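(* There exists a (universal) constant $C$ such that the following holds. Let $M^2$ be a closed oriented Riemannian surface, $R>0$, and $\varphi:M^2\to\mathbb{R}^3$ an isometric immersion of class $C^2$ whose image is contained in the ball of radius $R$. Let $U\subset M$ be an open set with smooth boundary. Then $$\mathrm{Area}(U)\le R^2\Big(T(U)+C\,\mathrm{Length}(\mathrm{Gauss}_{\partial U})+\frac{1}{2R}\,\mathrm{Length}(\partial U)\Big).$$
   Context: Closed means compact without boundary. $\mathrm{Gauss}:M\to\mathbb{S}^2$ is the unit normal map of the oriented immersed surface, and $T(U)=\int_U|\mathcal{K}|\,dS$ with $\mathcal{K}$ the Gauss curvature. $\mathrm{Length}(\mathrm{Gauss}_{\partial U})$ is the length, counted with multiplicity, of the image of $\partial U$ under the Gauss map, i.e. $\int_{\partial U}|d\,\mathrm{Gauss}(\tau)|\,ds$ with $\tau$ a unit tangent vector to $\partial U$. The Gauss map is not assumed to be non-degenerate on $U$. The ball is the closed ball of radius $R$ centred at the origin. *)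

(* Defs.v *)
From HB Require Import structures.
From mathcomp Require Import all_boot all_order all_algebra.
From mathcomp Require Import all_classical all_reals all_analysis.

Set Implicit Arguments.
Unset Strict Implicit.
Unset Printing Implicit Defensive.

Import Order.TTheory GRing.Theory Num.Theory.
Import numFieldNormedType.Exports.

Local Open Scope classical_set_scope.
Local Open Scope ring_scope.

(* Class C^k on an open set of a finite-dimensional space, through iterated
   directional derivatives. *)
Fixpoint Ck (R : realType) (V W : normedModType R) (k : nat) (O : set V)
    (f : V -> W) : Prop :=
  match k with
  | 0 => {in O, continuous f}
  | k'.+1 => {in O, continuous f} /\
      forall v, (forall x, O x -> derivable f x v) /\
                Ck k' O (fun x => 'D_v f x)
  end.

Definition smooth (R : realType) (V W : normedModType R) (O : set V)
  (f : V -> W) : Prop := forall k, Ck k O f.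

Definition plane (R : realType) : normedModType R := (R * R)%type.

Definition plane_basis (R : realType) (a : 'I_2) : plane R :=
  if a == 0 then (1, 0) else (0, 1).

Definition jacobian_det (R : realType) (f : plane R -> plane R)
    (x : plane R) : R :=
  let u := 'D_(plane_basis R 0) f x in
  let v := 'D_(plane_basis R 1) f x in
  u.1 * v.2 - u.2 * v.1.

Definition lebesgue_plane (R : realType) :
    {measure set (measurableTypeR R * measurableTypeR R) -> \bar R} :=
  (@lebesgue_measure R \x @lebesgue_measure R)%E.

(* The normed module structure of 'rV[R]_3 carries the sup norm; the
   Euclidean structure is the one below. *)
Definition dotv (R : realType) (u v : 'rV[R]_3) : R := \sum_i u 0 i * v 0 i.

Definition normv (R : realType) (u : 'rV[R]_3) : R := Num.sqrt (dotv u u).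

Definition crossv (R : realType) (u v : 'rV[R]_3) : 'rV[R]_3 :=
  let u_ (k : nat) := u 0 (inord k) in
  let v_ (k : nat) := v 0 (inord k) in
  \row_(k < 3)
    [:: u_ 1 * v_ 2 - u_ 2 * v_ 1;
        u_ 2 * v_ 0 - u_ 0 * v_ 2;
        u_ 0 * v_ 1 - u_ 1 * v_ 0]`_k.

(* A smooth oriented surface without boundary: a Hausdorff space with an
   oriented smooth atlas modelled on open sets of the plane. Both [chart i] and
   its inverse [param i] are total functions, meaningful only on [dom i] and on
   [chart i @` dom i]. [chart_at p] is a preferred chart around p.
   Second countability is not recorded: it follows from compactness. *)
Record oriented_surface (R : realType) := OrientedSurface {
  points :> topologicalType;
  chart_index : Type;
  dom : chart_index -> set points;
  chart : chart_index -> points -> plane R;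
  param : chart_index -> plane R -> points;
  chart_at : points -> chart_index;
  surface_hausdorff : hausdorff_space points;
  dom_chart_at : forall p, dom (chart_at p) p;
  dom_open : forall i, open (dom i);
  codom_open : forall i, open (chart i @` dom i);
  chartK : forall i p, dom i p -> param i (chart i p) = p;
  chart_continuous : forall i, {in dom i, continuous (chart i)};
  param_continuous : forall i,
    {in chart i @` dom i, continuous (param i)};
  transition_smooth : forall i j,
    smooth (chart i @` (dom i `&` dom j)) (chart j \o param i);
  transition_oriented : forall i j x,
    (chart i @` (dom i `&` dom j)) x ->
    0 < jacobian_det (chart j \o param i) x
}.

Definition chart_codom (R : realType) (M : oriented_surface R)
  (i : chart_index M) : set (plane R) := chart i @` dom i.

Definition closed_surface (R : realType) (M : oriented_surface R) : Prop :=
  compact [set: M].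

(* [metric i x v w] is the product of the tangent vectors with coordinates v
   and w in the chart i, at the point of coordinates x. C^1 is the regularity
   of a metric induced by an immersion of class C^2. *)
Record riemannian_metric (R : realType) (M : oriented_surface R) :=
    RiemannianMetric {
  metric :> chart_index M -> plane R -> plane R -> plane R -> R;
  metric_linear : forall i x, chart_codom i x -> forall a v v' w,
    metric i x (a *: v + v') w = a * metric i x v w + metric i x v' w;
  metric_sym : forall i x, chart_codom i x -> forall v w,
    metric i x v w = metric i x w v;
  metric_pos : forall i x, chart_codom i x -> forall v,
    v != 0 -> 0 < metric i x v v;
  metric_C1 : forall i v w,
    Ck 1 (chart_codom i) (fun x => metric i x v w : R);
  metric_transition : forall i j x,
    (chart i @` (dom i `&` dom j)) x ->
    let f := chart j \o param i in
    forall v w, metric i x v w = metric j (f x) ('D_v f x) ('D_w f x)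
}.

Definition first_form (R : realType) (M : oriented_surface R)
    (g : riemannian_metric M) (i : chart_index M) (x : plane R) : 'M[R]_2 :=
  \matrix_(a, b) g i x (plane_basis R a) (plane_basis R b).

(* The integral over A of f >= 0 with respect to the Riemannian area
   dS = sqrt (det g) dx dy: the supremum over finite disjoint families of
   measurable pieces of A, each lying in the domain of a chart. It is attained
   on the finite partitions of A, which exist when M is compact and A Borel. *)
Definition surface_integral (R : realType) (M : oriented_surface R)
    (g : riemannian_metric M) (A : set M) (f : M -> R) : \bar R :=
  ereal_sup [set z | exists (n : nat) (i : 'I_n -> chart_index M)
      (B : 'I_n -> set M),
    [/\ forall k, B k `<=` A `&` dom (i k),
        forall k, measurable (chart (i k) @` B k :
                                set (measurableTypeR R * measurableTypeR R)),
        trivIset [set: 'I_n] B &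
        z = (\sum_(k < n) \int[lebesgue_plane R]_(x in chart (i k) @` B k)
               (f (param (i k) x) * Num.sqrt (\det (first_form g (i k) x)))%:E)%E]].

Definition area (R : realType) (M : oriented_surface R)
    (g : riemannian_metric M) (A : set M) : \bar R :=
  surface_integral g A (fun=> 1).

(* A parametrized arc in the domain of a chart, given in coordinates on the
   open interval ]arc_lo, arc_hi[. *)
Record surface_arc (R : realType) (M : oriented_surface R) := SurfaceArc {
  arc_chart : chart_index M;
  arc_lo : R;
  arc_hi : R;
  arc_fun : R -> plane R
}.

Definition arc_image (R : realType) (M : oriented_surface R) (c : surface_arc M) :
    set M :=
  (param (arc_chart c) \o arc_fun c) @` (`]arc_lo c, arc_hi c[).

Definition regular_simple_arc (R : realType) (M : oriented_surface R)
    (S : set M) (c : surface_arc M) : Prop :=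
  let I : set R := `]arc_lo c, arc_hi c[%classic in
  [/\ arc_fun c @` I `<=` chart_codom (arc_chart c),
      arc_image c `<=` S,
      {in I &, injective (arc_fun c)},
      Ck 1 I (arc_fun c : R -> plane R) &
      forall t, I t -> 'D_1 (arc_fun c) t != 0].

(* For a compact curve S, the integral over S of f tau ds, where tau is a unit
   tangent vector of S, s the arc length, and f i x v >= 0 is a function of the
   tangent vector v at the point x, both read in the chart i: the supremum over
   finite disjoint families of regular simple arcs in S. It is attained when
   only finitely many points of S are left out. *)
Definition curve_integral (R : realType) (M : oriented_surface R)
    (g : riemannian_metric M) (S : set M)
    (f : chart_index M -> plane R -> plane R -> R) : \bar R :=
  ereal_sup [set z | exists (n : nat) (c : 'I_n -> surface_arc M),
    [/\ forall k, regular_simple_arc S (c k),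
        trivIset [set: 'I_n] (fun k => arc_image (c k)) &
        z = (\sum_(k < n)
               \int[@lebesgue_measure R]_(t in `]arc_lo (c k), arc_hi (c k)[)
                 (let i := arc_chart (c k) in
                  let x := arc_fun (c k) t in
                  let v := 'D_1 (arc_fun (c k)) t in
                  let speed := Num.sqrt (g i x v v) in
                  f i x (speed^-1 *: v) * speed)%:E)%E]].

Definition curve_length (R : realType) (M : oriented_surface R)
    (g : riemannian_metric M) (S : set M) : \bar R :=
  curve_integral g S (fun _ _ _ => 1).

Definition isometric_immersion_C2 (R : realType) (M : oriented_surface R)
    (g : riemannian_metric M) (phi : M -> 'rV[R]_3) : Prop :=
  forall i, let X : plane R -> 'rV[R]_3 := phi \o param i in
  [/\ Ck 2 (chart_codom i) X,
      forall x, chart_codom i x -> forall v, 'D_v X x = 0 -> v = 0 &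
      forall x, chart_codom i x ->
        forall v w, g i x v w = dotv ('D_v X x) ('D_w X x)].

(* The preferred chart at p is used; the atlas being oriented, any chart around
   p yields the same unit normal vector. *)
Definition gauss_map (R : realType) (M : oriented_surface R)
    (phi : M -> 'rV[R]_3) (p : M) : 'rV[R]_3 :=
  let i := chart_at p in
  let X : plane R -> 'rV[R]_3 := phi \o param i in
  let n := crossv ('D_(plane_basis R 0) X (chart i p))
                  ('D_(plane_basis R 1) X (chart i p)) in
  (normv n)^-1 *: n.

(* det II / det I, in the preferred chart at p. *)
Definition gauss_curvature (R : realType) (M : oriented_surface R)
    (g : riemannian_metric M) (phi : M -> 'rV[R]_3) (p : M) : R :=
  let i := chart_at p in
  let X : plane R -> 'rV[R]_3 := phi \o param i in
  let second_form : 'M[R]_2 := \matrix_(a, b)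
    dotv ('D_(plane_basis R a) (fun x => 'D_(plane_basis R b) X x) (chart i p))
         (gauss_map phi p) in
  \det second_form / \det (first_form g i (chart i p)).

Definition total_curvature (R : realType) (M : oriented_surface R)
    (g : riemannian_metric M) (phi : M -> 'rV[R]_3) (A : set M) : \bar R :=
  surface_integral g A (fun p => `|gauss_curvature g phi p|).

Definition gauss_length (R : realType) (M : oriented_surface R)
    (g : riemannian_metric M) (phi : M -> 'rV[R]_3) (S : set M) : \bar R :=
  curve_integral g S (fun i x v =>
    normv ('D_v (gauss_map phi \o param i : plane R -> 'rV[R]_3) x)).

Definition boundary (T : topologicalType) (A : set T) : set T :=
  closure A `\` A°.

(* Near each boundary point, U is a strict sublevel set {rho < 0} of a smooth
   function without critical points. *)
Definition smooth_boundary (R : realType) (M : oriented_surface R)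
    (U : set M) : Prop :=
  forall p, boundary U p ->
  exists (i : chart_index M) (W : set M) (rho : plane R -> R),
    [/\ open W /\ W p, W `<=` dom i, smooth (chart i @` W) rho,
        forall x, (chart i @` W) x -> exists v, 'D_v rho x != 0 &
        forall q, W q -> (U q <-> rho (chart i q) < 0)].

(* Main.v *)
(** Let X be the immersion, N its unit normal, h = <X, N>, and consider the 1-form
    omega = - (det (X, N, dX) + h det (X, N, dN)) / 2.  Then d omega = (1 - K q) dS with
    q = (3 h^2 - |X|^2) / 2, and |q| <= R^2 because |h| <= |X| <= R.  Hence
    Area U <= R^2 T(U) + int_U d omega, and Green's formula bounds the last term by the integral over
    the boundary of |omega| <= R/2 |dX| + R^2/2 |dN|: the constant C = 1/2 works, whatever the degeneracy
    of N.  Although dN is merely continuous, omega is a sum of terms f dg with f and g of class C^1, so that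
    d omega is a sum of brackets df /\ dg, which are invariant under C^1 changes of coordinates and
    satisfy Green's formula.  A C^1 partition of unity reduces the formula to
    square patches that U fills, misses, or meets in their lower half. *)

From HB Require Import structures.
Require Import Defs.
From mathcomp Require Import all_boot all_order all_algebra.
From mathcomp Require Import all_classical all_reals all_analysis.
From mathcomp Require Import measurable_realfun ring lra.

Set Implicit Arguments.
Unset Strict Implicit.
Unset Printing Implicit Defensive.

Import Order.TTheory GRing.Theory Num.Theory.
Import numFieldNormedType.Exports.

Local Open Scope classical_set_scope.
Local Open Scope ring_scope.

(** * Functions of class C1 on the plane *)

Section C1_functions.
Context {R : realType}.
Local Notation P := (plane R).
Implicit Types (z v : P) (O : set P).

(** The shape of omega is dictated by the mean curvature, which neither T(U) nor the boundary data
    control. The derivative of det (X, N, dX) is -2 dS plus h times a multiple of the mean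
    curvature; the derivative of h det (X, N, dN) contains the same mean curvature term with the
    opposite sign, next to multiples of K dS. In the sum only K survives.

    A second difficulty is that area, total curvature and lengths are suprema over finite disjoint
    families. The upper bound on the area has to treat an arbitrary family, and as d omega has no
    sign, that family must be completed to a partition of U before it is integrated. Total curvature
    and lengths, on the other hand, need only be bounded below by well-chosen families. For the
    lengths this means cutting the edges of overlapping patches into disjoint arcs on which the
    weights of the partition of unity still add up to 1.

    Brackets are carried between charts and patches by a change of variables formula for C1
    diffeomorphisms, itself a consequence of Green's formula. *)

Lemma plane_basis0 : plane_basis R 0 = (1, 0). Proof. by []. Qed.
Lemma plane_basis1 : plane_basis R 1 = (0, 1). Proof. by []. Qed.

Lemma plane_decomp v : v = v.1 *: plane_basis R 0 + v.2 *: plane_basis R 1.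
Proof.
case: v => a b; rewrite plane_basis0 plane_basis1 /=.
rewrite -[LHS]/((a, b) : R * R).
by congr pair; rewrite /= /GRing.scale /=; ring.
Qed.

Lemma derive_plane (W : normedModType R) (f : P -> W) z v :
  differentiable f z ->
  'D_v f z = v.1 *: 'D_(plane_basis R 0) f z + v.2 *: 'D_(plane_basis R 1) f z.
Proof.
move=> df; rewrite !deriveE// {1}(plane_decomp v).
by rewrite linearD !linearZ.
Qed.

Lemma is_derive_line (W : normedModType R) (f : P -> W) z v (h : R) df :
  is_derive (h *: v + z) v f df -> is_derive h 1 (fun h : R => f (h *: v + z)) df.
Proof.
move=> [dv dvE].
have E : (fun k : R => k^-1 *: (f (k *: v + (h *: v + z)) - f (h *: v + z))) =
  (fun k : R => k^-1 *: (f ((k%:A + h) *: v + z) - f (h *: v + z))).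
  by apply/funext => k; rewrite addrA -scalerDl [_%:A]mulr1.
apply: DeriveDef; first by move: dv; rewrite /derivable E.
by rewrite -dvE /derive; congr (lim _); rewrite E.
Qed.

(** The mean value theorem from 0 to [h] for [h] of either sign, as the increments to which it is
    applied have no fixed sign. *)
Lemma MVT_symmetric (g dg : R -> R) (h : R) :
  (forall t : R, `|t| <= `|h| -> is_derive t 1 g (dg t)) ->
  exists2 c, `|c| <= `|h| & g h - g 0 = dg c * h.
Proof.
move=> dgE.
have cg (a b : R) : (forall t, t \in `[a, b] -> `|t| <= `|h|) -> {within `[a, b], continuous g}.
  move=> H; apply: derivable_within_continuous => t /H /dgE [].
  by [].
have [h0|h0] := leP 0 h.
  have H t : t \in `[0, h] -> `|t| <= `|h|.
    by rewrite in_itv/= => /andP[t0 th]; rewrite !ger0_norm.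
  have [|c cI ->] := @MVT_segment R g dg 0 h h0 _ (cg _ _ H).
    by move=> t tI; apply/dgE/H/(subset_itv_oo_cc tI).
  by exists c; [exact: H|rewrite subr0].
have H t : t \in `[h, 0] -> `|t| <= `|h|.
  by rewrite in_itv/= => /andP[t0 th]; rewrite !ler0_norm ?lerN2// ltW.
have [|c cI E] := @MVT_segment R g dg h 0 (ltW h0) _ (cg _ _ H).
  by move=> t tI; apply/dgE/H/(subset_itv_oo_cc tI).
by exists c; [exact: H|rewrite -opprB E sub0r mulrN opprK].
Qed.

(** The differential with partial derivatives [a] and [b], as an explicit linear map: one [is_diff]
    statement then records both partials. *)
Definition linear_form (a b : R) (v : P) : R := v.1 * a + v.2 * b.

Lemma linear_form_is_linear a b : linear (linear_form a b).
Proof. by move=> k [x y] [x' y']; rewrite /linear_form/= /GRing.scale/=; ring. Qed.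

HB.instance Definition _ a b :=
  GRing.isLinear.Build R P R _ (linear_form a b) (linear_form_is_linear a b).

Lemma linear_form_continuous a b : continuous (linear_form a b).
Proof.
move=> z; apply: cvgD; apply: cvgM; (try exact: cvg_cst).
- exact: cvg_fst.
- exact: cvg_snd.
Qed.

Lemma plane_norm_fst z : `|z.1| <= `|z|.
Proof. by rewrite prod_normE le_max lexx. Qed.

Lemma plane_norm_snd z : `|z.2| <= `|z|.
Proof. by rewrite prod_normE le_max lexx orbT. Qed.

(** The increment is split along a vertical and a horizontal segment. The mean value theorem on each
    leaves values of [q] and [p] near [z], which continuity compares with [q z] and [p z]. *)
Lemma is_diff_partials O (f p q : P -> R) : open O ->
  (forall z, O z -> is_derive z (plane_basis R 0) f (p z)) ->
  (forall z, O z -> is_derive z (plane_basis R 1) f (q z)) ->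
  {in O, continuous p} -> {in O, continuous q} ->
  forall z, O z -> is_diff z f (linear_form (p z) (q z)).
Proof.
move=> oO dp dq cp cq z Oz.
have cL : continuous (linear_form (p z) (q z)) by exact: linear_form_continuous.
suff H : f \o shift z = cst (f z) + linear_form (p z) (q z) +o_ 0 id.
  have E := diff_unique cL H.
  by apply: DiffDef => //; apply/diff_locallyP; rewrite E.
apply/eqaddoP => _/posnumP[eps].
have Oz' : z \in O by rewrite inE.
have e2 : 0 < eps%:num / 2 by [].
have /cvgrPdist_le/(_ _ e2)/nbhs_ballP[r1 /= r10 H1] := cp z Oz'.
have /cvgrPdist_le/(_ _ e2)/nbhs_ballP[r2 /= r20 H2] := cq z Oz'.
have /nbhs_ballP[r3 /= r30 H3] := open_nbhs_nbhs (conj oO Oz).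
apply/nbhs_ballP; exists (Num.min r1 (Num.min r2 r3)) => /=.
  by rewrite !lt_min r10 r20 r30.
move=> h; rewrite -ball_normE /= sub0r normrN !lt_min => /and3P[hr1 hr2 hr3].
have B (w : P) r : `|w| <= `|h| -> `|h| < r -> ball z r (w + z).
  by move=> wh hr; rewrite -ball_normE/= opprD addrCA subrr addr0 normrN (le_lt_trans wh).
have n0 (t s : R) : `|t| <= `|h.1| -> `|s| <= `|h.2| -> `|((t, s) : P)| <= `|h|.
  move=> th sh; rewrite [leLHS]prod_normE/= ge_max.
  by rewrite (le_trans th) ?plane_norm_fst// (le_trans sh) ?plane_norm_snd.
pose w t s : P := (t, s) + z.
have Ew0 t s : w t s = t *: plane_basis R 0 + w 0 s.
  by rewrite /w plane_basis0 addrA; congr (_ + _); congr pair; rewrite /= /GRing.scale/=; ring.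
have Ew1 t : w 0 t = t *: plane_basis R 1 + z.
  by rewrite /w plane_basis1; congr (_ + _); congr pair; rewrite /= /GRing.scale/=; ring.
have [|c ch Ec] := @MVT_symmetric (fun t => f (w t h.2)) (fun t => p (w t h.2)) h.1.
  move=> t th; rewrite [X in is_derive _ _ X _](_ : _ = fun t => f (t *: plane_basis R 0 + w 0 h.2)).
    by apply: is_derive_line; rewrite -Ew0; apply/dp/H3/B => //; apply: n0.
  by apply/funext => u; rewrite -Ew0.
have [|d dh Ed] := @MVT_symmetric (fun t => f (w 0 t)) (fun t => q (w 0 t)) h.2.
  move=> t th; rewrite [X in is_derive _ _ X _](_ : _ = fun t => f (t *: plane_basis R 1 + z)).
    by apply: is_derive_line; rewrite -Ew1; apply/dq/H3/B => //; apply: n0; rewrite ?normr0.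
  by apply/funext => u; rewrite -Ew1.
have Ez : w 0 0 = z by rewrite /w -[(0, 0)]/(0 : P) add0r.
have Eh : w h.1 h.2 = h + z by rewrite /w; case: (h).
rewrite /= !fctE /= -Eh /linear_form.
have -> : f (w h.1 h.2) - (f z + (h.1 * p z + h.2 * q z)) =
   (p (w c h.2) - p z) * h.1 + (q (w 0 d) - q z) * h.2.
  by rewrite !mulrBl -Ec -Ed Ez; ring.
rewrite (le_trans (ler_normD _ _))// !normrM (splitr eps%:num) mulrDl lerD//.
- apply: ler_pM => //; last exact: plane_norm_fst.
  by rewrite distrC; apply/H1/B => //; apply: n0.
- apply: ler_pM => //; last exact: plane_norm_snd.
  by rewrite distrC; apply/H2/B => //; apply: n0; rewrite ?normr0.
Qed.

Lemma is_diff_linear_formE (f : P -> R) z a b v :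
  is_diff z f (linear_form a b) -> 'D_v f z = linear_form a b v.
Proof. by move=> [df dfE]; rewrite deriveE// dfE. Qed.

Definition dx (f : P -> R) z : R := 'D_(plane_basis R 0) f z.
Definition dy (f : P -> R) z : R := 'D_(plane_basis R 1) f z.

Lemma is_diff_dx (f : P -> R) z a b : is_diff z f (linear_form a b) -> dx f z = a.
Proof. by move=> /is_diff_linear_formE; rewrite /dx => ->; rewrite /linear_form plane_basis0/=; ring. Qed.

Lemma is_diff_dy (f : P -> R) z a b : is_diff z f (linear_form a b) -> dy f z = b.
Proof. by move=> /is_diff_linear_formE; rewrite /dy => ->; rewrite /linear_form plane_basis1/=; ring. Qed.

Lemma differentiable_is_diff (f : P -> R) z : differentiable f z ->
  is_diff z f (linear_form (dx f z) (dy f z)).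
Proof.
move=> df; apply: DiffDef => //; apply/funext => v.
by rewrite -deriveE// derive_plane// /linear_form.
Qed.

Lemma dxE (f : P -> R) z : 'D_(plane_basis R 0) f z = dx f z. Proof. by []. Qed.

Lemma dyE (f : P -> R) z : 'D_(plane_basis R 1) f z = dy f z. Proof. by []. Qed.

Opaque dx dy.

(** Two partials stand for the derivatives in all directions of [Ck 1]; this makes sums, products
    and composites easy to treat. *)
Definition C1 O (f : P -> R) := forall z, O z ->
  [/\ differentiable f z, {for z, continuous (dx f)} & {for z, continuous (dy f)}].

Lemma for_continuous_eq (T U : topologicalType) (O : set T) (f g : T -> U) (z : T) : open O -> O z ->
  (forall y, O y -> f y = g y) -> {for z, continuous f} -> {for z, continuous g}.
Proof.
move=> oO Oz fg cf; rewrite /prop_for /continuous_at -fg//.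
apply: cvg_trans cf; apply: near_eq_cvg.
by apply: filterS (open_nbhs_nbhs (conj oO Oz)) => y Oy; rewrite fg.
Qed.

Lemma C1_is_diff O (f p q : P -> R) : open O ->
  (forall z, O z -> is_diff z f (linear_form (p z) (q z))) ->
  {in O, continuous p} -> {in O, continuous q} -> C1 O f.
Proof.
move=> oO df cp cq z Oz; have Oz' : z \in O by rewrite inE.
split; first by have [] := df _ Oz.
- by apply: (for_continuous_eq oO Oz _ (cp _ Oz')) => y /df /is_diff_dx.
- by apply: (for_continuous_eq oO Oz _ (cq _ Oz')) => y /df /is_diff_dy.
Qed.

Lemma C1_diff O (f : P -> R) z : C1 O f -> O z -> is_diff z f (linear_form (dx f z) (dy f z)).
Proof. by move=> fC /fC[df _ _]; exact: differentiable_is_diff. Qed.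

Lemma C1_continuous O (f : P -> R) : C1 O f -> {in O, continuous f}.
Proof. by move=> fC z; rewrite inE => /fC[/differentiable_continuous]. Qed.

Lemma C1_dx O (f : P -> R) : C1 O f -> {in O, continuous (dx f)}.
Proof. by move=> fC z; rewrite inE => Oz; have [_ H _] := fC z Oz; exact: H. Qed.

Lemma C1_dy O (f : P -> R) : C1 O f -> {in O, continuous (dy f)}.
Proof. by move=> fC z; rewrite inE => Oz; have [_ _ H] := fC z Oz; exact: H. Qed.

Lemma C1_sub O O' (f : P -> R) : O' `<=` O -> C1 O f -> C1 O' f.
Proof. by move=> s fC z /s /fC. Qed.

Lemma C1_eq O (f g : P -> R) : open O -> (forall z, O z -> f z = g z) -> C1 O f -> C1 O g.
Proof.
move=> oO fg fC.
have nfg z : O z -> \near z, f z = g z.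
  by move=> Oz; apply: filterS (open_nbhs_nbhs (conj oO Oz)) => y Oy; rewrite fg.
have D v : forall z, O z -> is_derive z v g ('D_v f z).
  move=> z Oz; apply: near_eq_is_derive (nfg _ Oz) _.
  by apply: derivableP; apply: diff_derivable; have [] := fC _ Oz.
have D0 z : O z -> is_derive z (plane_basis R 0) g (dx f z) by rewrite -dxE; exact: D.
have D1 z : O z -> is_derive z (plane_basis R 1) g (dy f z) by rewrite -dyE; exact: D.
have c0 := C1_dx fC; have c1 := C1_dy fC.
exact: C1_is_diff oO (is_diff_partials oO D0 D1 c0 c1) c0 c1.
Qed.

Lemma Ck1_C1 O (f : P -> R) : open O -> Ck 1 O f -> C1 O f.
Proof.
move=> oO [_ fC].
have D0 z : O z -> is_derive z (plane_basis R 0) f (dx f z).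
  by move=> Oz; rewrite -dxE; apply: derivableP; exact: (fC _).1.
have D1 z : O z -> is_derive z (plane_basis R 1) f (dy f z).
  by move=> Oz; rewrite -dyE; apply: derivableP; exact: (fC _).1.
have c0 : {in O, continuous (dx f)} := (fC (plane_basis R 0)).2.
have c1 : {in O, continuous (dy f)} := (fC (plane_basis R 1)).2.
exact: C1_is_diff oO (is_diff_partials oO D0 D1 c0 c1) c0 c1.
Qed.

Lemma C1_cst O (c : R) : open O -> C1 O (fun=> c).
Proof.
move=> oO; apply: (C1_is_diff (p := fun=> 0) (q := fun=> 0) oO); try by move=> z _; exact: cvg_cst.
move=> z _; apply: is_diff_eq (is_diff_cst c z) _.
by apply/funext => v; rewrite /linear_form !mulr0 addr0.
Qed.

Lemma C1_linear_form O a b : open O -> C1 O (linear_form a b).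
Proof.
move=> oO; apply: (C1_is_diff (p := fun=> a) (q := fun=> b) oO); try by move=> z _; exact: cvg_cst.
move=> z _; apply: DiffDef; first exact/linear_differentiable/linear_form_continuous.
by rewrite diff_lin//; exact: linear_form_continuous.
Qed.

Lemma C1_fst O : open O -> C1 O fst.
Proof. by move=> oO; apply: C1_eq (C1_linear_form 1 0 oO) => // z _; rewrite /linear_form; ring. Qed.

Lemma C1_snd O : open O -> C1 O snd.
Proof. by move=> oO; apply: C1_eq (C1_linear_form 0 1 oO) => // z _; rewrite /linear_form; ring. Qed.

Lemma C1D O (f g : P -> R) : open O -> C1 O f -> C1 O g -> C1 O (fun z => f z + g z).
Proof.
move=> oO fC gC; apply: (C1_is_diff (p := fun z => dx f z + dx g z) (q := fun z => dy f z + dy g z) oO).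
- move=> z Oz; apply: is_diff_eq (is_diffD (C1_diff fC Oz) (C1_diff gC Oz)) _.
  by apply/funext => v; rewrite !fctE /linear_form; ring.
- by move=> z Oz; apply: cvgD; [exact: C1_dx fC _ Oz|exact: C1_dx gC _ Oz].
- by move=> z Oz; apply: cvgD; [exact: C1_dy fC _ Oz|exact: C1_dy gC _ Oz].
Qed.

Lemma C1M O (f g : P -> R) : open O -> C1 O f -> C1 O g -> C1 O (fun z => f z * g z).
Proof.
move=> oO fC gC; apply: (C1_is_diff (p := fun z => f z * dx g z + g z * dx f z)
  (q := fun z => f z * dy g z + g z * dy f z) oO).
- move=> z Oz; apply: is_diff_eq (is_diffM (C1_diff fC Oz) (C1_diff gC Oz)) _.
  by apply/funext => v; rewrite !fctE /linear_form /GRing.scale/=; ring.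
- move=> z Oz; have cf := C1_continuous fC Oz; have cg := C1_continuous gC Oz.
  by apply: cvgD; (apply: cvgM; first by []); [exact: C1_dx gC _ Oz|exact: C1_dx fC _ Oz].
- move=> z Oz; have cf := C1_continuous fC Oz; have cg := C1_continuous gC Oz.
  by apply: cvgD; (apply: cvgM; first by []); [exact: C1_dy gC _ Oz|exact: C1_dy fC _ Oz].
Qed.

Lemma C1N O (f : P -> R) : open O -> C1 O f -> C1 O (fun z => - f z).
Proof. by move=> oO fC; apply: C1_eq (C1M oO (C1_cst (-1) oO) fC) => // z _; rewrite mulN1r. Qed.

Lemma C1B O (f g : P -> R) : open O -> C1 O f -> C1 O g -> C1 O (fun z => f z - g z).
Proof. by move=> oO fC gC; exact: C1D oO fC (C1N oO gC). Qed.

Lemma C1_sum O (I : Type) (r : seq I) (f : I -> P -> R) : open O ->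
  (forall i, C1 O (f i)) -> C1 O (fun z => \sum_(i <- r) f i z).
Proof.
move=> oO fC; elim: r => [|i r IH].
  by apply: C1_eq (C1_cst 0 oO) => // z _; rewrite big_nil.
by apply: C1_eq (C1D oO (fC i) IH) => // z _; rewrite big_cons.
Qed.

Lemma is_diff_outer (h : R -> R) (f : P -> R) z dh a b :
  is_derive (f z) 1 h dh -> is_diff z f (linear_form a b) ->
  is_diff z (h \o f) (linear_form (dh * a) (dh * b)).
Proof.
move=> [dv dvE] df.
have dv' : differentiable h (f z) by exact/derivable1_diffP.
apply: is_diff_eq (is_diff_comp df (differentiableP dv')) _.
apply/funext => v /=; rewrite diff1E// derive1E dvE /linear_form /GRing.scale/=; ring.
Qed.

Lemma C1_outer O (h dh : R -> R) (f : P -> R) : open O -> C1 O f ->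
  (forall z, O z -> is_derive (f z) 1 h (dh (f z)) /\ {for f z, continuous dh}) ->
  C1 O (h \o f).
Proof.
move=> oO fC hC; apply: (C1_is_diff (p := fun z => dh (f z) * dx f z) (q := fun z => dh (f z) * dy f z) oO).
- by move=> z Oz; apply: is_diff_outer; [exact: (hC _ Oz).1|exact: C1_diff fC Oz].
- move=> z Oz; apply: cvgM; last exact: C1_dx fC _ Oz.
  have Oz' : O z by rewrite inE in Oz.
  by apply: (@continuous_comp _ _ _ f dh); [exact: C1_continuous fC _ Oz|exact: (hC _ Oz').2].
- move=> z Oz; apply: cvgM; last exact: C1_dy fC _ Oz.
  have Oz' : O z by rewrite inE in Oz.
  by apply: (@continuous_comp _ _ _ f dh); [exact: C1_continuous fC _ Oz|exact: (hC _ Oz').2].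
Qed.

Lemma C1V O (f : P -> R) : open O -> C1 O f -> (forall z, O z -> f z != 0) -> C1 O (fun z => (f z)^-1).
Proof.
move=> oO fC f0; apply: (C1_outer (h := GRing.inv) (dh := fun t => - (t ^- 2)) oO fC) => z Oz.
have n0 := f0 _ Oz; split; last first.
  apply: continuousN; apply: continuousV; last exact: exprn_continuous.
  by rewrite expf_neq0.
have dv : derivable id (f z) (1 : R) by exact: derivable_id.
apply: DeriveDef; first exact: derivableV n0 dv.
by rewrite (@deriveV _ _ id)// derive_id [_%:A]mulr1.
Qed.

Definition C1map O (F : P -> P) := C1 O (fst \o F) /\ C1 O (snd \o F).
(** The coefficient of df /\ dg on dx /\ dy. The Jacobian determinant [jac] is the bracket of the
    two components of a map. *)
Definition br (f g : P -> R) z := dx f z * dy g z - dy f z * dx g z.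
Definition jac (F : P -> P) := br (fst \o F) (snd \o F).

Lemma is_diff_map (F : P -> P) z a b c d :
  is_diff z (fst \o F) (linear_form a b) -> is_diff z (snd \o F) (linear_form c d) ->
  is_diff z F (fun v => (linear_form a b v, linear_form c d v)).
Proof.
move=> d1 d2; have := is_diff_pair d1 d2.
by congr (is_diff _ _ _); apply/funext => x /=; case: (F x).
Qed.

Lemma is_diff_comp_map (f : P -> R) (F : P -> P) z p q a b c d :
  is_diff z (fst \o F) (linear_form a b) -> is_diff z (snd \o F) (linear_form c d) ->
  is_diff (F z) f (linear_form p q) ->
  is_diff z (f \o F) (linear_form (a * p + c * q) (b * p + d * q)).
Proof.
move=> d1 d2 df; apply: is_diff_eq (is_diff_comp (is_diff_map d1 d2) df) _.
by apply/funext => v; rewrite /linear_form/=; ring.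
Qed.

Lemma continuous_pair (T U V : topologicalType) (f : T -> U) (g : T -> V) (z : T) :
  {for z, continuous f} -> {for z, continuous g} -> {for z, continuous (fun t => (f t, g t))}.
Proof. exact: (@cvg_pair _ _ _ (nbhs z) (nbhs (f z)) (nbhs (g z)) _ _ _ f g). Qed.

Lemma C1map_continuous O F : C1map O F -> {in O, continuous F}.
Proof.
move=> [F1 F2] z Oz.
rewrite (_ : F = fun t => ((F t).1, (F t).2)); last by apply/funext => t; case: (F t).
exact: (@continuous_pair P R R (fst \o F) (snd \o F) z (C1_continuous F1 Oz) (C1_continuous F2 Oz)).
Qed.

Lemma C1_comp O O' (f : P -> R) (F : P -> P) : open O -> C1map O F -> C1 O' f ->
  (forall z, O z -> O' (F z)) -> C1 O (f \o F).
Proof.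
move=> oO FC fC OO'; have [F1 F2] := FC.
apply: (C1_is_diff (p := fun z => dx (fst \o F) z * dx f (F z) + dx (snd \o F) z * dy f (F z))
  (q := fun z => dy (fst \o F) z * dx f (F z) + dy (snd \o F) z * dy f (F z)) oO).
- move=> z Oz; apply: is_diff_comp_map; first exact: C1_diff F1 Oz.
    exact: C1_diff F2 Oz.
  exact: C1_diff fC (OO' _ Oz).
- move=> z Oz; have Oz' : F z \in O' by rewrite inE; apply: OO'; rewrite inE in Oz.
  have cF := C1map_continuous FC Oz.
  apply: cvgD; apply: cvgM.
  + exact: C1_dx F1 _ Oz.
  + by apply: (@continuous_comp _ _ _ F (dx f)) => //; exact: C1_dx fC _ Oz'.
  + exact: C1_dx F2 _ Oz.
  + by apply: (@continuous_comp _ _ _ F (dy f)) => //; exact: C1_dy fC _ Oz'.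
- move=> z Oz; have Oz' : F z \in O' by rewrite inE; apply: OO'; rewrite inE in Oz.
  have cF := C1map_continuous FC Oz.
  apply: cvgD; apply: cvgM.
  + exact: C1_dy F1 _ Oz.
  + by apply: (@continuous_comp _ _ _ F (dx f)) => //; exact: C1_dx fC _ Oz'.
  + exact: C1_dy F2 _ Oz.
  + by apply: (@continuous_comp _ _ _ F (dy f)) => //; exact: C1_dy fC _ Oz'.
Qed.

Lemma C1map_comp O O' F G : open O -> C1map O F -> C1map O' G ->
  (forall z, O z -> O' (F z)) -> C1map O (G \o F).
Proof. by move=> oO FC [G1 G2] OO'; split; [exact: (C1_comp oO FC G1)|exact: (C1_comp oO FC G2)]. Qed.

(** The pullback of the 2-form df /\ dg. Only the chain rule for first derivatives enters, so that
    it holds in class C1. *)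
Lemma br_comp (f g : P -> R) F z : differentiable (fst \o F) z -> differentiable (snd \o F) z ->
  differentiable f (F z) -> differentiable g (F z) ->
  br (f \o F) (g \o F) z = br f g (F z) * jac F z.
Proof.
move=> /differentiable_is_diff d1 /differentiable_is_diff d2.
move=> /differentiable_is_diff df /differentiable_is_diff dg.
have Ef := is_diff_comp_map d1 d2 df; have Eg := is_diff_comp_map d1 d2 dg.
rewrite /jac /br (is_diff_dx Ef) (is_diff_dy Ef) (is_diff_dx Eg) (is_diff_dy Eg); ring.
Qed.

Lemma jac_comp F G z : differentiable (fst \o F) z -> differentiable (snd \o F) z ->
  differentiable (fst \o G) (F z) -> differentiable (snd \o G) (F z) ->
  jac (G \o F) z = jac G (F z) * jac F z.
Proof. by move=> *; rewrite {1}/jac -br_comp. Qed.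

Lemma br_C1_continuous O (f g : P -> R) : C1 O f -> C1 O g -> {in O, continuous (br f g)}.
Proof.
move=> fC gC z Oz.
have fx := C1_dx fC Oz; have fy := C1_dy fC Oz.
have gx := C1_dx gC Oz; have gy := C1_dy gC Oz.
by apply: cvgB; [exact: cvgM fx gy|exact: cvgM fy gx].
Qed.

Lemma near_br (f g f' g' : P -> R) z : (\near z, f z = f' z) -> (\near z, g z = g' z) ->
  br f g z = br f' g' z.
Proof. by move=> ff' gg'; rewrite /br -!dxE -!dyE !(near_eq_derive _ ff') !(near_eq_derive _ gg'). Qed.

Lemma is_derive_curve (f : P -> R) (c1 c2 : R -> R) (t d1 d2 : R) :
  differentiable f (c1 t, c2 t) -> is_derive t 1 c1 d1 -> is_derive t 1 c2 d2 ->
  is_derive t 1 (fun t => f (c1 t, c2 t)) (linear_form (dx f (c1 t, c2 t)) (dy f (c1 t, c2 t)) (d1, d2)).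
Proof.
move=> df [dc1 <-] [dc2 <-].
have d1' : differentiable c1 t by apply/derivable1_diffP; exact: dc1.
have d2' : differentiable c2 t by apply/derivable1_diffP; exact: dc2.
have dp := is_diff_pair (differentiableP d1') (differentiableP d2').
have [E1 E2] := is_diff_comp dp (differentiable_is_diff df).
have dd : derivable (fun t => f (c1 t, c2 t)) t 1 by apply/derivable1_diffP.
by apply: DeriveDef => //; rewrite deriveE//= E2/= !deriveE.
Qed.

End C1_functions.

(** * Green's formula on a rectangle *)

Section green.
Context {R : realType}.
Local Notation P := (plane R).
Local Notation mu := (@lebesgue_measure R).
Implicit Types (O : set P) (f g : P -> R).

Lemma is_derive_slice_x f x s : differentiable f (x, s) ->
  is_derive x 1 (fun x => f (x, s)) (dx f (x, s)).
Proof.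
move=> df; have := is_derive_curve df (is_derive_id x 1) (is_derive_cst s x 1).
by rewrite /linear_form/= mul1r mul0r addr0.
Qed.

Lemma is_derive_slice_y f x s : differentiable f (x, s) ->
  is_derive s 1 (fun s => f (x, s)) (dy f (x, s)).
Proof.
move=> df; have := is_derive_curve df (is_derive_cst x s 1) (is_derive_id s 1).
by rewrite /linear_form/= mul1r mul0r add0r.
Qed.

Lemma continuous_slice_x (f : P -> R) x s : {for (x, s), continuous f} ->
  {for x, continuous (fun x => f (x, s))}.
Proof.
move=> cf; apply: (@continuous_comp _ _ _ (fun x => ((x, s) : P)) f) => //.
exact: (@continuous_pair R R R id (cst s) x (@cvg_id _ _) (@cvg_cst _ _ _ _ _)).
Qed.

Lemma continuous_slice_y (f : P -> R) x s : {for (x, s), continuous f} ->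
  {for s, continuous (fun s => f (x, s))}.
Proof.
move=> cf; apply: (@continuous_comp _ _ _ (fun s => ((x, s) : P)) f) => //.
exact: (@continuous_pair R R R (cst x) id s (@cvg_cst _ _ _ _ _) (@cvg_id _ _)).
Qed.

Lemma continuous_compact_bound (T : topologicalType) (K : set T) (f : T -> R) :
  compact K -> {in K, continuous f} -> exists2 C : R, 0 <= C & forall z, K z -> `|f z| <= C.
Proof.
move=> cK cf; have cfK : {within K, continuous f} by exact: continuous_in_subspaceT.
have := compact_bounded (continuous_compact cfK cK).
move=> /pinfty_ex_gt0[C C0 HC]; exists C => [|z Kz]; first exact: ltW.
by apply: HC; exists z.
Qed.

Section box.
Variables (O : set P) (x0 x1 u v : R).
Hypotheses (x01 : x0 < x1) (uv : u < v).
Hypothesis boxO : `[x0, x1] `*` `[u, v] `<=` O.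

Lemma slice_integrable f s : {in O, continuous f} -> s \in `[u, v] ->
  mu.-integrable `[x0, x1] (fun x => (f (x, s))%:E).
Proof.
move=> cf sI; apply: continuous_compact_integrable; first exact: segment_compact.
apply: continuous_in_subspaceT => x xI; apply: continuous_slice_x; apply: cf.
by rewrite inE; apply: boxO; split => //; rewrite inE in xI.
Qed.

Lemma box_bound f : {in O, continuous f} ->
  exists2 C : R, 0 <= C & forall x s, x \in `[x0, x1] -> s \in `[u, v] -> `|f (x, s)| <= C.
Proof.
move=> cf.
have [||C C0 HC] := @continuous_compact_bound P (`[x0, x1] `*` `[u, v]) f.
- exact: compact_setX (@segment_compact _ _ _) (@segment_compact _ _ _).
- by move=> z; rewrite inE => /boxO Oz; apply: cf; rewrite inE.
- by exists C => // x s xI sI; apply: HC; split.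
Qed.

Variables (a b : P -> R).
Hypotheses (aC : C1 O a) (bC : C1 O b).
Hypothesis a0 : forall s, s \in `[u, v] -> a (x0, s) = 0 /\ a (x1, s) = 0.

Let phi s := \int[mu]_(x in `[x0, x1]) (a (x, s) * dx b (x, s)).
Let psi s := \int[mu]_(x in `[x0, x1]) (dy a (x, s) * dx b (x, s) - dx a (x, s) * dy b (x, s)).

Let ca : {in O, continuous a} := C1_continuous aC.
Let cb : {in O, continuous b} := C1_continuous bC.

Let OP x s : x \in `[x0, x1] -> s \in `[u, v] -> (x, s) \in O.
Proof. by move=> xI sI; rewrite inE; apply: boxO; split. Qed.

(** Integration by parts in x, without end terms since [a] vanishes at both ends. It takes the
    x-derivative off the increment of [b]: [dx b] is merely continuous, so its increment in s has no
    usable difference quotient, whereas that of [b] has one. *)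
Lemma by_parts_slice s s' : s \in `[u, v] -> s' \in `[u, v] ->
  \int[mu]_(x in `[x0, x1]) (a (x, s) * (dx b (x, s') - dx b (x, s))) =
  - \int[mu]_(x in `[x0, x1]) (dx a (x, s) * (b (x, s') - b (x, s))).
Proof.
move=> sI sI'.
have da x : x \in `[x0, x1] -> is_derive x 1 (fun x => a (x, s)) (dx a (x, s)).
  by move=> xI; apply: is_derive_slice_x; have [|] := aC (z := (x, s)); [have := OP xI sI; rewrite inE|].
have db t x : t \in `[u, v] -> x \in `[x0, x1] -> is_derive x 1 (fun x => b (x, t)) (dx b (x, t)).
  by move=> tI xI; apply: is_derive_slice_x; have [|] := bC (z := (x, t)); [have := OP xI tI; rewrite inE|].
have dbb x : x \in `[x0, x1] -> is_derive x 1 (fun x => b (x, s') - b (x, s)) (dx b (x, s') - dx b (x, s)).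
  by move=> xI; exact: is_deriveB (db _ _ sI' xI) (db _ _ sI xI).
have LR (F dF : R -> R) : (forall x, x \in `[x0, x1] -> is_derive x 1 F (dF x)) ->
    derivable_oo_LRcontinuous F x0 x1.
  move=> dFE; split.
  - by move=> x /subset_itv_oo_cc /dFE[].
  - apply: cvg_at_right_filter; apply: differentiable_continuous; apply/derivable1_diffP.
    by have [] := dFE x0; rewrite ?in_itv/= ?lexx ?ltW.
  - apply: cvg_at_left_filter; apply: differentiable_continuous; apply/derivable1_diffP.
    by have [] := dFE x1; rewrite ?in_itv/= ?lexx ?ltW.
rewrite (@Rintegration_by_parts R (fun x => a (x, s)) (fun x => b (x, s') - b (x, s))
  (fun x => dx a (x, s)) (fun x => dx b (x, s') - dx b (x, s)))//.
- by have [-> ->] := a0 sI; rewrite !mul0r subr0 sub0r.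
- apply: continuous_in_subspaceT => x xI; apply: continuous_slice_x; apply: C1_dx aC _ _.
  by apply: OP => //; rewrite inE in xI.
- exact: LR da.
- by move=> x /subset_itv_oo_cc /da[_]; rewrite derive1E.
- apply: continuous_in_subspaceT => x xI; rewrite inE in xI.
  apply: cvgB; apply: continuous_slice_x; apply: C1_dx bC _ _; exact: OP.
- exact: LR dbb.
- by move=> x /subset_itv_oo_cc /dbb[_]; rewrite derive1E.
Qed.

(** Formally, differentiating the slice integral of a db under the integral sign produces a mixed
    second derivative of [b]. Integrating by parts before the limit avoids it: the difference
    quotient of [phi] becomes the integral of [q], built from increments of [a] and [b] alone, and
    dominated convergence applies. *)
Lemma green_derive s : s \in `]u, v[ -> is_derive s 1 phi (psi s).
Proof.
move=> sI0.
have sI : s \in `[u, v] by exact: subset_itv_oo_cc.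
have [Ca Ca0 HCa] := box_bound (C1_dx aC).
have [Cb Cb0 HCb] := box_bound (C1_dx bC).
have [Da Da0 HDa] := box_bound (C1_dy aC).
have [Db Db0 HDb] := box_bound (C1_dy bC).
pose q t x := (a (x, t + s) - a (x, s)) / t * dx b (x, t + s) - dx a (x, s) * ((b (x, t + s) - b (x, s)) / t).
have cxb := C1_dx bC; have cxa := C1_dx aC; have cyb := C1_dy bC; have cya := C1_dy aC.
have cs f x t : {in O, continuous f} -> x \in `[x0, x1]%classic -> t \in `[u, v] ->
    {for x, continuous (fun x => f (x, t))}.
  by move=> cf xI tI; apply: continuous_slice_x; apply: cf; apply: OP => //; rewrite inE in xI.
have ci (h : R -> R) : (forall x, x \in `[x0, x1]%classic -> {for x, continuous h}) ->
    mu.-integrable `[x0, x1] (fun x => (h x)%:E).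
  move=> hc; apply: continuous_compact_integrable; first exact: segment_compact.
  exact: continuous_in_subspaceT.
have phiq t : t != 0 -> t + s \in `[u, v] -> t^-1 *: (phi (t + s) - phi s) = \int[mu]_(x in `[x0, x1]) q t x.
  move=> t0 tI.
  have -> : phi (t + s) - phi s = \int[mu]_(x in `[x0, x1]) ((a (x, t + s) - a (x, s)) * dx b (x, t + s)) +
     \int[mu]_(x in `[x0, x1]) (a (x, s) * (dx b (x, t + s) - dx b (x, s))).
    rewrite -RintegralB//; try by apply: ci => x xI; apply: cvgM; exact: cs.
    rewrite -RintegralD//; first by apply: eq_Rintegral => x _; ring.
    - by apply: ci => x xI; apply: cvgM; [apply: cvgB|]; exact: cs.
    - by apply: ci => x xI; apply: cvgM; [|apply: cvgB]; exact: cs.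
  rewrite by_parts_slice// -RintegralB//; last 2 first.
  - by apply: ci => x xI; apply: cvgM; [apply: cvgB|]; exact: cs.
  - by apply: ci => x xI; apply: cvgM; [|apply: cvgB]; exact: cs.
  rewrite -[LHS]RintegralZl//; first by apply: eq_Rintegral => x _; rewrite /q; ring.
  by apply: ci => x xI; apply: cvgB; apply: cvgM; try apply: cvgB; exact: cs.
suff H : t^-1 *: (phi (t + s) - phi s) @[t --> 0^'] --> psi s.
  have E : (fun h : R => h^-1 *: (phi (h *: 1 + s) - phi s)) = (fun h : R => h^-1 *: (phi (h + s) - phi s)).
    by apply/funext => h; rewrite [_%:A]mulr1.
  apply: DeriveDef; first by apply/cvg_ex; exists (psi s) => /=; rewrite E.
  by rewrite /derive /= E; exact/cvg_lim.
apply/cvgr_dnbhsP => t [t0 tc].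
have /near_in_itvoo[e /= e0 eI] : s \in `]u, v[ by [].
move/cvgr0_norm_lt: (tc) => /(_ _ e0)[N _ Nt].
(* Dropping the first terms of the sequence keeps every slice [t n + s] inside the box. *)
rewrite -(cvg_shiftn N).
have tI n : t (n + N)%N + s \in `]u, v[.
  apply: eI; rewrite /= opprD addrCA subrr addr0 normrN.
  by apply: Nt; rewrite /= leq_addl.
have tI' n : t (n + N)%N + s \in `[u, v] by exact: subset_itv_oo_cc.
under eq_fun do rewrite phiq//.
apply: fine_cvg.
rewrite /psi /Rintegral fineK; last first.
  apply: integrable_fin_num => //; apply: ci => x xI.
  by apply: cvgB; apply: cvgM; exact: cs.
apply: (@dominated_cvg _ _ _ mu _ _ (fun n x => (q (t (n + N)%N) x)%:E) _ (fun=> (Da * Cb + Ca * Db)%:E)) => //=.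
- move=> n; apply: (measurable_int mu); apply: (ci (q (t (n + N)%N))) => x xI.
  by apply: cvgB; apply: cvgM; (try apply: cvgM); (try apply: cvgB); (try exact: cvg_cst); exact: cs.
- move=> x xI; apply: cvg_EFin; first exact: nearW.
  have tc' : t (n + N)%N @[n --> \oo] --> 0 by rewrite cvg_shiftn.
  have quot f df : is_derive s 1 (fun s => f (x, s)) df ->
      (f (x, t (n + N)%N + s) - f (x, s)) / t (n + N)%N @[n --> \oo] --> df.
    move=> [dv <-]; have /cvg_ex[l Hl] := dv.
    have := Hl; move/cvg_lim => El; rewrite /derive El//.
    move/cvgr_dnbhsP: Hl => /(_ _ (conj (fun n => t0 (n + N)%N) tc')).
    by apply: cvg_trans; apply: near_eq_cvg; near=> n; rewrite /= [_%:A]mulr1 [LHS]mulrC.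
  have tcs : t (n + N)%N + s @[n --> \oo] --> s.
    by rewrite -[X in _ --> X]add0r; apply: cvgD => //; exact: cvg_cst.
  have Oxs : O (x, s) by have := OP xI sI; rewrite inE.
  apply: cvgB; apply: cvgM.
  + by apply: quot; apply: is_derive_slice_y; have [] := aC Oxs.
  + apply: (@cvg_comp _ _ _ (fun n => t (n + N)%N + s) (fun s => dx b (x, s)) _ _ _ tcs).
    apply: (@continuous_slice_y (dx b)).
    by apply: cxb; rewrite inE.
  + exact: cvg_cst.
  + by apply: quot; apply: is_derive_slice_y; have [] := bC Oxs.
- by apply: (ci (fun=> Da * Cb + Ca * Db)) => x xI; exact: cvg_cst.
- move=> n x xI; rewrite lee_fin.
  have xI' : x \in `[x0, x1] by [].
  (* The mean value theorem bounds the quotients in [q] by the bound on the y-derivative, so that a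
     constant dominates. *)
  have mv f C : C1 O f -> (forall x s : R, x \in `[x0, x1] -> s \in `[u, v] -> `|dy f (x, s)| <= C) ->
     `|(f (x, t (n + N)%N + s) - f (x, s)) / t (n + N)%N| <= C.
    move=> fC HC; rewrite normrM normfV ler_pdivrMr ?normr_gt0//.
    have I y : `|y| <= `|t (n + N)%N| -> y + s \in `[u, v].
      move=> yt; apply: subset_itv_oo_cc; apply: eI; rewrite /= opprD addrCA subrr addr0 normrN.
      by apply: le_lt_trans yt _; apply: Nt; rewrite /= leq_addl.
    have [|c cI] := @MVT_symmetric R (fun y => f (x, y + s)) (fun y => dy f (x, y + s)) (t (n + N)%N).
      move=> y yt; have Oy : O (x, y + s) by have := OP xI' (I _ yt); rewrite inE.
      have [df _ _] := fC _ Oy.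
      have := @is_derive_curve R f (cst x) (id + cst s) y 0 (1 + 0) df (is_derive_cst x y 1) (is_deriveD (is_derive_id y 1) (is_derive_cst s y 1)).
      by rewrite /linear_form/= mul0r addr0 mul1r add0r.
    by rewrite add0r => ->; rewrite normrM ler_wpM2r//; apply: HC => //; exact: I.
  rewrite (le_trans (ler_normB _ _))// lerD// normrM ler_pM//.
  + exact: mv.
  + exact: HCb.
  + exact: HCa.
  + exact: mv.
Unshelve. all: by end_near. Qed.

Lemma green_psi_continuous : {in `]u, v[, continuous psi}.
Proof.
have [Ca Ca0 HCa] := box_bound (C1_dx aC).
have [Cb Cb0 HCb] := box_bound (C1_dx bC).
have [Da Da0 HDa] := box_bound (C1_dy aC).
have [Db Db0 HDb] := box_bound (C1_dy bC).
move=> s sI.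
apply: (@continuity_under_integral R _ _ mu (fun s x => dy a (x, s) * dx b (x, s) - dx a (x, s) * dy b (x, s))
  `[x0, x1]%classic _ u v _ _ (fun=> Da * Cb + Ca * Db)) => //.
- move=> t tI; apply: (@slice_integrable (fun z => dy a z * dx b z - dx a z * dy b z)) => //.
    by move=> z Oz; apply: cvgB; apply: cvgM;
      [exact: C1_dy aC _ Oz|exact: C1_dx bC _ Oz|exact: C1_dx aC _ Oz|exact: C1_dy bC _ Oz].
  exact: subset_itv_oo_cc.
- apply: aeW => x xI t tI.
  have Oz : (x, t) \in O by apply: OP => //; apply: subset_itv_oo_cc; rewrite inE in tI.
  apply: (@continuous_slice_y (fun z => dy a z * dx b z - dx a z * dy b z)).
  by apply: cvgB; apply: cvgM;
      [exact: C1_dy aC _ Oz|exact: C1_dx bC _ Oz|exact: C1_dx aC _ Oz|exact: C1_dy bC _ Oz].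
- apply: continuous_compact_integrable; first exact: segment_compact.
  by apply: continuous_in_subspaceT => x _; exact: cvg_cst.
- move=> t tI; apply: aeW => x xI; rewrite (le_trans (ler_normB _ _))// lerD// normrM ler_pM//.
  + by apply: HDa => //; exact: subset_itv_oo_cc.
  + by apply: HCb => //; exact: subset_itv_oo_cc.
  + by apply: HCa => //; exact: subset_itv_oo_cc.
  + by apply: HDb => //; exact: subset_itv_oo_cc.
- by rewrite inE.
Qed.

(** The fundamental theorem of calculus in s. The heights stay strictly between [u] and [v], as the
    slice integral has been differentiated in the open interval. *)
Lemma green_iterated s0 s1 : u < s0 -> s0 < s1 -> s1 < v ->
  \int[mu]_(s in `[s0, s1]) psi s = phi s1 - phi s0.
Proof.
move=> us0 s01 s1v.
have sI s : s \in `[s0, s1] -> s \in `]u, v[.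
  by rewrite !in_itv/= => /andP[? ?]; rewrite (lt_le_trans us0)//= (le_lt_trans _ s1v).
rewrite /Rintegral (@continuous_FTC2 R psi phi s0 s1)//.
- apply: continuous_in_subspaceT => s; rewrite inE => /sI sI'.
  by apply: green_psi_continuous; rewrite inE.
- have D s : s \in `[s0, s1] -> {for s, continuous phi}.
    move=> /sI /green_derive[? _]; apply: differentiable_continuous.
    exact/derivable1_diffP.
  split.
  + by move=> s /subset_itv_oo_cc /sI /green_derive[].
  + by apply: cvg_at_right_filter; apply: D; rewrite in_itv/= lexx ltW.
  + by apply: cvg_at_left_filter; apply: D; rewrite in_itv/= lexx ltW.
- by move=> s /subset_itv_oo_cc /sI /green_derive[_]; rewrite derive1E.
Qed.

End box.

End green.

(** * Lebesgue measure of the plane *)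

Section plane_measure.
Context {R : realType}.
Local Notation P := (plane R).
Local Notation PM := (measurableTypeR R * measurableTypeR R)%type.
Local Notation mu := (@lebesgue_measure R).
Local Notation lam := (lebesgue_plane R).

Definition open_boxes : set (set PM) :=
  [set B | exists a b c d : R, B = (`]a, b[%classic `*` `]c, d[%classic)].

Lemma open_box_measurable a b c d : measurable (`]a, b[%classic `*` `]c, d[%classic : set PM).
Proof. by apply: measurableX; exact: measurable_itv. Qed.

(** Rational endpoints keep the union countable. This yields the measurability of open sets and,
    later, a countable cover on which two measures are compared. *)
Lemma open_bigcup_boxes (O : set P) : open O ->
  O = \bigcup_(q in [set q : (rat * rat) * (rat * rat) |
        `]ratr q.1.1, ratr q.1.2[%classic `*` `]ratr q.2.1, ratr q.2.2[%classic `<=` O])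
        (`]ratr q.1.1, ratr q.1.2[%classic `*` `]ratr q.2.1, ratr q.2.2[%classic).
Proof.
move=> oO; rewrite eqEsubset; split => [[x y] Oz|z [q /= qO /qO//]].
have /nbhs_ballP[e /= e0 He] := open_nbhs_nbhs (conj oO Oz).
have near_rat (t : R) : exists ab : rat * rat, ratr ab.1 < t < ratr ab.2 /\
    (forall s : R, ratr ab.1 < s < ratr ab.2 -> `|t - s| < e).
  have [a] := @rat_in_itvoo R (t - e) t (ltac:(by rewrite ltrBlDr ltrDl)).
  have [b] := @rat_in_itvoo R t (t + e) (ltac:(by rewrite ltrDl)).
  rewrite !in_itv/= => /andP[b1 b2] /andP[a1 a2].
  exists (a, b); split => /=; first by rewrite a2.
  move=> s /andP[s1 s2].
  by rewrite ltr_distl; apply/andP; split; lra.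
have [qx [xq Hx]] := near_rat x; have [qy [yq Hy]] := near_rat y.
exists (qx, qy); rewrite /= ?in_itv//=.
move=> -[s t] /=; rewrite !in_itv/= => -[sI tI]; apply: He; split => /=.
  by rewrite -ball_normE; exact: Hx.
by rewrite -ball_normE; exact: Hy.
Qed.

Lemma open_measurable_plane (O : set P) : open O -> measurable (O : set PM).
Proof.
move=> /open_bigcup_boxes ->; rewrite bigcup_mkcond.
apply: countable_bigcupT_measurable; first exact: countableP.
by move=> q; case: ifP => // _; exact: open_box_measurable.
Qed.

Lemma open_boxes_setI : setI_closed open_boxes.
Proof.
move=> _ _ [a [b [c [d ->]]]] [a' [b' [c' [d' ->]]]].
exists (Num.max a a'), (Num.min b b'), (Num.max c c'), (Num.min d d').
rewrite -setXI; congr (_ `*` _); apply/seteqP; split => x /=;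
  rewrite !in_itv/= gt_max lt_min.
- by move=> [/andP[-> ->] /andP[-> ->]].
- by move=> /andP[/andP[-> ->] /andP[-> ->]].
- by move=> [/andP[-> ->] /andP[-> ->]].
- by move=> /andP[/andP[-> ->] /andP[-> ->]].
Qed.

Definition centered_box (k : nat) : set PM :=
  `](- k%:R), k%:R[%classic `*` `](- k%:R), k%:R[%classic.

Lemma bigcup_centered_box : \bigcup_k centered_box k = setT.
Proof.
apply/seteqP; split => // -[x y] _.
have H (t : R) : t \in `](- (Num.truncn (`|x| + `|y|)).+1%:R), (Num.truncn (`|x| + `|y|)).+1%:R[ = 
   (`|t| < (Num.truncn (`|x| + `|y|)).+1%:R) by rewrite in_itv/= ltr_norml.
exists (Num.truncn (`|x| + `|y|)).+1 => //; split => /=; rewrite H.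
  by rewrite (le_lt_trans _ (truncnS_gt _))// lerDl.
by rewrite (le_lt_trans _ (truncnS_gt _))// lerDr.
Qed.

(** The sets whose vertical or horizontal cylinder lies in the generated sigma-algebra form a
    sigma-algebra containing the open intervals, because a cylinder over an interval is a countable
    union of boxes; a measurable rectangle is the intersection of two cylinders. *)
Lemma plane_measurableE : @measurable _ PM = <<s open_boxes >>.
Proof.
rewrite eqEsubset; split; last first.
  apply: smallest_sub; first exact: sigma_algebra_measurable.
  by move=> _ [a [b [c [d ->]]]]; exact: open_box_measurable.
have sG : sigma_algebra setT (<<s open_boxes >>) by exact: smallest_sigma_algebra.
have [G0 GD GU] := sG.
have gT : \bigcup_k (`](- k%:R), k%:R[%classic : set R) = setT.
  apply/seteqP; split => // x _; exists (Num.truncn `|x|).+1 => //=.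
  by rewrite in_itv/= -ltr_norml truncnS_gt.
have GC A : <<s open_boxes >> A -> <<s open_boxes >> (~` A) by rewrite -setTD; exact: GD.
have sX : sigma_algebra setT [set A : set R | <<s open_boxes >> (A `*` [set: R])].
  split => /=.
  - by rewrite set0X.
  - move=> A /GC; rewrite (_ : ~` (A `*` setT) = (setT `\` A) `*` setT)//.
    by apply/seteqP; split => -[x y] /=; tauto.
  - move=> A HA; rewrite setX_bigcupl; exact: GU.
have sY : sigma_algebra setT [set A : set R | <<s open_boxes >> ([set: R] `*` A)].
  split => /=.
  - by rewrite setX0.
  - move=> A /GC; rewrite (_ : ~` (setT `*` A) = setT `*` (setT `\` A))//.
    by apply/seteqP; split => -[x y] /=; tauto.
  - move=> A HA; rewrite setX_bigcupr; exact: GU.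
have mX (A : set R) : measurable A -> <<s open_boxes >> (A `*` [set: R]).
  move=> mA; have : <<s @measurable_realfun.RGenOpens.G R >> A.
    change ((@measurable_realfun.RGenOpens.G R).-sigma.-measurable A).
    by rewrite -(measurable_realfun.RGenOpens.measurableE R).
  move: A {mA}; apply: smallest_sub => // _ [a [b ->]] /=.
  rewrite -gT setX_bigcupr; apply: GU => k; apply: sub_sigma_algebra.
  by exists a, b, (- k%:R), k%:R.
have mY (A : set R) : measurable A -> <<s open_boxes >> ([set: R] `*` A).
  move=> mA; have : <<s @measurable_realfun.RGenOpens.G R >> A.
    change ((@measurable_realfun.RGenOpens.G R).-sigma.-measurable A).
    by rewrite -(measurable_realfun.RGenOpens.measurableE R).
  move: A {mA}; apply: smallest_sub => // _ [a [b ->]] /=.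
  rewrite -gT setX_bigcupl; apply: GU => k; apply: sub_sigma_algebra.
  by exists (- k%:R), k%:R, a, b.
rewrite measurable_prod_measurableType; apply: smallest_sub => // _ [A mA [B mB <-]].
have -> : A `*` B = (A `*` setT) `&` (setT `*` B).
  by apply/seteqP; split => -[x y] /=; tauto.
apply: (@measurableI _ (g_sigma_algebraType open_boxes)); [exact: mX|exact: mY].
Qed.

(** Open boxes are stable under intersection, and the centered ones exhaust the plane with finite
    measure, which is what uniqueness of measures asks. *)
Lemma plane_measure_unique (m1 m2 : {measure set PM -> \bar R}) :
  (forall a b c d : R, m1 (`]a, b[%classic `*` `]c, d[%classic) = m2 (`]a, b[%classic `*` `]c, d[%classic)) ->
  (forall k, (m1 (centered_box k) < +oo)%E) ->
  forall A, measurable A -> m1 A = m2 A.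
Proof.
move=> m12 mfin; apply: (measure_unique open_boxes centered_box) => //.
- exact: plane_measurableE.
- exact: open_boxes_setI.
- by move=> k; exists (- k%:R), k%:R, (- k%:R), k%:R.
- exact: bigcup_centered_box.
- by move=> _ [a [b [c [d ->]]]].
Qed.

Lemma open_preimage_in (T U : topologicalType) (D : set T) (V : set U) (f : T -> U) : open D ->
  {in D, continuous f} -> open V -> open (D `&` f @^-1` V).
Proof.
move=> oD cf oV; rewrite openE => z [Dz Vz]; apply: filterI.
  exact: open_nbhs_nbhs (conj oD Dz).
by apply: cf; [rewrite inE|exact: open_nbhs_nbhs (conj oV Vz)].
Qed.

Lemma continuous_measurable_plane (D : set P) (f : P -> R) : open D -> {in D, continuous f} ->
  measurable_fun (D : set PM) (f : PM -> R).
Proof.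
move=> oD cf; apply: (measurability _ (measurable_realfun.RGenOpens.measurableE R)).
move=> _ [_ [a [b ->] <-]]; apply: open_measurable_plane.
by apply: open_preimage_in => //; exact: interval_open.
Qed.

Lemma open_box (a b c d : R) : open (`]a, b[%classic `*` `]c, d[%classic : set P).
Proof.
rewrite (_ : _ `*` _ = (setT `&` (fst : P -> R) @^-1` `]a, b[%classic) `&`
   (setT `&` (snd : P -> R) @^-1` `]c, d[%classic)); last first.
  by apply/seteqP; split => -[x y] /=; tauto.
apply: openI; apply: open_preimage_in => //; try exact: openT; try exact: interval_open.
- by move=> z _; exact: cvg_fst.
- by move=> z _; exact: cvg_snd.
Qed.

Lemma continuous_map_measurable_plane (D : set P) (F : P -> P) : open D -> {in D, continuous F} ->
  measurable_fun (D : set PM) (F : PM -> PM).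
Proof.
move=> oD cF; apply: (measurability _ plane_measurableE).
move=> _ [_ [a [b [c [d ->]]]] <-]; apply: open_measurable_plane.
by apply: open_preimage_in => //; exact: open_box.
Qed.

Lemma lebesgue_plane_box (A B : set R) : measurable A -> measurable B ->
  lam (A `*` B) = (mu A * mu B)%E.
Proof. by move=> mA mB; exact: (product_measure1E mu mu). Qed.

Lemma integrable_plane (A : set PM) (f : P -> R) (C : R) : measurable A -> (lam A < +oo)%E ->
  measurable_fun A (f : PM -> R) -> (forall z, A z -> `|f z| <= C) ->
  lam.-integrable A (fun z => (f z)%:E).
Proof.
move=> mA Aoo mf fC; apply: (@measurable_bounded_integrable _ _ _ lam f A) => //.
exists C; split; first exact: num_real.
by move=> x Cx z Az; rewrite /= (le_trans (fC _ Az))// ltW.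
Qed.

Lemma integral_box (A B : set R) (f : PM -> R) : measurable A -> measurable B ->
  lam.-integrable (A `*` B) (fun z => (f z)%:E) ->
  (\int[lam]_(z in A `*` B) (f z)%:E = \int[mu]_(y in B) \int[mu]_(x in A) (f (x, y))%:E)%E.
Proof.
move=> mA mB fi; have mAB : measurable (A `*` B) by exact: measurableX.
rewrite integral_mkcond -integral21_prod_meas1; last by rewrite -integrable_mkcond.
rewrite [RHS]integral_mkcond; apply: eq_integral => y _; rewrite patchE.
case: ifPn => yB.
  rewrite [RHS]integral_mkcond; apply: eq_integral => x _; rewrite !patchE.
  by rewrite in_setX/= yB andbT.
rewrite /fubini_G; apply: integral0_eq => x _; rewrite patchE in_setX/= (negbTE yB) andbF//.
Qed.

End plane_measure.

(** * Cut-off functions and affine changes of variables *)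

Section bumps.
Context {R : realType}.
Local Notation mu := (@lebesgue_measure R).

(** The basic function of class C1 with a half-line of zeros; all cut-offs are obtained from it by
    algebra, so that their regularity is that of sums, products and quotients. *)
Definition sqpos (t : R) : R := Num.max 0 t ^+ 2.

Lemma sqpos_ge0 t : 0 <= sqpos t. Proof. exact: sqr_ge0. Qed.

Lemma sqpos_le0 t : t <= 0 -> sqpos t = 0.
Proof. by move=> t0; rewrite /sqpos; move/max_idPl : t0 => ->; rewrite expr0n. Qed.

Lemma sqpos_ge t : 0 <= t -> sqpos t = t ^+ 2.
Proof. by move=> t0; rewrite /sqpos; move/max_idPr : t0 => ->. Qed.

Lemma sqpos_gt0 t : 0 < t -> 0 < sqpos t.
Proof. by move=> t0; rewrite sqpos_ge ?ltW// exprn_gt0. Qed.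

Lemma is_derive_sqpos (t : R) : is_derive t 1 sqpos (2 * Num.max 0 t).
Proof.
have [t0|t0|->] := ltgtP t 0.
- rewrite mulr0; apply: near_eq_is_derive (is_derive_cst 0 t 1).
  by near=> y; rewrite /= sqpos_le0//; apply: ltW; near: y; exact: lt_nbhsl.
- apply: (@near_eq_is_derive _ R R (fun t : R => t ^+ 2) _ t 1).
    by near=> y; rewrite /= sqpos_ge//; apply: ltW; near: y; exact: lt_nbhsr.
  have H := is_deriveM (is_derive_id t (1 : R)) (is_derive_id t (1 : R)).
  apply: is_derive_eq H _; rewrite /GRing.scale/=; ring.
- rewrite mulr0.
  have H : h^-1 *: (sqpos (h *: 1 + 0) - sqpos 0) @[h --> 0^'] --> (0 : R).
    apply/cvgr0Pnorm_le => e e0; near=> h.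
    rewrite addr0 [_%:A]mulr1 (@sqpos_le0 0)// subr0 /GRing.scale/= normrM normfV.
    have h0 : h != 0 by near: h; exact: nbhs_dnbhs_neq.
    rewrite ler_pdivrMl ?normr_gt0// ger0_norm ?sqpos_ge0//.
    have he : `|h| <= e by near: h; apply: dnbhs0_le.
    have [hp|hn] := leP 0 h; last by rewrite sqpos_le0 ?mulr_ge0// ltW.
    by rewrite sqpos_ge// expr2 ger0_norm// ler_wpM2l// (le_trans (ler_norm h)).
  apply: DeriveDef; first by apply/cvg_ex; exists 0.
  by rewrite /derive; exact/cvg_lim.
Unshelve. all: by end_near. Qed.

Lemma continuous_max0 : continuous (fun t : R => Num.max 0 t).
Proof. by move=> t; apply: continuous_max => //; exact: cvg_cst. Qed.

Lemma continuous_sqpos : continuous sqpos.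
Proof.
move=> t; have [d _] := is_derive_sqpos t.
exact/differentiable_continuous/derivable1_diffP.
Qed.

(** For |t| <= 1 the inner [sqpos] is at least 1, which kills the outer one and gives the value 1;
    for t^2 >= 2 the inner one vanishes and the value is 0. *)
Definition cutoff (t : R) : R := 1 - sqpos (1 - sqpos (2 - t ^+ 2)).

Lemma cutoff_in t : `|t| <= 1 -> cutoff t = 1.
Proof.
move=> t1; have t2 : t ^+ 2 <= 1 by rewrite -(real_normK (num_real t)) exprn_ile1.
rewrite /cutoff (sqpos_ge (t := 2 - _)); last by rewrite subr_ge0; lra.
by rewrite sqpos_le0 ?subr0//; nra.
Qed.

Lemma cutoff_out t : 2 <= `|t| -> cutoff t = 0.
Proof.
move=> t1; have t2 : 2 <= t ^+ 2.
  by rewrite -(real_normK (num_real t)); have := normr_ge0 t; nra.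
rewrite /cutoff (sqpos_le0 (t := 2 - _)); last by rewrite subr_le0.
by rewrite subr0 sqpos_ge// expr1n subrr.
Qed.

Lemma cutoff_ge0 t : 0 <= cutoff t.
Proof.
rewrite /cutoff subr_ge0; set s := sqpos (2 - _).
have s0 : 0 <= s by exact: sqpos_ge0.
have [s1|s1] := leP s 1; last by rewrite sqpos_le0// subr_le0 ltW.
by rewrite sqpos_ge ?subr_ge0// exprn_ile1// ?subr_ge0// gerBl.
Qed.

Lemma cutoff_le1 t : cutoff t <= 1.
Proof. by rewrite /cutoff gerBl sqpos_ge0. Qed.

Lemma C1_sqpos O (f : plane R -> R) : open O -> C1 O f -> C1 O (fun z => sqpos (f z)).
Proof.
move=> oO fC; apply: (@C1_outer _ _ sqpos (fun t => 2 * Num.max 0 t) f oO fC) => z _.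
split; first exact: is_derive_sqpos.
by apply: cvgM; [exact: cvg_cst|exact: continuous_max0].
Qed.

Lemma C1_cutoff O (f : plane R -> R) : open O -> C1 O f -> C1 O (fun z => cutoff (f z)).
Proof.
move=> oO fC.
have H := C1B oO (C1_cst 2 oO) (C1M oO fC fC).
have := C1B oO (C1_cst 1 oO) (C1_sqpos oO (C1B oO (C1_cst 1 oO) (C1_sqpos oO H))).
by apply: C1_eq => // z _; rewrite /cutoff expr2.
Qed.

(* increasing in [n], with limit the indicator function of ]a, b[ *)
Definition plateau (a b : R) (n : nat) (t : R) : R :=
  let w := sqpos (t - a) * sqpos (b - t) in w / (w + n.+1%:R^-1).

Lemma plateau_den_gt0 a b n t : 0 < sqpos (t - a) * sqpos (b - t) + n.+1%:R^-1.
Proof. by rewrite ltr_wpDl// mulr_ge0// sqpos_ge0. Qed.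

Lemma plateau_ge0 a b n t : 0 <= plateau a b n t.
Proof. by apply: divr_ge0; [rewrite mulr_ge0// sqpos_ge0|exact/ltW/plateau_den_gt0]. Qed.

Lemma plateau_out a b n t : t \notin `]a, b[ -> plateau a b n t = 0.
Proof.
rewrite in_itv/= negb_and -!leNgt /plateau => /orP[ta|bt].
  by rewrite (@sqpos_le0 (t - a)) ?subr_le0// !mul0r.
by rewrite (@sqpos_le0 (b - t)) ?subr_le0// mulr0 mul0r.
Qed.

Lemma continuous_plateau a b n : continuous (plateau a b n).
Proof.
have c1 : continuous (fun t => sqpos (t - a) * sqpos (b - t)).
  move=> t; apply: cvgM.
    by apply: (@continuous_comp _ _ _ (fun t => t - a) sqpos); [apply: cvgB; [exact: cvg_id|exact: cvg_cst]|exact: continuous_sqpos].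
  by apply: (@continuous_comp _ _ _ (fun t => b - t) sqpos); [apply: cvgB; [exact: cvg_cst|exact: cvg_id]|exact: continuous_sqpos].
move=> t; apply: cvgM; first exact: c1.
by apply: cvgV; [rewrite gt_eqF// plateau_den_gt0|apply: cvgD; [exact: c1|exact: cvg_cst]].
Qed.

Lemma plateau_nondecreasing a b t : {homo (plateau a b)^~ t : m n / (m <= n)%N >-> m <= n}.
Proof.
move=> m n mn; apply: ler_wpM2l; first by rewrite mulr_ge0 ?sqpos_ge0.
by rewrite lef_pV2 ?posrE ?plateau_den_gt0// lerD2l lef_pV2 ?posrE// ler_nat.
Qed.

Lemma plateau_cvg a b t : t \in `]a, b[ -> plateau a b n t @[n --> \oo] --> (1 : R).
Proof.
rewrite in_itv/= => /andP[ta tb]; rewrite /plateau.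
set w := sqpos _ * _; have w0 : 0 < w by rewrite mulr_gt0// sqpos_gt0 ?subr_gt0.
rewrite -[X in _ --> X](@divff _ w) ?gt_eqF//; apply: cvgM; first exact: cvg_cst.
apply: cvgV; first by rewrite gt_eqF.
rewrite -[X in _ --> X]addr0; apply: cvgD; first exact: cvg_cst.
exact: cvg_harmonic.
Qed.

Lemma C1_plateau O a b n (f : plane R -> R) : open O -> C1 O f -> C1 O (fun z => plateau a b n (f z)).
Proof.
move=> oO fC.
have wC : C1 O (fun z => sqpos (f z - a) * sqpos (b - f z)).
  exact: C1M oO (C1_sqpos oO (C1B oO fC (C1_cst a oO))) (C1_sqpos oO (C1B oO (C1_cst b oO) fC)).
apply: (C1M oO wC); apply: (C1V oO); first exact: C1D oO wC (C1_cst _ oO).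
by move=> z _; rewrite gt_eqF// plateau_den_gt0.
Qed.

Lemma plateau_integrable a b n : mu.-integrable setT (fun t => (plateau a b n t)%:E).
Proof.
have -> : (fun t => (plateau a b n t)%:E) = (fun t => (plateau a b n t)%:E) \_ `[a, b].
  apply/funext => t; rewrite patchE; case: ifPn => // tI; rewrite plateau_out//.
  by apply: contraNN tI => tI; rewrite inE; exact: subset_itv_oo_cc.
rewrite -integrable_mkcond//; apply: continuous_compact_integrable; first exact: segment_compact.
exact/continuous_subspaceT/continuous_plateau.
Qed.

(** A primitive turns a product of plateaus into an x-derivative, hence into a bracket with the
    second coordinate, to which Green's formula applies. *)
Lemma plateau_primitive a b n : exists B : R -> R, forall x : R, is_derive x 1 B (plateau a b n x).
Proof.
exists (fun x => \int[mu]_(t in `]-oo, x]) plateau a b n t) => x.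
have x1 : x < x + 1 by rewrite ltrDl.
have bi : mu.-integrable [set` Interval -oo%O (BRight (x + 1))] (EFin \o plateau a b n).
  exact: integrableS (plateau_integrable a b n).
have [d dE] := continuous_FTC1 x1 bi (ltNyr x) (@continuous_plateau a b n x).
by apply: DeriveDef; [exact: d|rewrite -derive1E; exact: dE].
Qed.

(** Both sides are measures, compared on the half-open intervals that characterize Lebesgue measure.
    For k < 0 the preimage is half-open on the other side, with the same length. *)
Lemma affine_pushforward (k l : R) : k != 0 -> forall A, measurable A ->
  mu A = (`|k|%:E * mu ((fun x : R => k * x + l)%R @^-1` A))%E.
Proof.
move=> k0.
have mf : measurable_fun setT (fun x : measurableTypeR R => k * x + l : measurableTypeR R).
  apply: continuous_measurable_fun => x; apply: cvgD; last exact: cvg_cst.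
  by apply: cvgM; [exact: cvg_cst|exact: cvg_id].
pose p : {measure set (measurableTypeR R) -> \bar R} := pushforward mu (fun x : measurableTypeR R => k * x + l : measurableTypeR R).
apply: (@lebesgue_measure_unique R (mscale (NngNum (normr_ge0 k)) (p mf))) => _ [[a b] _ <-].
rewrite [RHS](_ : _ = (`|k|%:E * mu ((fun x : R => (k * x + l)%R) @^-1` `]a, b]%classic))%E)//.
rewrite lebesgue_measure_itv/= lte_fin.
have [k1|k1] := ltP 0 k.
  rewrite (_ : _ @^-1` _ = `](a - l) / k, (b - l) / k]%classic); last first.
    apply/seteqP; split => x /=; rewrite !in_itv/= ltr_pdivrMr// ler_pdivlMr//;
      by rewrite [x * k]mulrC ltrBlDr lerBrDr.
  rewrite lebesgue_measure_itv/= lte_fin ltr_pM2r ?invr_gt0// ltrD2r.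
  case: ifPn => _; last by rewrite mule0.
  by rewrite -!EFinB -EFinM gtr0_norm//; congr EFin; field.
have {}k1 : k < 0 by rewrite lt_neqAle k0 k1.
rewrite (_ : _ @^-1` _ = `[(b - l) / k, (a - l) / k[%classic); last first.
  apply/seteqP; split => x /=; rewrite !in_itv/= ltr_ndivlMr// ler_ndivrMr//;
    by rewrite [x * k]mulrC ltrBlDr lerBrDr andbC.
rewrite lebesgue_measure_itv/= lte_fin ltr_nM2r ?invr_lt0// ltrD2r.
case: ifPn => _; last by rewrite mule0.
by rewrite -!EFinB -EFinM ltr0_norm//; congr EFin; field.
Qed.

Lemma affine_ge0_integral (k l : R) (f : R -> \bar R) : k != 0 ->
  measurable_fun setT f -> (forall x, 0 <= f x)%E ->
  (\int[mu]_x f x = `|k|%:E * \int[mu]_x f (k * x + l)%R)%E.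
Proof.
move=> k0 mf f0.
have mg : measurable_fun setT (fun x : measurableTypeR R => k * x + l : measurableTypeR R).
  apply: continuous_measurable_fun => x; apply: cvgD; last exact: cvg_cst.
  by apply: cvgM; [exact: cvg_cst|exact: cvg_id].
pose p : {measure set (measurableTypeR R) -> \bar R} := pushforward mu (fun x : measurableTypeR R => k * x + l : measurableTypeR R).
rewrite (eq_measure_integral (mscale (NngNum (normr_ge0 k)) (p mg))); last first.
  by move=> A mA _; exact: affine_pushforward l k0 _ mA.
rewrite ge0_integral_mscale//; congr (_ * _)%E.
by rewrite ge0_integral_pushforward.
Qed.

Local Notation P := (plane R).
Local Notation PM := (measurableTypeR R * measurableTypeR R)%type.
Local Notation lam := (lebesgue_plane R).

(** Two successive substitutions in one variable: at fixed y, the first affine form becomes the new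
    x, after which the second has coefficient D / k1 in y; then, at fixed x, the second form becomes
    the new y. The factors |k1| and |D / k1| multiply to |D|. *)
Lemma affine_integral_plane1 (b c : R -> R) (k1 k2 k3 k4 l1 l2 : R) :
  continuous b -> continuous c -> (forall x, 0 <= b x) -> (forall x, 0 <= c x) ->
  k1 != 0 -> k1 * k4 - k2 * k3 != 0 ->
  (`|k1 * k4 - k2 * k3|%:E * \int[lam]_z (b (k1 * z.1 + k2 * z.2 + l1) * c (k3 * z.1 + k4 * z.2 + l2))%:E =
   (\int[mu]_x (b x)%:E) * (\int[mu]_x (c x)%:E))%E.
Proof.
move=> cb cc b0 c0 k10 D0; set D := k1 * k4 - k2 * k3.
have mE (g : R -> R) : continuous g -> measurable_fun setT (fun x => (g x)%:E).
  by move=> cg; apply/measurable_EFinP; exact: continuous_measurable_fun.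
have maff (h : R -> R) (f : P -> R) : continuous h -> continuous f -> continuous (h \o f).
  by move=> ch cf z; apply: continuous_comp; [exact: cf|exact: ch].
have ca (p q r : R) : continuous (fun z : P => p * z.1 + q * z.2 + r).
  move=> z; apply: cvgD; last exact: cvg_cst.
  by apply: cvgD; apply: cvgM; try exact: cvg_cst; [exact: cvg_fst|exact: cvg_snd].
have ca1 (p q : R) : continuous (fun z : R => p * z + q).
  by move=> z; apply: cvgD; [apply: cvgM; [exact: cvg_cst|exact: cvg_id]|exact: cvg_cst].
have mP (f : P -> R) : continuous f -> measurable_fun setT (fun z : PM => (f z)%:E).
  by move=> cf; apply/measurable_EFinP; apply: (continuous_measurable_plane openT) => z _; exact: cf.
have cf1 : continuous (fun z : P => b (k1 * z.1 + k2 * z.2 + l1) * c (k3 * z.1 + k4 * z.2 + l2)).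
  by move=> z; apply: cvgM; [exact: (maff b)|exact: (maff c)].
pose m := k3 / k1.
have cf2 : continuous (fun z : P => b z.1 * c (m * z.1 + (D / k1) * z.2 + (l2 - m * l1))).
  move=> z; apply: cvgM; last exact: (maff c).
  exact: (maff b fst cb (fun z => @cvg_fst _ _ _ _ _)).
rewrite /lebesgue_plane (@fubini_tonelli2 _ _ _ _ _ mu mu); [|exact: mP cf1|by move=> z; rewrite lee_fin mulr_ge0].
have E1 y : (fubini_G mu (fun z : PM => (b (k1 * z.1 + k2 * z.2 + l1)%R * c (k3 * z.1 + k4 * z.2 + l2)%R)%:E) y =
  `|k1|^-1%:E * fubini_G mu (fun z : PM => (b z.1 * c (m * z.1 + (D / k1) * z.2 + (l2 - m * l1)))%:E) y)%E.
  rewrite /fubini_G.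
  rewrite [in RHS](affine_ge0_integral (k2 * y + l1) k10); last 2 first.
  - apply: mE => x; apply: cvgM; first exact: cb.
    apply: (@continuous_comp _ _ _ (fun x => (m * x + D / k1 * y + (l2 - m * l1))%R) c); last exact: cc.
    by apply: cvgD; [apply: cvgD; [apply: cvgM; [exact: cvg_cst|exact: cvg_id]|exact: cvg_cst]|exact: cvg_cst].
  - by move=> x; rewrite lee_fin mulr_ge0.
  rewrite muleA -EFinM mulVf ?normr_eq0// mul1e.
  by apply: eq_integral => x _ /=; congr (_ * _)%:E; congr (_ _); rewrite /m /D; field.
under eq_integral do rewrite E1.
set f2 := (fun z : PM => _).
have f20 z : (0 <= f2 z)%E by rewrite lee_fin mulr_ge0.
have mf2 : measurable_fun setT f2 by exact: mP cf2.
rewrite ge0_integralZl_EFin//; last 2 first.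
- by move=> y _; apply: integral_ge0 => x _; exact: f20.
- exact: (@measurable_fun_fubini_tonelli_G _ _ _ _ _ mu f2 mf2 f20).
rewrite -(@fubini_tonelli _ _ _ _ _ mu mu f2 mf2 f20) /fubini_F /f2 /=.
have Dk0 : D / k1 != 0 by rewrite mulf_neq0// invr_neq0.
have E2 x : (\int[mu]_y (b x * c (m * x + D / k1 * y + (l2 - m * l1)))%:E =
   `|D / k1|^-1%:E * \int[mu]_y (c y)%:E * (b x)%:E)%E.
  rewrite [in RHS](affine_ge0_integral (m * x + (l2 - m * l1)) Dk0); last 2 first.
  - exact: mE.
  - by move=> y; rewrite lee_fin.
  rewrite muleA -EFinM mulVf ?normr_eq0// mul1e muleC -ge0_integralZl_EFin//.
  - apply: eq_integral => y _; rewrite EFinM; congr (_ * (c _)%:E)%E; ring.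
  - by move=> y _; rewrite lee_fin.
  - by apply: mE => y; apply: (@continuous_comp _ _ _ (fun y => (D / k1 * y + (m * x + (l2 - m * l1)))%R) c); [exact: ca1|exact: cc].
under eq_integral do rewrite E2.
rewrite ge0_integralZl//; last 3 first.
- exact: mE.
- by move=> x _; rewrite lee_fin.
- by rewrite mule_ge0// ?lee_fin ?invr_ge0//; apply: integral_ge0 => y _; rewrite lee_fin.
rewrite [LHS]muleA -EFinM [LHS]muleA [X in (X * _ = _)%E]muleA -EFinM [in RHS]muleC.
rewrite [X in (X%:E * _ * _)%E](_ : _ = 1) ?mul1e//.
by rewrite -normfV -normrM divff// normr_eq0.
Qed.

(** If k1 = 0 then k3 != 0, and exchanging the two factors leads back to the previous case. *)
Lemma affine_integral_plane (b c : R -> R) (k1 k2 k3 k4 l1 l2 : R) :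
  continuous b -> continuous c -> (forall x, 0 <= b x) -> (forall x, 0 <= c x) ->
  k1 * k4 - k2 * k3 != 0 ->
  (`|k1 * k4 - k2 * k3|%:E * \int[lam]_z (b (k1 * z.1 + k2 * z.2 + l1) * c (k3 * z.1 + k4 * z.2 + l2))%:E =
   (\int[mu]_x (b x)%:E) * (\int[mu]_x (c x)%:E))%E.
Proof.
move=> cb cc b0 c0 D0; have [k10|k10] := eqVneq k1 0; last exact: affine_integral_plane1.
have k30 : k3 != 0 by apply: contraNneq D0 => ->; rewrite k10; apply/eqP; ring.
rewrite muleC [in RHS]muleC -(affine_integral_plane1 l2 l1 cc cb c0 b0 k30 (k2 := k4) (k3 := k1) (k4 := k2)); last first.
  by rewrite -oppr_eq0; apply: contraNneq D0 => <-; apply/eqP; ring.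
rewrite muleC; congr (_%:E * _)%E; first by rewrite -normrN; congr `|_|; ring.
by apply: eq_integral => z _; rewrite mulrC.
Qed.

End bumps.

(** * Green's formula as an integral over plane rectangles *)

Section green_plane.
Context {R : realType}.
Local Notation P := (plane R).
Local Notation PM := (measurableTypeR R * measurableTypeR R)%type.
Local Notation mu := (@lebesgue_measure R).
Local Notation lam := (lebesgue_plane R).

Lemma continuous_box_integrable (O : set P) (x0 x1 s0 s1 : R) (f : P -> R) : open O ->
  `[x0, x1] `*` `[s0, s1] `<=` O -> {in O, continuous f} ->
  lam.-integrable (`[x0, x1] `*` `[s0, s1]) (fun z => (f z)%:E).
Proof.
move=> oO sO cf.
have mb : measurable (`[x0, x1]%classic `*` `[s0, s1]%classic : set PM).
  by apply: measurableX; exact: measurable_itv.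
have [||C C0 HC] := @continuous_compact_bound _ P (`[x0, x1] `*` `[s0, s1]) f.
- exact: compact_setX (@segment_compact _ _ _) (@segment_compact _ _ _).
- by move=> z; rewrite inE => /sO Oz; apply: cf; rewrite inE.
- apply: (@integrable_plane _ _ f C) => //.
  + rewrite lebesgue_plane_box; [|exact: measurable_itv..].
    by rewrite !lebesgue_measure_itv; case: ifP => _; case: ifP => _; rewrite ?mule0 ?mul0e// -!EFinB -EFinM ltry.
  + apply: measurable_funS (continuous_measurable_plane oO cf) => //.
    exact: open_measurable_plane.
Qed.

Lemma Rintegral_opp d (T : measurableType d) (m : {measure set T -> \bar R}) (D : set T) (f : T -> R) :
  measurable D -> m.-integrable D (EFin \o f) ->
  \int[m]_(x in D) (- f x) = - \int[m]_(x in D) f x.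
Proof.
by move=> mD fi; rewrite -mulN1r -RintegralZl//; apply: eq_Rintegral => x _; rewrite mulN1r.
Qed.

(** The boundary integral of a db reduces to the top side, as [a] vanishes on the three others. The
    rectangle between [u] and [v] overhangs the domain of integration because slices are
    differentiated at interior heights. *)
Lemma green_box (O : set P) (x0 x1 u s0 s1 v : R) (a b : P -> R) : open O ->
  x0 < x1 -> u < s0 -> s0 < s1 -> s1 < v -> `[x0, x1] `*` `[u, v] `<=` O ->
  C1 O a -> C1 O b ->
  (forall s, s \in `[u, v] -> a (x0, s) = 0 /\ a (x1, s) = 0) ->
  (forall x, x \in `[x0, x1] -> a (x, s0) = 0) ->
  (\int[lam]_(z in `[x0, x1] `*` `[s0, s1]) (br a b z)%:E =
   (- \int[mu]_(x in `[x0, x1]) (a (x, s1) * dx b (x, s1)))%:E)%E.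
Proof.
move=> oO x01 us0 s01 s1v sO aC bC aside a0.
have uv : u < v by rewrite (lt_trans us0)// (lt_trans s01).
have s01uv s : s \in `[s0, s1] -> s \in `[u, v].
  by rewrite !in_itv/= => /andP[h1 h2]; rewrite (le_trans (ltW us0))//= (le_trans h2)// ltW.
have cbr := br_C1_continuous aC bC.
have sO' : `[x0, x1] `*` `[s0, s1] `<=` O.
  by move=> [x s] [/= h1 /s01uv h2]; apply: sO.
rewrite integral_box; [|exact: measurable_itv|exact: measurable_itv|exact: continuous_box_integrable sO' cbr].
have := green_iterated x01 sO aC bC aside us0 s01 s1v.
pose psi s := \int[mu]_(x in `[x0, x1]) (dy a (x, s) * dx b (x, s) - dx a (x, s) * dy b (x, s)).
rewrite -[X in X = _]/(\int[mu]_(s in `[s0, s1]) psi s).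
rewrite [X in _ = _ - X](_ : _ = 0); last first.
  by rewrite /Rintegral integral0_eq// => x xI; rewrite a0// mul0r.
rewrite subr0 => <-.
have ipsi : mu.-integrable `[s0, s1] (fun s => (psi s)%:E).
  apply: continuous_compact_integrable; first exact: segment_compact.
  apply: continuous_in_subspaceT => s; rewrite inE/= in_itv/= => /andP[h1 h2].
  have sI : s \in `]u, v[ by rewrite in_itv/= (lt_le_trans us0)//= (le_lt_trans h2).
  have H := green_psi_continuous sO aC bC; by apply: H.
have ibr y : y \in `[s0, s1] -> mu.-integrable `[x0, x1] (fun x => (br a b (x, y))%:E).
  by move=> /s01uv yI; exact: (slice_integrable sO cbr yI).
rewrite -Rintegral_opp// /Rintegral fineK; last first.
  by apply: integrable_fin_num => //; exact: (integrableN ipsi).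
apply: eq_integral => y; rewrite inE => yI.
rewrite -[LHS]fineK; last by apply: integrable_fin_num => //; exact: ibr.
congr EFin; rewrite /psi -[RHS]Rintegral_opp//; first by apply: eq_Rintegral => x _; rewrite /br; ring.
apply: eq_integrable (integrableN (ibr _ yI)) => // x _ /=.
by congr EFin; rewrite /br; ring.
Qed.

Definition square (p : P) (d : R) : set PM :=
  `[p.1 - d, p.1 + d]%classic `*` `[p.2 - d, p.2 + d]%classic.

(** With [a] null on the whole boundary nothing is left of Green's formula: an integral of brackets
    does not see a modification made inside the square. *)
Lemma green_box_zero (O : set P) (p : P) (d : R) (a b : P -> R) : open O -> 0 < d ->
  (forall z, `|z - p| <= 2 * d -> O z) -> C1 O a -> C1 O b ->
  (forall z, d <= `|z - p| -> a z = 0) ->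
  (\int[lam]_(z in square p d) (br a b z)%:E = 0)%E.
Proof.
move=> oO d0 dO aC bC a0.
have far x s : d <= `|x - p.1| \/ d <= `|s - p.2| -> a (x, s) = 0.
  move=> h; apply: a0; rewrite prod_normE/= le_max.
  by case: h => ->; rewrite ?orbT.
have -> := @green_box O (p.1 - d) (p.1 + d) (p.2 - 2 * d) (p.2 - d) (p.2 + d) (p.2 + 2 * d) a b oO
  ltac:(lra) ltac:(lra) ltac:(lra) ltac:(lra) _ aC bC.
- rewrite /Rintegral integral0_eq ?oppr0// => x _; rewrite far ?mul0r//; right.
  by rewrite (addrC p.2) addrK ger0_norm// ltW.
- move=> [x s] /= []; rewrite !in_itv/= => /andP[x1 x2] /andP[s1 s2].
  apply: dO; rewrite prod_normE/= ge_max; apply/andP; split; rewrite ler_norml; apply/andP; split; lra.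
- by move=> s _; rewrite !far//; left; rewrite (addrC p.1) addrK ?normrN ger0_norm// ltW.
- by move=> x _; rewrite far//; right; rewrite (addrC p.2) addrK normrN ger0_norm// ltW.
Qed.

Lemma differentiable_bound (f : P -> R) p (e : R) : differentiable f p -> 0 < e ->
  exists2 d : R, 0 < d & forall z, `|z - p| < d ->
    `|f z - (f p + linear_form (dx f p) (dy f p) (z - p))| <= e * `|z - p|.
Proof.
move=> df e0; have [_ dfE] := differentiable_is_diff df.
have := diff_locally df; rewrite dfE => /eqaddoP /(_ _ e0) /nbhs_ballP[d /= d0 H].
exists d => // z zd; have := H (z - p).
rewrite -ball_normE/= sub0r normrN => /(_ zd).
by rewrite !fctE/= subrK.
Qed.

Lemma C1_setT_cover (O1 O2 : set P) (f : P -> R) : (forall z, O1 z \/ O2 z) ->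
  C1 O1 f -> C1 O2 f -> C1 setT f.
Proof. by move=> cv f1 f2 z _; have [/f1|/f2] := cv z. Qed.

Lemma continuous_norm_sub (p : P) : continuous (fun z : P => `|z - p| : R).
Proof.
move=> z; apply: (@continuous_comp _ _ _ (fun z : P => z - p) Num.norm); last exact: norm_continuous.
by apply: cvgB; [exact: cvg_id|exact: cvg_cst].
Qed.

Lemma open_norm_lt (p : P) (d : R) : open [set z : P | `|z - p| < d].
Proof.
rewrite (_ : mkset _ = setT `&` (fun z : P => `|z - p|) @^-1` `]-oo, d[%classic); last first.
  by apply/seteqP; split => z /=; rewrite in_itv//= => -[].
apply: open_preimage_in; [exact: openT|by move=> z _; exact: continuous_norm_sub|exact: interval_open].
Qed.

Lemma open_norm_gt (p : P) (d : R) : open [set z : P | d < `|z - p|].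
Proof.
rewrite (_ : mkset _ = setT `&` (fun z : P => `|z - p|) @^-1` `]d, +oo[%classic); last first.
  by apply/seteqP; split => z /=; rewrite in_itv/= andbT// => -[].
apply: open_preimage_in; [exact: openT|by move=> z _; exact: continuous_norm_sub|exact: interval_open].
Qed.

(** A telescoping: each bracket on the left contains a difference, which vanishes wherever the two
    pairs of functions agree. *)
Lemma brB (a b c d : P -> R) z : differentiable a z -> differentiable b z ->
  differentiable c z -> differentiable d z ->
  br (fun z => a z - c z) b z + br c (fun z => b z - d z) z = br a b z - br c d z.
Proof.
move=> da db dc dd; rewrite /br -!dxE -!dyE !deriveB; try exact: diff_derivable.
rewrite !dxE !dyE; ring.
Qed.

Lemma is_diff_linear_form (z : P) (k l : R) : is_diff z (linear_form k l) (linear_form k l).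
Proof.
apply: DiffDef; first exact/linear_differentiable/linear_form_continuous.
by rewrite diff_lin//; exact: linear_form_continuous.
Qed.

Lemma is_diff_snd (z : P) : is_diff z (snd : P -> R) (linear_form 0 1).
Proof.
rewrite (_ : snd = linear_form 0 1); first exact: is_diff_linear_form.
by apply/funext => v; rewrite /linear_form mulr0 add0r mulr1.
Qed.

Lemma is_diff_fst (z : P) : is_diff z (fst : P -> R) (linear_form 1 0).
Proof.
rewrite (_ : fst = linear_form 1 0); first exact: is_diff_linear_form.
by apply/funext => v; rewrite /linear_form mulr0 addr0 mulr1.
Qed.

Lemma br_snd (V : P -> R) z : br V snd z = dx V z.
Proof. by rewrite /br (is_diff_dx (is_diff_snd z)) (is_diff_dy (is_diff_snd z)); ring. Qed.

(** Cramer's rule, with a bound on the norm of the inverse matrix for the sup norm. *)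
Lemma linear_form_inverse (a b c d : R) (h : P) : a * d - b * c != 0 ->
  `|h| <= (`|a| + `|b| + `|c| + `|d|) / `|a * d - b * c| *
     Num.max `|linear_form a b h| `|linear_form c d h|.
Proof.
move=> D0; set D := a * d - b * c; set u := linear_form a b h; set v := linear_form c d h.
set N := Num.max _ _.
have uN : `|u| <= N by rewrite le_max lexx.
have vN : `|v| <= N by rewrite le_max lexx orbT.
have N0 : 0 <= N by rewrite (le_trans _ uN).
rewrite mulrAC ler_pdivlMr ?normr_gt0// prod_normE maxr_pMl//.
have E1 : D * h.1 = d * u - b * v by rewrite /D /u /v /linear_form; ring.
have E2 : D * h.2 = a * v - c * u by rewrite /D /u /v /linear_form; ring.
have le4 (x y : R) : `|x * u| <= `|x| * N /\ `|y * v| <= `|y| * N by rewrite !normrM !ler_wpM2l.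
rewrite ge_max -!normrM ![_ * D]mulrC E1 E2 !mulrDl; apply/andP; split.
  have [h1 h2] := le4 d b; rewrite (le_trans (ler_normB _ _))//.
  have := mulr_ge0 (normr_ge0 a) N0; have := mulr_ge0 (normr_ge0 c) N0; lra.
have [h1 h2] := le4 c a; rewrite (le_trans (ler_normB _ _))//.
have := mulr_ge0 (normr_ge0 b) N0; have := mulr_ge0 (normr_ge0 d) N0; lra.
Qed.

End green_plane.

(** * The change of variables formula *)

Section lax.
Context {R : realType}.
Local Notation P := (plane R).
Local Notation PM := (measurableTypeR R * measurableTypeR R)%type.
Local Notation mu := (@lebesgue_measure R).
Local Notation lam := (lebesgue_plane R).

Lemma norm_sum_le0 (a b c d : R) : `|a| + `|b| + `|c| + `|d| <= 0 -> a = 0 /\ b = 0.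
Proof.
have := normr_ge0 a; have := normr_ge0 b; have := normr_ge0 c; have := normr_ge0 d.
by move=> *; split; apply/normr0_eq0; lra.
Qed.

Definition open_square (p : P) (d : R) : set P := [set z : P | `|z - p| < d].

Lemma open_square_sub (p : P) (d : R) : 0 < d -> open_square p d `<=` square p (2 * d).
Proof.
move=> d0 z; rewrite /open_square/square/= prod_normE/= gt_max !in_itv/= !ltr_norml.
by move=> /andP[/andP[h1 h2] /andP[h3 h4]]; split; apply/andP; split; lra.
Qed.

Lemma near_open_square (p z : P) (d : R) : open_square p d z -> \near z, open_square p d z.
Proof. by move=> h; apply: open_nbhs_nbhs; split; [exact: open_norm_lt|]. Qed.

Lemma integral_scale_support d (T : measurableType d) (m : {measure set T -> \bar R}) (S : set T)
    (f h : T -> R) (k : R) : 0 <= k -> measurable_fun setT f -> (forall z, 0 <= f z) ->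
  (forall z, h z = k * f z) -> (forall z, ~ S z -> f z = 0) ->
  (\int[m]_(z in S) (h z)%:E = k%:E * \int[m]_z (f z)%:E)%E.
Proof.
move=> k0 mf f0 hE fS; rewrite -ge0_integralZl_EFin//; last 2 first.
- by move=> z _; rewrite lee_fin.
- exact/measurable_EFinP.
rewrite integral_mkcond; apply: eq_integral => z _; rewrite patchE hE -EFinM.
by case: ifPn => // /negP zS; rewrite fS ?mulr0// => Sz; apply: zS; rewrite inE.
Qed.

Lemma norm_near_far (x y w t : R) : `|y - x| <= t -> t + t <= `|x - w| -> t <= `|y - w|.
Proof.
move=> yx; have -> : x - w = (y - w) - (y - x) by ring.
by have := ler_normB (y - w) (y - x); lra.
Qed.

(** Near the centre the Jacobian determinant keeps the sign it has there, so that a constant sign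
    can stand for the absolute value. *)
Lemma sgr_mul_near (D J : R) : `|D - J| < `|D| -> Num.sg D * J = `|J|.
Proof.
have [D0|D0|->] := ltgtP D 0; last by rewrite normr0 ltNge normr_ge0.
  rewrite (ltr0_norm D0) ltr_distl => /andP[h _]; rewrite ltr0_sg// mulN1r ltr0_norm//; lra.
rewrite (gtr0_norm D0) ltr_distl => /andP[_ h]; rewrite gtr0_sg// mul1r gtr0_norm//; lra.
Qed.

Lemma dxM (a b : P -> R) z : differentiable a z -> differentiable b z ->
  dx (fun z => a z * b z) z = a z * dx b z + b z * dx a z.
Proof. by move=> da db; rewrite -!dxE deriveM//; exact: diff_derivable. Qed.

Lemma dx_snd (h : R -> R) (z : P) : dx (h \o snd) z = 0.
Proof.
rewrite -dxE /derive plane_basis0 (_ : (fun t : R => _) = fun=> 0) ?lim_cst//.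
by apply/funext => t /=; rewrite [t *: 0]mulr0 add0r subrr scaler0.
Qed.

Lemma integral_eq_of_sub d (T : measurableType d) (m : {measure set T -> \bar R}) (S : set T)
    (A B C E : T -> R) : measurable S ->
  m.-integrable S (fun z => (A z)%:E) -> m.-integrable S (fun z => (B z)%:E) ->
  m.-integrable S (fun z => (C z)%:E) -> m.-integrable S (fun z => (E z)%:E) ->
  (forall z, A z - B z = C z - E z) ->
  (\int[m]_(z in S) (A z)%:E = 0)%E -> (\int[m]_(z in S) (B z)%:E = 0)%E ->
  (\int[m]_(z in S) (C z)%:E = \int[m]_(z in S) (E z)%:E)%E.
Proof.
move=> mS iA iB iC iE ABCE A0 B0.
have : (\int[m]_(z in S) (C z)%:E - \int[m]_(z in S) (E z)%:E = 0)%E.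
  rewrite -integralB//; transitivity (\int[m]_(z in S) ((A z)%:E - (B z)%:E))%E.
    by apply: eq_integral => z _; rewrite -!EFinB ABCE.
  by rewrite integralB// A0 B0 sube0.
have := integrable_fin_num mS iC; have := integrable_fin_num mS iE.
case: (\int[m]_(z in S) (C z)%:E)%E => // x; case: (\int[m]_(z in S) (E z)%:E)%E => // y _ _.
by rewrite -EFinB => -[/eqP]; rewrite subr_eq0 => /eqP ->.
Qed.

Lemma C1_cutoff_affine (l : P -> R) (c d : R) : C1 setT l ->
  C1 setT (fun z => cutoff ((l z - c) / d)).
Proof.
move=> lC; apply: (C1_cutoff openT).
exact: (C1M openT (C1B openT lC (C1_cst c openT)) (C1_cst d^-1 openT)).
Qed.

(* [l] everywhere, except near [p], where it is deformed into [g] *)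
Definition deform (p : P) (d0 : R) (th g l : P -> R) (z : P) : R :=
  if `|z - p| < d0 then l z + th z * (g z - l z) else l z.

Lemma C1_deform (O : set P) (p : P) (d d0 : R) (th g l : P -> R) : d < d0 ->
  (forall z, `|z - p| < d0 -> O z) -> (forall z, d <= `|z - p| -> th z = 0) ->
  C1 setT th -> C1 O g -> C1 setT l -> C1 setT (deform p d0 th g l).
Proof.
move=> dd HO th0 thC gC lC.
apply: (@C1_setT_cover _ (open_square p d0) [set z : P | d < `|z - p|]).
- move=> z; have [h|h] := ltP `|z - p| d0; [by left|right].
  exact: lt_le_trans dd h.
- apply: (@C1_eq _ _ (fun z => l z + th z * (g z - l z))); first exact: open_norm_lt.
    by move=> z zd; rewrite /deform ifT.
  have gC' : C1 (open_square p d0) g by apply: C1_sub gC => z /HO.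
  have lC' : C1 (open_square p d0) l by exact: C1_sub lC.
  have tC' : C1 (open_square p d0) th by exact: C1_sub thC.
  have o : open (open_square p d0) := @open_norm_lt R p d0.
  exact: (C1D o lC' (C1M o tC' (C1B o gC' lC'))).
- apply: (@C1_eq _ _ l); first exact: open_norm_gt.
    by move=> z /= h; rewrite /deform; case: ifP => // _; rewrite th0 ?mul0r ?addr0// ltW.
  exact: C1_sub lC.
Qed.

Section local.
Variables (O : set P) (F : P -> P) (p : P).
Hypotheses (oO : open O) (FC : C1map O F) (Op : O p) (J0 : jac F p != 0).

Let f1 : P -> R := fst \o F.
Let f2 : P -> R := snd \o F.
Let D := jac F p.
Let K := (`|dx f1 p| + `|dy f1 p| + `|dx f2 p| + `|dy f2 p|) / `|D|.

Let D_E : D = dx f1 p * dy f2 p - dy f1 p * dx f2 p. Proof. by []. Qed.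

Let K0 : 0 < K.
Proof.
apply: divr_gt0; last by rewrite normr_gt0.
rewrite ltNge; apply/negP => /norm_sum_le0[e1 e2].
by move: J0; rewrite -/D D_E e1 e2 !mul0r subrr eqxx.
Qed.

(** The linearization at [p] expands distances to [p] by at least 1 / K = 2 m; an error of m times
    the distance then still leaves an expansion by m. *)
Let m := (2 * K)^-1.
Let m0 : 0 < m. Proof. by rewrite invr_gt0; apply: mulr_gt0 => //; exact: K0. Qed.

Let L1 z := dx f1 p * z.1 + dy f1 p * z.2 + (f1 p - dx f1 p * p.1 - dy f1 p * p.2).
Let L2 z := dx f2 p * z.1 + dy f2 p * z.2 + (f2 p - dx f2 p * p.1 - dy f2 p * p.2).

Let L1E z : L1 z = f1 p + linear_form (dx f1 p) (dy f1 p) (z - p).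
Proof. by rewrite /L1 /linear_form/=; ring. Qed.
Let L2E z : L2 z = f2 p + linear_form (dx f2 p) (dy f2 p) (z - p).
Proof. by rewrite /L2 /linear_form/=; ring. Qed.

Let affC (k l c : R) : C1 setT (fun z : P => k * z.1 + l * z.2 + c).
Proof.
have := C1D openT (C1_linear_form k l openT) (C1_cst c (@openT P)).
by apply: C1_eq; [exact: openT|move=> z _; rewrite /linear_form; ring].
Qed.

Let affdx (k l c : R) z : is_diff z (fun z : P => k * z.1 + l * z.2 + c) (linear_form k l).
Proof.
have := is_diffD (is_diff_linear_form z k l) (is_diff_cst c z).
rewrite addr0; congr (is_diff _ _ _).
by apply/funext => v; rewrite /linear_form !fctE; ring.
Qed.

Let jacL z : br L1 L2 z = D.
Proof. by rewrite /br (is_diff_dx (affdx _ _ _ z)) (is_diff_dy (affdx _ _ _ z)) (is_diff_dx (affdx _ _ _ z)) (is_diff_dy (affdx _ _ _ z)). Qed.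

Let far_L z : 2 * m * `|z - p| <= Num.max `|L1 z - f1 p| `|L2 z - f2 p|.
Proof.
have E1 : L1 z - f1 p = linear_form (dx f1 p) (dy f1 p) (z - p) by rewrite L1E addrC addKr.
have E2 : L2 z - f2 p = linear_form (dx f2 p) (dy f2 p) (z - p) by rewrite L2E addrC addKr.
have H := linear_form_inverse (z - p) J0.
have -> : 2 * m = K^-1 by rewrite /m invfM mulrA divff ?mul1r.
by rewrite E1 E2 ler_pdivrMl.
Qed.

(* After P. Lax: [g] below agrees with [F] near [p] and with the linearization [L] of [F] at [p] away
   from [p].  The Jacobian determinant of [(V \o g, g2)] is a divergence, so its integral does not see
   the deformation and can be computed with [L]. *)
Lemma lax_local : exists d r : R, [/\ 0 < d, 0 < r, (forall z, `|z - p| < d -> O z) &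
  forall a b c e n, (`]a, b[%classic `*` `]c, e[%classic `<=` open_square (F p) r) ->
  (\int[lam]_(z in open_square p d) (plateau a b n (f1 z) * plateau c e n (f2 z) * `|jac F z|)%:E =
    \int[mu]_x (plateau a b n x)%:E * \int[mu]_x (plateau c e n x)%:E)%E].
Proof.
have [F1 F2] := FC.
have [df1 _ _] := F1 p Op; have [df2 _ _] := F2 p Op.
have [d1 d10 H1] := differentiable_bound df1 m0.
have [d2 d20 H2] := differentiable_bound df2 m0.
have Op' : p \in O by rewrite inE.
have D0' : 0 < `|D| by rewrite normr_gt0.
have /cvgrPdist_lt/(_ _ D0')/nbhs_ballP[d3 /= d30 H3] := br_C1_continuous F1 F2 Op'.
have /nbhs_ballP[d4 /= d40 H4] := open_nbhs_nbhs (conj oO Op).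
pose d0 := Num.min (Num.min d1 d2) (Num.min d3 d4).
have d00 : 0 < d0 by rewrite !lt_min d10 d20 d30 d40.
(* A cut-off at scale [d] lives in the square of radius 2 d, which has to fit inside radius [d0],
   where the linearization estimates hold. *)
pose d := d0 / 8.
have dp : 0 < d by rewrite divr_gt0.
have dd1 : d < d0 by rewrite /d ltr_pdivrMr// ltr_pMr// ltr1n.
have inB z r : `|z - p| < r -> ball p r z by rewrite -ball_normE/= distrC.
have H01 z : `|z - p| < d0 -> `|f1 z - L1 z| <= m * `|z - p|.
  by rewrite !lt_min => /andP[/andP[h _] _]; rewrite L1E; exact: H1.
have H02 z : `|z - p| < d0 -> `|f2 z - L2 z| <= m * `|z - p|.
  by rewrite !lt_min => /andP[/andP[_ h] _]; rewrite L2E; exact: H2.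
have HJ z : `|z - p| < d0 -> `|D - jac F z| < `|D|.
  by rewrite !lt_min => /andP[_ /andP[h _]]; apply: H3; exact: inB.
have HO z : `|z - p| < d0 -> O z.
  by rewrite !lt_min => /andP[_ /andP[_ h]]; apply: H4; exact: inB.
exists d, (m * d); split => //; first by rewrite mulr_gt0.
  by move=> z zd; apply: HO; exact: lt_trans zd dd1.
move=> a b c e n sub.
pose th (z : P) := cutoff ((z.1 - p.1) / d) * cutoff ((z.2 - p.2) / d).
have th01 z : 0 <= th z <= 1.
  by rewrite mulr_ge0 ?cutoff_ge0//= mulr_ile1 ?cutoff_ge0 ?cutoff_le1.
have th1 z : `|z - p| <= d -> th z = 1.
  rewrite prod_normE/= ge_max => /andP[h1 h2]; rewrite /th !cutoff_in ?mulr1//.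
    by rewrite normrM normfV (gtr0_norm dp) ler_pdivrMr// mul1r.
  by rewrite normrM normfV (gtr0_norm dp) ler_pdivrMr// mul1r.
have th0 z : 2 * d <= `|z - p| -> th z = 0.
  rewrite prod_normE/= le_max => /orP[h|h]; rewrite /th.
    by rewrite cutoff_out ?mul0r// normrM normfV (gtr0_norm dp) ler_pdivlMr.
  by rewrite mulrC cutoff_out ?mul0r// normrM normfV (gtr0_norm dp) ler_pdivlMr.
have thC : C1 setT th by exact: (C1M openT (C1_cutoff_affine p.1 d (C1_fst openT)) (C1_cutoff_affine p.2 d (C1_snd openT))).
clearbody th.
have dd0 : 2 * d < d0 by rewrite /d; lra.
pose g1 := deform p d0 th f1 L1; pose g2 := deform p d0 th f2 L2.
have g1C : C1 setT g1 by apply: (C1_deform dd0 HO th0 thC F1); exact: affC.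
have g2C : C1 setT g2 by apply: (C1_deform dd0 HO th0 thC F2); exact: affC.
have near_L z : `|z - p| < d0 -> Num.max `|g1 z - L1 z| `|g2 z - L2 z| <= m * `|z - p|.
  move=> zd; have /andP[t0 t1] := th01 z.
  rewrite /g1 /g2 /deform zd.
  rewrite (addrC (L1 z)) (addrC (L2 z)) !addrK !normrM (ger0_norm t0) ge_max.
  by apply/andP; split; [rewrite (le_trans _ (H01 _ zd))//|rewrite (le_trans _ (H02 _ zd))//]; rewrite ler_piMl.
(* The deformed map keeps expansion m everywhere: near [p] because 2 m loses at most m, farther away
   because there it is the linearization. Hence no point at distance at least [d] from [p] is sent
   into the open square of radius m d about F p, where the plateaus live. *)
have far_g z : m * `|z - p| <= Num.max `|g1 z - f1 p| `|g2 z - f2 p|.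
  have [zd|zd] := ltP `|z - p| d0; last first.
    rewrite /g1 /g2 /deform ltNge zd/=; apply: le_trans (far_L z).
    have mz : 0 <= m * `|z - p| by rewrite mulr_ge0// ltW.
    by rewrite -mulrA mulr_natl mulr2n lerDl.
  have h := far_L z; have := near_L z zd; rewrite ge_max => /andP[n1 n2].
  move: h; rewrite -mulrA mulr_natl mulr2n !le_max => /orP[h|h]; apply/orP; [left|right].
    exact: norm_near_far n1 h.
  exact: norm_near_far n2 h.
have gu z : d <= `|z - p| -> plateau a b n (g1 z) * plateau c e n (g2 z) = 0.
  move=> zd; have [h1|h1] := boolP (g1 z \in `]a, b[); last by rewrite plateau_out ?mul0r.
  have [h2|h2] := boolP (g2 z \in `]c, e[); last by rewrite [X in _ * X]plateau_out ?mulr0.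
  have := sub (g1 z, g2 z) (conj h1 h2).
  rewrite /open_square/= prod_normE/= => h.
  have := le_lt_trans (far_g z) h; rewrite ltr_pM2l// ltNge zd//.
have g_near z : `|z - p| < d -> g1 z = f1 z /\ g2 z = f2 z.
  move=> zd; have zd0 : `|z - p| < d0 by exact: lt_trans zd dd1.
  rewrite /g1 /g2 /deform zd0 th1 ?ltW// !mul1r.
  by split; rewrite addrC subrK.
have Lu_out z : d <= `|z - p| -> plateau a b n (L1 z) * plateau c e n (L2 z) = 0.
  move=> zd; have [h1|h1] := boolP (L1 z \in `]a, b[); last by rewrite plateau_out ?mul0r.
  have [h2|h2] := boolP (L2 z \in `]c, e[); last by rewrite [X in _ * X]plateau_out ?mulr0.
  have := sub (L1 z, L2 z) (conj h1 h2).
  rewrite /open_square/= prod_normE/= => h.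
  have := le_lt_trans (far_L z) h; rewrite -mulrA mulr_natl mulr2n.
  have : m * d <= m * `|z - p| by rewrite ler_wpM2l// ltW.
  have : 0 < m * d by rewrite mulr_gt0.
  by move=> *; exfalso; lra.
have [B BE] := plateau_primitive a b n.
pose sg := Num.sg D.
(* The bracket of [V] with the second coordinate is the signed product of plateaus; composing with a
   map multiplies it by the Jacobian determinant. *)
pose V (w : P) := sg * (B w.1 * plateau c e n w.2).
have VC : C1 setT V.
  have BC : C1 setT (B \o fst).
    apply: (C1_outer (dh := plateau a b n) openT (C1_fst openT)) => z _.
    by split; [exact: BE|exact: continuous_plateau].
  exact: (C1M openT (C1_cst sg openT) (C1M openT BC (C1_plateau c e n openT (C1_snd openT)))).
have dV w : differentiable V w by have [] := VC w I.
have dxV w : dx V w = sg * (plateau a b n w.1 * plateau c e n w.2).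
  have dB : is_diff w (B \o (fst : P -> R)) (linear_form (plateau a b n w.1 * 1) (plateau a b n w.1 * 0)).
    exact: is_diff_outer (BE _) (is_diff_fst w).
  have [dB1 _] := dB.
  have [dc _ _] := @C1_plateau R setT c e n snd openT (C1_snd openT) w I.
  rewrite /V dxM; [|exact: differentiable_cst|exact: differentiableM].
  rewrite dxM// (is_diff_dx dB) (dx_snd (plateau c e n)) (_ : dx (fun=> sg) w = 0).
    by rewrite /=; ring.
  by rewrite -dxE derive_cst.
pose g z := (g1 z, g2 z); pose L z := (L1 z, L2 z).
have dg1 z : differentiable g1 z by have [] := g1C z I.
have dg2 z : differentiable g2 z by have [] := g2C z I.
have dsnd w : differentiable (snd : P -> R) w by have [] := is_diff_snd w.
have dL1 z : differentiable L1 z by have [] := affC (dx f1 p) (dy f1 p) (f1 p - dx f1 p * p.1 - dy f1 p * p.2) I (z := z).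
have dL2 z : differentiable L2 z by have [] := affC (dx f2 p) (dy f2 p) (f2 p - dx f2 p * p.1 - dy f2 p * p.2) I (z := z).
have brg z : br (V \o g) g2 z = sg * (plateau a b n (g1 z) * plateau c e n (g2 z)) * jac g z.
  by rewrite (@br_comp R V snd g z)// br_snd dxV.
have brL z : br (V \o L) L2 z = sg * (plateau a b n (L1 z) * plateau c e n (L2 z)) * D.
  by rewrite (@br_comp R V snd L z)// br_snd dxV -(jacL z).
have gL z : 2 * d <= `|z - p| -> g1 z = L1 z /\ g2 z = L2 z.
  by move=> zd; rewrite /g1 /g2 /deform (th0 z zd) !mul0r !addr0 !if_same.
have VgC : C1 setT (V \o g) by exact: (@C1_comp _ setT setT V g openT (conj g1C g2C) VC (fun _ _ => I)).
have VLC : C1 setT (V \o L) by exact: (@C1_comp _ setT setT V L openT (conj (affC _ _ _) (affC _ _ _)) VC (fun _ _ => I)).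
have L2C : C1 setT L2 by exact: affC.
have d20' : 0 < 2 * d by rewrite mulr_gt0.
(* [g] and [L] agree beyond radius 2 d, so both halves of the telescoped difference of brackets have
   integral zero. *)
have Z1 : (\int[lam]_(z in square p (2 * d)) (br (fun z => (V \o g) z - (V \o L) z) g2 z)%:E = 0)%E.
  have H z : 2 * d <= `|z - p| -> (V \o g) z - (V \o L) z = 0.
    by move=> /gL[h1 h2]; rewrite /= /g /L h1 h2 subrr.
  exact: (green_box_zero openT d20' (fun _ _ => I) (C1B openT VgC VLC) g2C H).
have Z2 : (\int[lam]_(z in square p (2 * d)) (br (fun z => g2 z - L2 z) (V \o L) z)%:E = 0)%E.
  have H z : 2 * d <= `|z - p| -> g2 z - L2 z = 0 by move=> /gL[h1 h2]; rewrite h2 subrr.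
  exact: (green_box_zero openT d20' (fun _ _ => I) (C1B openT g2C L2C) VLC H).
have msq : measurable (square p (2 * d)) by apply: measurableX; exact: measurable_itv.
have isq (f h : P -> R) : C1 setT f -> C1 setT h ->
    lam.-integrable (square p (2 * d)) (fun z => (br f h z)%:E).
  move=> fC hC; apply: (continuous_box_integrable openT) => //.
  exact: br_C1_continuous fC hC.
have Z : (\int[lam]_(z in square p (2 * d)) (br (V \o g) g2 z)%:E =
   \int[lam]_(z in square p (2 * d)) (br (V \o L) L2 z)%:E)%E.
  have ABCE z : br (fun z => (V \o g) z - (V \o L) z) g2 z - br (fun z => g2 z - L2 z) (V \o L) z =
      br (V \o g) g2 z - br (V \o L) L2 z.
    have [dVg _ _] := VgC z I; have [dVL _ _] := VLC z I.
    rewrite -(brB dVg (dg2 z) dVL (dL2 z)) /br.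
    move: (dx _ z) (dy _ z) (dx g2 z) (dy g2 z) (dx _ z) (dy _ z) (dx _ z) (dy _ z) => *; ring.
  exact: (integral_eq_of_sub msq (isq _ _ (C1B openT VgC VLC) g2C) (isq _ _ (C1B openT g2C L2C) VLC)
    (isq _ _ VgC g2C) (isq _ _ VLC L2C) ABCE Z1 Z2).
have mos : measurable (open_square p d : set PM) by apply: open_measurable_plane; exact: open_norm_lt.
have os_sq := @open_square_sub p d dp.
have out_os z : z \notin open_square p d -> d <= `|z - p|.
  by rewrite notin_setE /open_square/= => /negP; rewrite -leNgt.
transitivity (\int[lam]_(z in square p (2 * d)) (br (V \o g) g2 z)%:E)%E.
  rewrite [LHS]integral_mkcond [RHS]integral_mkcond; apply: eq_integral => z _.
  rewrite !patchE; case: ifPn => zo.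
    have zd : `|z - p| < d by rewrite inE in zo.
    rewrite mem_set; last by apply: os_sq; rewrite inE in zo.
    have [e1 e2] := g_near z zd.
    rewrite brg e1 e2; congr EFin.
    have -> : jac g z = jac F z.
      have ond := near_open_square zd.
      by apply: near_br; apply: filterS ond => y /g_near[h1 h2]; rewrite /g/= ?h1 ?h2.
    have zd0 : `|z - p| < d0 by exact: lt_trans zd dd1.
    by rewrite -(sgr_mul_near (HJ z zd0)) -/sg; ring.
  case: ifP => [_|_]; last reflexivity.
  rewrite brg gu; last exact: out_os.
  by rewrite mulr0 mul0r.
have aff : (`|D|%:E * \int[lam]_z (plateau a b n (L1 z) * plateau c e n (L2 z))%:E =
    \int[mu]_x (plateau a b n x)%:E * \int[mu]_x (plateau c e n x)%:E)%E.
  exact: (@affine_integral_plane R _ _ _ _ _ _ _ _ (@continuous_plateau R a b n) (@continuous_plateau R c e n)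
   (plateau_ge0 a b n) (plateau_ge0 c e n) J0).
rewrite Z -aff.
apply: integral_scale_support.
- exact: normr_ge0.
- apply: (continuous_measurable_plane openT).
  exact: C1_continuous (C1M openT (C1_plateau a b n openT (affC _ _ _)) (C1_plateau c e n openT (affC _ _ _))).
- by move=> z; apply: mulr_ge0; exact: plateau_ge0.
- by move=> z; rewrite brL normrEsg -/sg; ring.
- move=> z zS; apply: Lu_out; apply: out_os; apply: contra_notN zS.
  by rewrite inE; exact: os_sq.
Qed.

End local.
End lax.

(** * Integration against a measure given by a density along a map *)

Section transfer.
Local Open Scope ereal_scope.
Context d1 d2 (T1 : measurableType d1) (T2 : measurableType d2) (R : realType).
Variables (m1 : {measure set T1 -> \bar R}) (m2 : {measure set T2 -> \bar R}).
Variables (D : set T1) (A : set T2) (phi : T1 -> T2) (w : T1 -> R).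
Hypotheses (mD : measurable D) (mA : measurable A) (mphi : measurable_fun D phi).
Hypotheses (mw : measurable_fun D w) (w0 : forall x, D x -> (0 <= w x)%R).
Hypothesis DA : forall x, D x -> A (phi x).
Hypothesis m2E : forall B, measurable B -> B `<=` A ->
  m2 B = \int[m1]_(x in D `&` phi @^-1` B) (w x)%:E.

Import HBNNSimple.

(** By linearity the identity passes from measures of sets to simple functions, and by monotone
    convergence to nonnegative measurable functions. *)
Lemma ge0_integral_transfer (f : T2 -> \bar R) : measurable_fun A f ->
  (forall y, A y -> 0 <= f y) ->
  \int[m2]_(y in A) f y = \int[m1]_(x in D) (f (phi x) * (w x)%:E).
Proof.
move=> mf f0.
pose h := nnsfun_approx mA mf.
have mhphi n : measurable_fun D (fun x => h n (phi x)).
  by apply: (measurable_comp measurableT) mphi => //; exact: measurable_funP.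
have -> : \int[m2]_(x in A) f x =
    lim (\int[m2]_(x in A) (EFin \o h n) x @[n --> \oo]).
  have fE x : A x -> f x = lim ((EFin \o h n) x @[n --> \oo]).
    by move=> Ax; apply/esym/cvg_lim => //; exact: cvg_nnsfun_approx.
  under eq_integral => x /[!inE] /fE -> //.
  apply: monotone_convergence => //.
  - move=> n; apply/measurable_EFinP.
    by apply: (measurable_funS measurableT) => //; exact/measurable_funP.
  - by move=> n x Ex //=; rewrite lee_fin.
  - by move=> x Ex a b ab; rewrite lee_fin; exact/lefP/nd_nnsfun_approx.
have -> : \int[m1]_(x in D) (f (phi x) * (w x)%:E) =
    lim (\int[m1]_(x in D) ((h n (phi x))%:E * (w x)%:E) @[n --> \oo]).
  have fg x : D x -> f (phi x) * (w x)%:E = lim (((h n (phi x))%:E * (w x)%:E) @[n --> \oo]).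
    move=> Dx; apply/esym/cvg_lim => //; apply: cvgeZr => //.
    by apply: cvg_nnsfun_approx => //; exact: DA.
  under eq_integral => x /[!inE] /fg -> //.
  apply: monotone_convergence => [//| | |].
  - by move=> n; apply: emeasurable_funM; apply/measurable_EFinP.
  - by move=> n x Ex /=; rewrite mule_ge0 ?lee_fin ?w0.
  - by move=> x Ex a b ab/=; rewrite lee_wpmul2r ?lee_fin ?w0//; exact/lefP/nd_nnsfun_approx.
apply: congr_lim; apply/funext => n.
transitivity (\int[m2]_(x in A)
   (\sum_(y \in range (h n)) (y * \1_(h n @^-1` [set y]) x)%:E)).
  by apply: eq_integral => t tE; rewrite /= fimfunE -fsumEFin.
rewrite ge0_integral_fsum//; last 2 first.
- by move=> y; apply/measurable_EFinP; apply: measurable_funTS; exact: measurable_funM.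
- by move=> m y Ey; exact: nnfun_muleindic_ge0.
transitivity (\int[m1]_(x in D) (\sum_(y \in range (h n))
    (y * \1_(h n @^-1` [set y]) (phi x))%:E * (w x)%:E)); last first.
  under [RHS]eq_integral => x xE.
    rewrite fimfunE -fsumEFin// ge0_mule_fsuml => [|y]; last exact: nnfun_muleindic_ge0.
    over.
  by [].
have mi y : measurable_fun D (fun x => (y * \1_(h n @^-1` [set y]) (phi x))%:E).
  apply/measurable_EFinP; apply: measurable_funM => //.
  by apply: (measurable_comp measurableT) mphi.
rewrite ge0_integral_fsum//; last 2 first.
- by move=> y; apply: emeasurable_funM => //; exact/measurable_EFinP.
- by move=> m y Ey; rewrite mule_ge0 ?lee_fin ?w0// -lee_fin nnfun_muleindic_ge0.
apply: eq_fsbigr => r rhn.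
rewrite integralZl_indic_nnsfun// integral_indic//.
have mhr : measurable (h n @^-1` [set r]) by [].
rewrite m2E; [|exact: measurableI|exact: subIsetr].
have r0 : (0 <= r)%R by move: rhn; rewrite inE => -[x _ <-].
under [RHS]eq_integral do rewrite EFinM -muleA.
rewrite ge0_integralZl//.
- congr (_ * _); rewrite [LHS]integral_mkcondr; apply: eq_integral => x; rewrite inE => Dx.
  rewrite /= patchE indicE; case: ifPn => hx.
    by rewrite mem_set ?mul1e//; move: hx; rewrite inE => -[].
  rewrite memNset ?mul0e// => hx'; move/negP: hx; apply; rewrite inE; split => //.
  exact: DA.
- apply: emeasurable_funM; last exact/measurable_EFinP.
  by apply/measurable_EFinP; apply: (measurable_comp measurableT) mphi.
- by move=> x Dx; rewrite mule_ge0// lee_fin ?w0.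
Qed.

End transfer.

(** * From boxes to measurable sets: the formula for a diffeomorphism *)

Section change_of_variables.
Context {R : realType}.
Local Notation P := (plane R).
Local Notation PM := (measurableTypeR R * measurableTypeR R)%type.
Local Notation lam := (lebesgue_plane R).

(** The plateaus increase to the indicator function of the open box, so that monotone convergence
    applies. *)
Lemma plateau_limit (D : set PM) (H : PM -> PM) (w : PM -> R) (a b c e : R) :
  measurable D -> measurable_fun D H -> measurable_fun D w -> (forall z, D z -> 0 <= w z) ->
  (\int[lam]_(z in D) (plateau a b n (H z).1 * plateau c e n (H z).2 * w z)%:E @[n --> \oo] -->
   \int[lam]_(z in D `&` H @^-1` (`]a, b[%classic `*` `]c, e[%classic)) (w z)%:E)%E.
Proof.
move=> mD mH mw w0.
have mp (x y : R) n : measurable_fun setT (plateau x y n).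
  by apply: continuous_measurable_fun; exact: continuous_plateau.
have mf n : measurable_fun D (fun z => (plateau a b n (H z).1 * plateau c e n (H z).2 * w z)%:E).
  apply/measurable_EFinP; apply: measurable_funM => //; apply: measurable_funM.
    apply: (measurable_comp measurableT) => //; first exact: mp.
    exact: (measurableT_comp measurable_fst mH).
  apply: (measurable_comp measurableT) => //; first exact: mp.
  exact: (measurableT_comp measurable_snd mH).
have f0 n z : D z -> (0 <= (plateau a b n (H z).1 * plateau c e n (H z).2 * w z)%:E)%E.
  by move=> Dz; rewrite lee_fin; apply: mulr_ge0; [apply: mulr_ge0; exact: plateau_ge0|exact: w0].
have nd z : D z -> {homo (fun n => (plateau a b n (H z).1 * plateau c e n (H z).2 * w z)%:E) : m n / (m <= n)%N >-> (m <= n)%E}.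
  move=> Dz m n mn; rewrite lee_fin ler_wpM2r ?w0// ler_pM ?plateau_ge0//; exact: plateau_nondecreasing.
have := @cvg_monotone_convergence _ _ _ lam _ mD _ mf f0 nd.
rewrite (_ : (\int[lam]_(z in D) _)%E = (\int[lam]_(z in D `&` H @^-1` (`]a, b[%classic `*` `]c, e[%classic)) (w z)%:E)%E)//.
rewrite [RHS]integral_mkcondr; apply: eq_integral => z; rewrite inE => Dz.
rewrite patchE; case: ifPn => zB.
  apply/cvg_lim => //; apply: cvg_EFin; first exact: nearW.
  rewrite -[X in _ --> X]mul1r -[X in X * _]mul1r.
  move: zB; rewrite inE => -[/= h1 h2].
  by apply: cvgM; [apply: cvgM; exact: plateau_cvg|exact: cvg_cst].
apply/cvg_lim => //; rewrite (_ : (fun n => _) = cst 0%E); first exact: cvg_cst.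
apply/funext => n; have [h1|h1] := boolP ((H z).1 \in `]a, b[); last by rewrite plateau_out ?mul0r.
have [h2|h2] := boolP ((H z).2 \in `]c, e[); last by rewrite [X in _ * X * _]plateau_out ?mulr0 ?mul0r.
by exfalso; move/negP : zB; apply; rewrite inE.
Qed.

Section diffeomorphism.
Variables (O O' : set P) (F G : P -> P).
Hypotheses (oO : open O) (oO' : open O') (FC : C1map O F).
Hypothesis J0 : forall z, O z -> jac F z != 0.
Hypothesis cG : {in O', continuous G}.
Hypothesis FO : forall z, O z -> O' (F z) /\ G (F z) = z.
Hypothesis GO : forall y, O' y -> O (G y) /\ F (G y) = y.

(** The measure that the formula predicts for [A]. Viewed as a measure, it can be compared with
    Lebesgue measure on boxes alone. *)
Definition pullback_measure (A : set PM) : \bar R :=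
  (\int[lam]_(z in O `&` F @^-1` A) `|jac F z|%:E)%E.

Let mF : measurable_fun (O : set PM) (F : PM -> PM).
Proof. by apply: continuous_map_measurable_plane => //; exact: C1map_continuous. Qed.

Let mO : measurable (O : set PM). Proof. exact: open_measurable_plane. Qed.

Let mFA A : measurable A -> measurable (O `&` F @^-1` A : set PM).
Proof. by move=> mA; exact: mF. Qed.

Let mJ : measurable_fun (O : set PM) (fun z : PM => `|jac F z|).
Proof.
apply: measurableT_comp => //; apply: continuous_measurable_plane => //.
by have [F1 F2] := FC; exact: br_C1_continuous.
Qed.

Let pullback0 : pullback_measure set0 = 0%E.
Proof. by rewrite /pullback_measure preimage_set0 setI0 integral_set0. Qed.

Let pullback_ge0 A : (0 <= pullback_measure A)%E.
Proof. by apply: integral_ge0 => z _; rewrite lee_fin. Qed.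

Let pullback_additive : semi_sigma_additive pullback_measure.
Proof.
move=> B mB tB mUB; rewrite /pullback_measure preimage_bigcup setI_bigcupr.
rewrite ge0_integral_bigcup//.
- by apply: is_cvg_ereal_nneg_natsum_cond => // n _ _; apply: integral_ge0 => z _; rewrite lee_fin.
- by move=> k; apply: mFA; exact: mB.
- apply/measurable_EFinP; apply: measurable_funS mJ => //.
  by move=> z [k _ []].
- apply/trivIsetP => i j _ _ ij; rewrite setIACA setIid -preimage_setI.
  by move/trivIsetP : tB => /(_ i j I I ij) ->; rewrite preimage_set0 setI0.
Qed.

HB.instance Definition _ := isMeasure.Build _ _ _ pullback_measure pullback0 pullback_ge0 pullback_additive.

Let pm : {measure set PM -> \bar R} := pullback_measure.

Lemma cv_box (p : P) : O p -> exists2 d : R, 0 < d & (open_square (F p) d `<=` O') /\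
  forall a b c e, `]a, b[%classic `*` `]c, e[%classic `<=` open_square (F p) d ->
    lam (`]a, b[%classic `*` `]c, e[%classic) = pullback_measure (`]a, b[%classic `*` `]c, e[%classic).
Proof.
move=> Op; have [d [r [d0 r0 dO H]]] := lax_local oO FC Op (J0 Op).
have [OFp GFp] := FO Op.
have nF : nbhs (F p) (O' `&` G @^-1` open_square p d).
  apply: filterI; first exact: open_nbhs_nbhs.
  have opd : open_square p d p by rewrite /open_square/= subrr normr0.
  by apply: cG; rewrite ?inE// GFp; exact: near_open_square opd.
have /nbhs_ballP[e0 /= e00 He] := nF.
exists (Num.min e0 r); first by rewrite lt_min e00.
have sub y : open_square (F p) (Num.min e0 r) y -> (O' y /\ open_square p d (G y)) /\ open_square (F p) r y.
  rewrite /open_square/= lt_min => /andP[h1 h2]; split => //.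
  by apply: He; rewrite -ball_normE/= distrC.
split; first by move=> y /sub[[]].
move=> a b c e Bsub; set B : set PM := _ `*` _.
have Br : B `<=` open_square (F p) r by move=> y /Bsub /sub[].
have mos : measurable (open_square p d : set PM) by apply: open_measurable_plane; exact: open_norm_lt.
have osO : open_square p d `<=` O by move=> z; exact: dO.
have c1 := @plateau_limit (open_square p d) F (fun z => `|jac F z|) a b c e mos
  (measurable_funS mO osO mF) (measurable_funS mO osO mJ) (fun _ _ => normr_ge0 _).
have c2 := @plateau_limit setT id (fun=> 1) a b c e measurableT
  (@measurable_id _ _ _) (@measurable_cst _ _ _ _ _ _) (fun _ _ => ler01).
have E2 : (\int[lam]_(z in setT `&` id @^-1` B) 1%:E)%E = lam B.
  by rewrite setTI preimage_id integral_cst ?mul1e//; exact: open_box_measurable.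
have E1 : (\int[lam]_(z in open_square p d `&` F @^-1` B) `|jac F z|%:E)%E = pullback_measure B.
  congr (integral _ _ _); apply/seteqP; split => z /= [h1 h2]; split => //; first exact: osO.
  by have := FO h1; move=> [_ <-]; have [[]] := sub _ (Bsub _ h2).
have Eseq : (fun n => \int[lam]_(z in open_square p d) (plateau a b n (F z).1 * plateau c e n (F z).2 * `|jac F z|)%:E)%E =
   (fun n => \int[lam]_z (plateau a b n z.1 * plateau c e n z.2 * 1)%:E)%E; last first.
  rewrite -E2 -E1 -(cvg_lim (@ereal_hausdorff R) c1) -(cvg_lim (@ereal_hausdorff R) c2).
  by rewrite Eseq.
apply/funext => n; have := H a b c e n Br => /= ->.
rewrite -(@affine_integral_plane R (plateau a b n) (plateau c e n) 1 0 0 1 0 0)//.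
- rewrite mulr1 mulr0 subr0 normr1 mul1e; apply: eq_integral => z _.
  by rewrite mulr1 !mul1r !mul0r !addr0 add0r.
- exact: continuous_plateau.
- exact: continuous_plateau.
- by move=> x; exact: plateau_ge0.
- by move=> x; exact: plateau_ge0.
Qed.

Lemma open_squareE (p : P) d : open_square p d =
  `]p.1 - d, p.1 + d[%classic `*` `]p.2 - d, p.2 + d[%classic.
Proof.
apply/seteqP; split => z; rewrite /open_square/= prod_normE/= gt_max !in_itv/= !ltr_norml.
  by move=> /andP[/andP[h1 h2] /andP[h3 h4]]; split; apply/andP; split; lra.
by move=> [/andP[h1 h2] /andP[h3 h4]]; apply/andP; split; apply/andP; split; lra.
Qed.

(** Quantifying over all measurable subsets makes the property hereditary, so that it passes to
    smaller boxes and to the pieces of a disjoint decomposition. *)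
Definition good (B : set PM) := forall A, measurable A -> A `<=` B -> lam A = pullback_measure A.

(** Both measures are restricted to the square. A box meets the square in a box, where they agree by
    the local formula, and uniqueness extends this to all measurable sets. *)
Lemma good_square (p : P) : O p -> exists2 d : R, 0 < d &
  (open_square (F p) d `<=` O') /\ good (open_square (F p) d).
Proof.
move=> Op; have [d d0 [dO dbox]] := cv_box Op; exists d => //; split => //.
set S : set PM := open_square (F p) d.
have mS : measurable S by apply: open_measurable_plane; exact: open_norm_lt.
pose m1 : {measure set PM -> \bar R} := mrestr lam mS.
pose m2 : {measure set PM -> \bar R} := mrestr pm mS.
have E : forall A, measurable A -> m1 A = m2 A.
  apply: plane_measure_unique => [a b c e|k].
    have [a' [b' [c' [e' BE]]]] : open_boxes ((`]a, b[%classic `*` `]c, e[%classic) `&` S).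
      apply: open_boxes_setI; first by exists a, b, c, e.
      by rewrite /S open_squareE; do 4 eexists.
    change (lam ((`]a, b[%classic `*` `]c, e[%classic) `&` S) = pullback_measure ((`]a, b[%classic `*` `]c, e[%classic) `&` S)).
    by rewrite BE; apply: dbox; rewrite -BE; exact: subIsetr.
  apply: (@le_lt_trans _ _ (lam (centered_box k))).
    change (lam (centered_box k `&` S) <= lam (centered_box k))%E.
    apply: le_measure; rewrite ?inE; last exact: subIsetl.
      by apply: measurableI => //; exact: open_box_measurable.
    exact: open_box_measurable.
  rewrite lebesgue_plane_box; [|exact: measurable_itv..].
  by rewrite !lebesgue_measure_itv; case: ifP => _; rewrite ?mule0// -!EFinB -EFinM ltry.
move=> A mA AS; have := E A mA.
by rewrite -[m1 A]/(lam (A `&` S)) -[m2 A]/(pullback_measure (A `&` S)) (setIidl AS).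
Qed.

Let rbox (q : (rat * rat) * (rat * rat)) : set PM :=
  `]ratr q.1.1, ratr q.1.2[%classic `*` `]ratr q.2.1, ratr q.2.2[%classic.

(** An enumeration of the good rational boxes; a code of no box, or of a box that is not good,
    yields the empty set, which is good. *)
Let gbox (n : nat) : set PM :=
  if unpickle n is Some q then (if `[< good (rbox q) >] then rbox q else set0) else set0.

Let gbox_measurable n : measurable (gbox n).
Proof.
by rewrite /gbox; case: unpickle => // q; case: ifP => // _; exact: open_box_measurable.
Qed.

Let gbox_good n : good (gbox n).
Proof.
have g0 : good set0 by move=> A _; rewrite subset0 => ->; rewrite !measure0.
by rewrite /gbox; case: unpickle => // q; case: ifP => // /asboolP.
Qed.

Let gbox_cover : O' `<=` \bigcup_n gbox n.
Proof.
move=> y /GO[OGy FGy]; have [d d0 [_ gS]] := good_square OGy.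
have Sy : open_square (F (G y)) d y by rewrite FGy /open_square/= subrr normr0.
move: Sy; rewrite [X in X y -> _](open_bigcup_boxes (@open_norm_lt R (F (G y)) d)) => -[q qS yq].
exists (pickle q); [exact: I|rewrite /gbox pickleK].
case: ifPn => // /asboolPn; apply: contra_notP => _ A mA Aq.
by apply: gS => //; exact: subset_trans qS.
Qed.

(** Countably many good boxes cover [O']; made disjoint, they cut [A] into pieces on which the two
    measures agree. *)
Theorem change_of_variables_measure (A : set PM) : measurable A -> A `<=` O' ->
  lam A = pullback_measure A.
Proof.
move=> mA AO.
have -> : A = \bigcup_n seqDU (fun n => A `&` gbox n) n.
  rewrite -seqDU_bigcup_eq -setI_bigcupr; apply/esym/setIidl.
  exact: subset_trans gbox_cover.
have mD n : measurable (seqDU (fun n => A `&` gbox n) n).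
  apply: measurableD; first exact: measurableI.
  by apply: bigsetU_measurable => k _; exact: measurableI.
rewrite -[RHS]/(pm _) !measure_bigcup//; try exact: trivIset_seqDU.
apply: eq_eseriesr => n _; apply: (@gbox_good n) => //.
by apply: subset_trans (@subDsetl _ _ _) _; exact: subIsetr.
Qed.

Theorem ge0_change_of_variables (A : set PM) (f : PM -> \bar R) : measurable A -> A `<=` O' ->
  measurable_fun A f -> (forall y, A y -> 0 <= f y)%E ->
  (\int[lam]_(y in A) f y = \int[lam]_(z in O `&` F @^-1` A) (f (F z) * `|jac F z|%:E))%E.
Proof.
move=> mA AO mf f0.
apply: ge0_integral_transfer => //.
- exact: mFA.
- by apply: measurable_funS mF => //; exact: subIsetl.
- by apply: measurable_funS mJ => //; exact: subIsetl.
- by move=> z [].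
move=> B mB BA; rewrite change_of_variables_measure//; last exact: subset_trans AO.
rewrite /pullback_measure; congr (integral _ _ _).
by apply/seteqP; split => z /= [h1 h2]; split => //; [split => //; exact: BA|case: h1].
Qed.

Theorem integral_change_of_variables (A : set PM) (f : PM -> R) : measurable A -> A `<=` O' ->
  measurable_fun A f ->
  (lam.-integrable A (fun y => (f y)%:E) ->
   lam.-integrable (O `&` F @^-1` A) (fun z => (f (F z) * `|jac F z|)%:E)) /\
  (\int[lam]_(y in A) (f y)%:E = \int[lam]_(z in O `&` F @^-1` A) (f (F z) * `|jac F z|)%:E)%E.
Proof.
move=> mA AO mf.
have mFA' := mFA mA.
have mf' : measurable_fun (O `&` F @^-1` A) (fun z : PM => f (F z) * `|jac F z|).
  apply: measurable_funM; last by apply: measurable_funS mJ => //; exact: subIsetl.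
  apply: (measurable_comp mA _ mf); first by move=> _ [z [_ h] <-].
  by apply: measurable_funS mF => //; exact: subIsetl.
split.
  move=> /integrableP[_ fi]; apply/integrableP; split; first exact/measurable_EFinP.
  apply: le_lt_trans fi.
  rewrite [leRHS](ge0_change_of_variables (f := fun y => `|(f y)%:E|%E) mA AO)//; last first.
    by apply: measurableT_comp => //; exact/measurable_EFinP.
  rewrite le_eqVlt; apply/orP; left; apply/eqP; apply: eq_integral => z _.
  by rewrite /= normrM normr_id.
have mfp : measurable_fun A (fun y => (f y)%:E)^\+%E by apply: measurable_funepos; exact/measurable_EFinP.
have mfn : measurable_fun A (fun y => (f y)%:E)^\-%E by apply: measurable_funeneg; exact/measurable_EFinP.
rewrite integralE [RHS]integralE (ge0_change_of_variables mA AO mfp)// (ge0_change_of_variables mA AO mfn)//.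
congr (_ - _)%E; apply: eq_integral => z _.
  by rewrite !funeposE -!EFin_max -EFinM maxr_pMl// mul0r.
by rewrite !funenegE -!EFinN -!EFin_max -EFinM maxr_pMl// mul0r mulNr.
Qed.

End diffeomorphism.
End change_of_variables.

(** * The implicit function theorem *)

Section implicit.
Context {R : realType}.
Local Notation P := (plane R).

Lemma C1_increasing_slice (H : P -> R) (t r : R) :
  (forall s, `|s| < r -> differentiable H (t, s) /\ 0 < dy H (t, s)) ->
  forall s s', `|s| < r -> `|s'| < r -> s < s' -> H (t, s) < H (t, s').
Proof.
move=> Hd s s' sr s'r ss'.
have I (x : R) : x \in `[s, s'] -> `|x| < r.
  rewrite in_itv/= => /andP[x1 x2]; rewrite ltr_norml.
  move: sr s'r; rewrite !ltr_norml => /andP[h1 h2] /andP[h3 h4].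
  by rewrite (lt_le_trans h1)//= (le_lt_trans x2).
have D (x : R) : x \in `[s, s'] -> is_derive x 1 (fun x => H (t, x)) (dy H (t, x)).
  by move=> /I /Hd[d _]; exact: is_derive_slice_y.
apply: (@gtr0_derive1_lt_cc R (fun x => H (t, x)) s s') => //.
- by move=> x /subset_itv_oo_cc /D[].
- by move=> x /subset_itv_oo_cc xI; rewrite derive1E; have [_ ->] := D x xI; have [] := Hd x (I x xI).
- by apply: derivable_within_continuous => x /D[].
- by rewrite in_itv/= lexx ltW.
- by rewrite in_itv/= lexx ltW.
Qed.

Lemma continuous_nbhs_gt (T : topologicalType) (f : T -> R) x c : {for x, continuous f} -> c < f x ->
  \near x, c < f x.
Proof. by move=> cf cx; apply: (cvgr_gt (f x)). Qed.

Lemma continuous_nbhs_lt (T : topologicalType) (f : T -> R) x c : {for x, continuous f} -> f x < c ->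
  \near x, f x < c.
Proof. by move=> cf cx; apply: (cvgr_lt (f x)). Qed.

Lemma is_derive_bound (f : R -> R) (t d : R) :
  (forall e, 0 < e -> \forall h \near (0 : R), `|f (h + t) - f t - d * h| <= e * `|h|) ->
  is_derive t 1 f d.
Proof.
move=> H.
have c : (fun h : R => h^-1 *: (f (h *: 1 + t) - f t)) @ 0^' --> d.
  apply/cvgrPdist_le => e e0.
  have Hd : \forall h \near (0 : R)^', `|f (h + t) - f t - d * h| <= e * `|h|.
    by have := H e e0; apply: filterS => h + _.
  near=> h; have h0 : h != 0 by near: h; exact: nbhs_dnbhs_neq.
  rewrite distrC; have -> : h^-1 *: (f (h *: 1 + t) - f t) - d = h^-1 * (f (h + t) - f t - d * h).
    by rewrite [h%:A]mulr1 /GRing.scale/= [RHS]mulrBr (mulrC d) mulKf.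
  rewrite normrM normfV ler_pdivrMl ?normr_gt0// (mulrC `|h|).
  by near: h.
by split; [apply/cvg_ex; exists d|exact: cvg_lim].
Unshelve. all: by end_near. Qed.

(** Two passes over the same estimate. As w <= b / 2, the term in |k| is absorbed and |k| <= L |h|;
    inserting this back, the error is at most w (1 + L) |h|, hence at most u b |h|. *)
Lemma implicit_slope (a b h k w u L : R) : 0 < b -> 0 <= L -> 0 < w -> w <= b / 2 ->
  w * (1 + L) <= u * b -> L * (b / 2) = `|a| + b / 2 ->
  `|h * a + k * b| <= w * Num.max `|h| `|k| -> `|k - - (a / b) * h| <= u * `|h|.
Proof.
move=> b0 L0 w0 w1 w2 Lb hk.
have hk' : `|h * a + k * b| <= w * (`|h| + `|k|).
  by apply: (le_trans hk); rewrite ler_pM2l// ge_max lerDl lerDr !normr_ge0.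
have kb : `|k| * b <= `|h * a + k * b| + `|h| * `|a|.
  rewrite -{1}(gtr0_norm b0) -!normrM.
  have E : k * b = (h * a + k * b) - h * a by rewrite addrAC subrr add0r.
  by rewrite {1}E; exact: ler_normB.
have wk : w * `|k| <= b / 2 * `|k| by rewrite ler_wpM2r.
have wh : w * `|h| <= b / 2 * `|h| by rewrite ler_wpM2r.
have kL : `|k| <= L * `|h|.
  rewrite -(ler_pM2r (_ : 0 < b / 2)) ?divr_gt0//.
  have -> : L * `|h| * (b / 2) = (`|a| + b / 2) * `|h| by rewrite -Lb; ring.
  by lra.
have E : k - - (a / b) * h = (h * a + k * b) / b by field; rewrite gt_eqF.
rewrite E normrM normfV (gtr0_norm b0) ler_pdivrMr//.
have wkL : w * `|k| <= w * (L * `|h|) by rewrite ler_pM2l.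
have w2h : w * (1 + L) * `|h| <= u * b * `|h| by rewrite ler_wpM2r.
by lra.
Qed.

Section implicit_function.
Variables (O : set P) (H : P -> R).
Hypotheses (oO : open O) (HC : C1 O H) (O0 : O (0, 0)) (H0 : H (0, 0) = 0) (dH0 : 0 < dy H (0, 0)).

Lemma implicit_box : exists e d : R, [/\ 0 < e, 0 < d,
  (forall t s, `|t| < e -> `|s| < 2 * d -> O (t, s) /\ 0 < dy H (t, s)) &
  forall t, `|t| < e -> H (t, - d) < 0 /\ 0 < H (t, d)].
Proof.
have O0' : (0, 0) \in O by rewrite inE.
have n1 : nbhs ((0, 0) : P) [set z | 0 < dy H z] by exact: continuous_nbhs_gt (C1_dy HC O0') dH0.
have n2 : nbhs ((0, 0) : P) O by exact: open_nbhs_nbhs.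
have n12 : nbhs ((0, 0) : P) (O `&` [set z | 0 < dy H z]) by exact: filterI.
move/nbhs_ballP : n12 => [r /= r0 Hr].
have B t s : `|t| < r -> `|s| < r -> O (t, s) /\ 0 < dy H (t, s).
  by move=> tr sr; apply: Hr; split; rewrite -ball_normE/= sub0r normrN.
(* The sign change takes place between heights -d and d, while monotonicity holds up to 2 d; this
   room is later filled by a band of half-height [d] around the graph. *)
pose d := r / 4.
have d0 : 0 < d by rewrite divr_gt0.
have dr : d < r by rewrite /d ltr_pdivrMr// ltr_pMr// ltr1n.
have nd : `|d| < r by rewrite gtr0_norm.
have nNd : `|- d| < r by rewrite normrN gtr0_norm.
have n00 : `|0 : R| < r by rewrite normr0.
have inc t s s' : `|t| < r -> `|s| < r -> `|s'| < r -> s < s' -> H (t, s) < H (t, s').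
  move=> tr; apply: C1_increasing_slice => u ur; have [Otu ->] := B _ _ tr ur.
  by split => //; have [] := HC Otu.
have c s : `|s| < r -> {for 0, continuous (fun t => H (t, s))}.
  move=> sr; apply: continuous_slice_x; apply: (C1_continuous HC); rewrite inE.
  by have [] := B _ _ n00 sr.
have m1 : nbhs (0 : R) [set t | H (t, - d) < 0].
  have h : H (0, - d) < 0 by have := inc 0 (- d) 0 n00 nNd n00; rewrite oppr_lt0 H0; exact.
  exact: (@continuous_nbhs_lt _ (fun t => H (t, - d)) 0 0 (c _ nNd) h).
have m2 : nbhs (0 : R) [set t | 0 < H (t, d)].
  have h : 0 < H (0, d) by have := inc 0 0 d n00 n00 nd d0; rewrite H0.
  exact: (@continuous_nbhs_gt _ (fun t => H (t, d)) 0 0 (c _ nd) h).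
have m12 : nbhs (0 : R) ([set t | H (t, - d) < 0] `&` [set t | 0 < H (t, d)]) by exact: filterI.
move/nbhs_ballP : m12 => [e /= e0 He].
exists (Num.min e r), d; split => //; first by rewrite lt_min e0.
  move=> t s; rewrite lt_min => /andP[_ tr] sd; apply: B => //.
  by rewrite (lt_le_trans sd)// /d; lra.
by move=> t; rewrite lt_min => /andP[te _]; apply: He; rewrite -ball_normE/= sub0r normrN.
Qed.

(** A zero on each vertical exists by the intermediate value theorem and is unique by monotonicity.
    Trapping it between points where [H] has opposite signs gives continuity, and differentiability
    of [H] then gives the slope by [implicit_slope]. *)
Lemma implicit_function : exists (e d : R) (phi dphi : R -> R), [/\ 0 < e, 0 < d, phi 0 = 0,
  (forall t, `|t| < e -> [/\ `|phi t| < d, H (t, phi t) = 0, is_derive t 1 phi (dphi t) &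
     {for t, continuous dphi}]) &
  forall t s, `|t| < e -> `|s| < 2 * d -> O (t, s) /\ (H (t, s) < 0 <-> s < phi t)].
Proof.
have [e [d [e0 d0 B S]]] := implicit_box.
have dd : d < 2 * d by lra.
have inc t s s' : `|t| < e -> `|s| < 2 * d -> `|s'| < 2 * d -> s < s' -> H (t, s) < H (t, s').
  move=> tr; apply: C1_increasing_slice => u ur; have [Otu ->] := B _ _ tr ur.
  by split => //; have [] := HC Otu.
have zero t : exists s, `|t| < e -> `|s| < d /\ H (t, s) = 0.
  have [te|] := boolP (`|t| < e); last by exists 0.
  have [h1 h2] := S t te.
  have [s sI sE] : exists2 s, s \in `[(- d), d] & H (t, s) = 0.
    apply: (@IVT R (fun s => H (t, s)) (- d) d 0); first by lra.
    - apply: continuous_in_subspaceT => s; rewrite inE/= in_itv/= => /andP[s1 s2].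
      apply: continuous_slice_y; apply: (C1_continuous HC); rewrite inE.
      by have [] := B t s te; rewrite ?ltr_norml; [apply/andP; split; lra|].
    - by rewrite ge_min le_max (ltW h1) (ltW h2) orbT.
  exists s => _; split => //; rewrite ltr_norml.
  move: sI; rewrite in_itv/= !le_eqVlt => /andP[/orP[/eqP s1|->]]; first by move: h1; rewrite s1 sE ltxx.
  by move=> /orP[/eqP s2|h]; [exfalso; move: h2; rewrite -s2 sE ltxx|rewrite h].
have [phi phiP] := choice zero.
have phi_lt t s : `|t| < e -> `|s| < 2 * d -> H (t, s) < 0 <-> s < phi t.
  move=> te sd; have [pd pE] := phiP t te; have pd2 := lt_trans pd dd; split => h.
    rewrite ltNge le_eqVlt; apply/negP => /orP[/eqP h'|h']; first by move: h; rewrite -h' pE ltxx.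
    by have := inc _ _ _ te pd2 sd h'; rewrite pE => /(lt_trans h); rewrite ltxx.
  by have := inc _ _ _ te sd pd2 h; rewrite pE.
have phi_gt t s : `|t| < e -> `|s| < 2 * d -> 0 < H (t, s) -> phi t < s.
  move=> te sd h; have [pd pE] := phiP t te; have pd2 := lt_trans pd dd.
  rewrite ltNge le_eqVlt; apply/negP => /orP[/eqP h'|h']; first by move: h; rewrite h' pE ltxx.
  by have := inc _ _ _ te sd pd2 h'; rewrite pE => /(lt_trans h); rewrite ltxx.
have phi0 : phi 0 = 0.
  have z0 : `|0 : R| < e by rewrite normr0.
  have z1 : `|0 : R| < 2 * d by rewrite normr0 mulr_gt0.
  have [pd pE] := phiP 0 z0; have pd2 := lt_trans pd dd.
  have [h|h|//] := ltgtP (phi 0) 0.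
    by have := inc _ _ _ z0 pd2 z1 h; rewrite pE H0 ltxx.
  by have := inc _ _ _ z0 z1 pd2 h; rewrite pE H0 ltxx.
have nte (t : R) : `|t| < e -> \near t, `|t| < e.
  move=> te; apply: continuous_nbhs_lt te; exact: norm_continuous.
have cphi t : `|t| < e -> {for t, continuous phi}.
  move=> te; apply/cvgrPdist_lt => u u0.
  have [pd pE] := phiP t te; have pd2 := lt_trans pd dd.
  (* Small enough for phi t - u' and phi t + u' to stay in the range of heights where [H]
     increases. *)
  pose u' := Num.min (u / 2) ((2 * d - d) / 2).
  have u'0 : 0 < u' by rewrite lt_min; apply/andP; split; lra.
  have u'u : u' < u by rewrite gt_min; apply/orP; left; lra.
  have u'd : u' < d by rewrite gt_min; apply/orP; right; lra.
  have a1 : `|phi t - u'| < 2 * d by move: pd; rewrite !ltr_norml => /andP[? ?]; apply/andP; split; lra.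
  have a2 : `|phi t + u'| < 2 * d by move: pd; rewrite !ltr_norml => /andP[? ?]; apply/andP; split; lra.
  have c s : `|s| < 2 * d -> {for t, continuous (fun t => H (t, s))}.
    move=> sd; apply: continuous_slice_x; apply: (C1_continuous HC); rewrite inE.
    by have [] := B _ _ te sd.
  have l1 : H (t, phi t - u') < 0 by apply/(phi_lt _ _ te a1); lra.
  have l2 : 0 < H (t, phi t + u') by rewrite -pE; apply: inc => //; lra.
  have m1 := continuous_nbhs_lt (c _ a1) l1; have m2 := continuous_nbhs_gt (c _ a2) l2.
  have m3 := nte t te; near=> x; have xe : `|x| < e by near: x.
  have h1 : phi t - u' < phi x by apply/(phi_lt _ _ xe a1); near: x.
  have h2 : phi x < phi t + u' by apply: (phi_gt _ _ xe a2); near: x.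
  rewrite ltr_distlC; apply/andP; split; first by apply: le_lt_trans h1; rewrite lerD2l lerN2 ltW.
  by apply: (lt_trans h2); rewrite ltrD2l.
pose dphi t := - (dx H (t, phi t) / dy H (t, phi t)).
have cp t : `|t| < e -> {for t, continuous (fun t => ((t, phi t) : P))}.
  move=> te; apply: (@continuous_pair R R R id phi t); [exact: cvg_id|exact: cphi].
have Op t : `|t| < e -> O (t, phi t) /\ 0 < dy H (t, phi t).
  by move=> te; apply: B => //; exact: lt_trans (phiP t te).1 dd.
exists e, d, phi, dphi; split; [exact: e0|exact: d0|exact: phi0| |]; last first.
  by move=> t s te sd; split; [exact: (B _ _ te sd).1|exact: phi_lt].
move=> t te; have [pd pE] := phiP t te; have [Ot bt] := Op t te.
have Oi : (t, phi t) \in O by rewrite inE.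
split; [exact: pd|exact: pE| |].
- apply: is_derive_bound => u u0.
  set a := dx H (t, phi t); set b := dy H (t, phi t) in bt.
  pose L := (`|a| + b / 2) / (b / 2).
  have L0 : 0 <= L by rewrite divr_ge0 ?addr_ge0 ?normr_ge0// divr_ge0// ltW.
  pose w := Num.min (b / 2) (u * b / (1 + L)).
  have w0 : 0 < w.
    by rewrite lt_min divr_gt0//= divr_gt0// ?mulr_gt0// ltr_pwDl.
  have w1 : w <= b / 2 by rewrite ge_min lexx.
  have w2 : w * (1 + L) <= u * b.
    by rewrite -ler_pdivlMr ?ltr_pwDl// ge_min lexx orbT.
  have Lb : L * (b / 2) = `|a| + b / 2 by rewrite divfK// gt_eqF// divr_gt0.
  have [HdH _ _] := HC Ot.
  have [v v0 Hv] := differentiable_bound HdH w0.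
  have cz : {for 0, continuous (fun h : R => ((h + t, phi (h + t)) : P))}.
    apply: (@continuous_comp _ _ _ (fun h : R => h + t) (fun t => ((t, phi t) : P))).
      by apply: continuousD; [exact: cvg_id|exact: cvg_cst].
    by rewrite add0r; exact: cp.
  have nv : \forall h \near (0 : R), `|((h + t, phi (h + t)) : P) - (t, phi t)| < v.
    move: (cz) => /cvgrPdist_lt /(_ v v0); rewrite /= !add0r.
    by apply: filterS => h; rewrite distrC.
  have ne : \forall h \near (0 : R), `|h + t| < e.
    have c0 : {for 0, continuous (fun h : R => h + t)}.
      by apply: continuousD; [exact: cvg_id|exact: cvg_cst].
    by apply: (c0 [set x | `|x| < e]); rewrite /= add0r; exact: nte.
  near=> h.
  have hv : `|((h + t, phi (h + t)) : P) - (t, phi t)| < v by near: h.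
  have he : `|h + t| < e by near: h.
  have := Hv _ hv; rewrite pE (phiP _ he).2 !add0r normrN.
  set k := phi (h + t) - phi t.
  have -> : ((h + t, phi (h + t)) : P) - (t, phi t) = (h, k).
    by rewrite /k; congr pair => /=; rewrite addrK.
  rewrite /linear_form/= -/a -/b prod_normE/= => hk.
  exact: (implicit_slope bt L0 w0 w1 w2 Lb hk).
- rewrite /dphi; apply: continuousN; apply: continuousM.
    exact: (@continuous_comp _ _ _ (fun t => ((t, phi t) : P)) (dx H) t (cp _ te) (C1_dx HC Oi)).
  apply: continuousV; first by rewrite gt_eqF.
  exact: (@continuous_comp _ _ _ (fun t => ((t, phi t) : P)) (dy H) t (cp _ te) (C1_dy HC Oi)).
Unshelve. all: by end_near. Qed.

End implicit_function.
End implicit.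

(** * Change of variables on the line *)

Section line.
Context {R : realType}.
Local Notation P := (plane R).
Local Notation PM := (measurableTypeR R * measurableTypeR R)%type.
Local Notation mu := (@lebesgue_measure R).
Local Notation lam := (lebesgue_plane R).

Lemma ge0_integral_fst (A B : set R) (f : R -> \bar R) : measurable A -> measurable B ->
  measurable_fun A f -> (forall x, A x -> 0 <= f x)%E ->
  (\int[lam]_(z in A `*` B) f z.1 = \int[mu]_(x in A) f x * mu B)%E.
Proof.
move=> mA mB mf f0; have mAB : measurable (A `*` B : set PM) by exact: measurableX.
have mg : measurable_fun (A `*` B) (fun z : PM => f z.1).
  apply: (measurable_comp mA) => //; last exact: measurable_funTS measurable_fst.
  by move=> _ [z [h _] <-].
rewrite integral_mkcond fubini_tonelli1; last 2 first.
- exact/(measurable_restrictT _ mAB).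
- by apply: erestrict_ge0 => z [h _]; exact: f0.
rewrite -ge0_integralZr//.
rewrite [RHS]integral_mkcond; apply: eq_integral => x _.
rewrite /fubini_F patchE; have [xA|xA] := ifPn.
  rewrite -integral_cst//; rewrite [RHS]integral_mkcond; apply: eq_integral => y _.
  by rewrite !patchE in_setX/= xA.
by apply: integral0_eq => y _; rewrite patchE in_setX/= (negbTE xA).
Qed.

(** The plane formula applied to (x, y) |-> (tau x, y) on a product with the interval ]0, 1[, whose
    measure is 1. *)
Theorem change_of_variables_line (I J A : set R) (tau dtau sigma f : R -> R) :
  open I -> open J ->
  (forall t, I t -> [/\ is_derive t 1 tau (dtau t), {for t, continuous dtau} & dtau t != 0]) ->
  {in J, continuous sigma} ->
  (forall t, I t -> J (tau t) /\ sigma (tau t) = t) ->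
  (forall t, J t -> I (sigma t) /\ tau (sigma t) = t) ->
  measurable A -> A `<=` J -> measurable_fun A f -> (forall y, A y -> 0 <= f y) ->
  (\int[mu]_(y in A) (f y)%:E = \int[mu]_(t in I `&` tau @^-1` A) (f (tau t) * `|dtau t|)%:E)%E.
Proof.
move=> oI oJ dt cs IJ JI mA AJ mf f0.
have oX (K : set R) : open K -> open ([set z | K z.1] : set P).
  by move=> oK; apply: (@open_comp _ _ fst K) => // z _; exact: cvg_fst.
pose F (z : P) : P := (tau z.1, z.2); pose G (z : P) : P := (sigma z.1, z.2).
pose O := [set z : P | I z.1]; pose O' := [set z : P | J z.1].
have cf (K : set R) (h : R -> R) : (forall t, K t -> {for t, continuous h}) ->
    {in [set z : P | K z.1], continuous (fun z : P => h z.1)}.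
  move=> ch z; rewrite inE/= => Kz; apply: (@continuous_comp _ _ _ fst h); first exact: cvg_fst.
  exact: ch.
have dF (z : P) : O z -> is_diff z (fst \o F) (linear_form (dtau z.1) 0).
  move=> Oz; have [dz _ _] := dt _ Oz.
  have := @is_diff_outer R tau fst z (dtau z.1) 1 0 dz (is_diff_fst z).
  by rewrite mulr1 mulr0.
have FC : C1map O F.
  split; last exact: (C1_snd (oX _ oI)).
  apply: (C1_is_diff (oX _ oI) dF); last by move=> z _; exact: cvg_cst.
  by apply: cf => t It; have [] := dt t It.
have jE z : O z -> jac F z = dtau z.1.
  move=> Oz; have h1 := dF z Oz; have h2 : is_diff z (snd \o F) (linear_form 0 1) := is_diff_snd z.
  by rewrite /jac /br (is_diff_dx h1) (is_diff_dy h1) (is_diff_dx h2) (is_diff_dy h2) mulr1 mul0r subr0.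
have J0 z : O z -> jac F z != 0 by move=> Oz; rewrite jE//; have [] := dt _ Oz.
have cG : {in O', continuous G}.
  move=> z Oz; apply: (@continuous_pair P R R (fun z => sigma z.1) snd z); last exact: cvg_snd.
  by apply: (cf J sigma) Oz => t Jt; apply: cs; rewrite inE.
have FO z : O z -> O' (F z) /\ G (F z) = z.
  by case: z => x y Oz; have [h1 h2] := IJ x Oz; split; [exact: h1|rewrite /F /G/= h2].
have GO z : O' z -> O (G z) /\ F (G z) = z.
  by case: z => x y Oz; have [h1 h2] := JI x Oz; split; [exact: h1|rewrite /F /G/= h2].
pose B : set R := `]0, 1[%classic.
have mB : measurable B by exact: measurable_itv.
have muB : mu B = 1%E by rewrite lebesgue_measure_itv/= lte01 oppr0 adde0.
have mI : measurable (I : set (measurableTypeR R)) by exact: open_measurable.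
have mtau : measurable_fun (I : set (measurableTypeR R)) (tau : measurableTypeR R -> measurableTypeR R).
  apply: open_continuous_measurable_fun => // t; rewrite inE => It.
  by apply/differentiable_continuous/derivable1_diffP; have [[]] := dt t It.
have mdtau : measurable_fun (I : set (measurableTypeR R)) (dtau : measurableTypeR R -> measurableTypeR R).
  by apply: open_continuous_measurable_fun => // t; rewrite inE => It; have [] := dt t It.
have mIA : measurable (I `&` tau @^-1` A : set (measurableTypeR R)) by exact: mtau.
have mg : measurable_fun (I `&` tau @^-1` A) (fun t : measurableTypeR R => (f (tau t) * `|dtau t|)%:E).
  apply/measurable_EFinP; apply: measurable_funM.
    apply: (measurable_comp mA (_ : tau @` _ `<=` A) mf); first by move=> _ [t [_ h] <-].
    exact: measurable_funS mtau.
  by apply: measurableT_comp => //; exact: measurable_funS mdtau.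
rewrite -[LHS]mule1 -[RHS]mule1 -muB.
rewrite -(ge0_integral_fst (f := EFin \o f) mA mB); last 2 first.
- exact/measurable_EFinP.
- by move=> x /f0; rewrite lee_fin.
rewrite -(ge0_integral_fst mIA mB mg); last by move=> x [_ /f0 h]; rewrite lee_fin mulr_ge0.
rewrite (ge0_change_of_variables (oX _ oI) (oX _ oJ) FC J0 cG FO GO (A := A `*` B)); last first.
- by move=> z [/f0 h _]; rewrite lee_fin.
- apply: (measurable_comp mA) => //; last exact: measurable_funTS measurable_fst.
    by move=> _ [z [h _] <-].
  exact/measurable_EFinP.
- by move=> z [/AJ h _].
- exact: measurableX.
have -> : O `&` F @^-1` (A `*` B) = (I `&` tau @^-1` A) `*` B.
  by apply/seteqP; split => [z [h1 [h2 h3]]|z [[h1 h2] h3]].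
by apply: eq_integral => z; rewrite inE => -[[Iz _] _]; rewrite jE.
Qed.

End line.

(** * Components of maps of class [Ck 1] *)

Section planar.
Context {R : realType}.
Local Notation P := (plane R).

Lemma derive_linear (U W : normedModType R) (l : {linear U -> W}) (F : P -> U) z v :
  continuous l -> derivable F z v -> derivable (l \o F) z v /\ 'D_v (l \o F) z = l ('D_v F z).
Proof.
move=> lc dF; have E : (fun h : R => h^-1 *: ((l \o F) (h *: v + z) - (l \o F) z)) =
    l \o (fun h : R => h^-1 *: (F (h *: v + z) - F z)).
  by apply/funext => h /=; rewrite linearZ (raddfB l).
have c : (fun h : R => h^-1 *: ((l \o F) (h *: v + z) - (l \o F) z)) @ 0^' --> l ('D_v F z).
  by rewrite E; apply: (@cvg_comp _ _ _ _ l _ _ _ dF); exact: lc.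
by split; [apply/cvg_ex; exists (l ('D_v F z))|exact: cvg_lim].
Qed.

Lemma Ck1_linear (U : normedModType R) (l : {linear U -> R}) (O : set P) (F : P -> U) : open O ->
  continuous l -> Ck 1 O F -> Ck 1 O (l \o F).
Proof.
move=> oO lc [cF dF].
have cl (G : P -> U) : {in O, continuous G} -> {in O, continuous (l \o G)}.
  by move=> cG z Oz; apply: (@continuous_comp _ _ _ G l) => //; [exact: cG|exact: lc].
split; first exact: cl.
move=> v; have [d1 d2] := dF v.
split; first by move=> z Oz; exact: (derive_linear lc (d1 z Oz)).1.
move=> z Oz; have zO : O z by rewrite inE in Oz.
apply: (for_continuous_eq oO zO _ (cl _ d2 z Oz)) => y Oy.
by rewrite (derive_linear lc (d1 y Oy)).2.
Qed.

Lemma Ck1_C1map (O : set P) (F : P -> P) : open O -> Ck 1 O F ->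
  C1map O F /\ forall z, O z -> jac F z = jacobian_det F z.
Proof.
move=> oO FC.
have c1 : continuous (fst : P -> R) by move=> z; exact: cvg_fst.
have c2 : continuous (snd : P -> R) by move=> z; exact: cvg_snd.
split; first by split; apply: (Ck1_C1 oO); exact: Ck1_linear.
move=> z Oz; have [_ dF] := FC.
have d v := (dF v).1 z Oz.
rewrite /jac /br /jacobian_det -!dxE -!dyE.
have e1 v := (@derive_linear _ _ (fst : {linear P -> R}) F z v c1 (d v)).2.
have e2 v := (@derive_linear _ _ (snd : {linear P -> R}) F z v c2 (d v)).2.
by rewrite !e1 !e2 [X in _ - X]mulrC.
Qed.

End planar.

(** * Functions and patches on a surface *)

Section surface.
Context {R : realType} {M : oriented_surface R}.
Local Notation P := (plane R).
Implicit Types (i j : chart_index M).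

Definition trans_dom i j : set P := chart i @` (dom i `&` dom j).
Definition transition i j : P -> P := chart j \o param i.

Lemma param_dom i x : chart_codom i x -> dom i (param i x) /\ chart i (param i x) = x.
Proof. by move=> [p pi <-]; rewrite chartK. Qed.

Lemma chart_codomP i p : dom i p -> chart_codom i (chart i p).
Proof. by move=> pi; exists p. Qed.

Lemma chart_codom_open i : open (chart_codom i). Proof. exact: codom_open. Qed.

Lemma param_cont i : {in chart_codom i, continuous (param i)}.
Proof. exact: param_continuous. Qed.

Lemma trans_domP i j x : trans_dom i j x <-> chart_codom i x /\ dom j (param i x).
Proof.
split=> [[p [pi pj] <-]|[xi xj]]; first by rewrite chartK//; split => //; exact: chart_codomP.
by have [h1 h2] := param_dom xi; exists (param i x).
Qed.

Lemma trans_domE i j : trans_dom i j = chart_codom i `&` param i @^-1` dom j.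
Proof. by apply/seteqP; split => x /trans_domP. Qed.

Lemma trans_dom_open i j : open (trans_dom i j).
Proof.
rewrite trans_domE; apply: open_preimage_in; first exact: chart_codom_open.
  exact: param_cont.
exact: dom_open.
Qed.

Lemma transitionP i j x : trans_dom i j x ->
  [/\ trans_dom j i (transition i j x), param j (transition i j x) = param i x &
      transition j i (transition i j x) = x].
Proof.
move=> /trans_domP[xi xj]; have [h1 h2] := param_dom xi.
have E : param j (transition i j x) = param i x by rewrite /transition/= chartK.
split => //; last by rewrite {1}/transition/= E.
by apply/trans_domP; split; [exact: chart_codomP|rewrite E].
Qed.

Lemma transition_C1map i j : C1map (trans_dom i j) (transition i j).
Proof. exact: (Ck1_C1map (@trans_dom_open i j) (transition_smooth i j 1)).1. Qed.

Lemma transition_jac i j x : trans_dom i j x -> 0 < jac (transition i j) x.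
Proof.
move=> xij; rewrite (Ck1_C1map (@trans_dom_open i j) (transition_smooth i j 1)).2//.
exact: transition_oriented.
Qed.

Definition C1S (f : M -> R) := forall i, C1 (chart_codom i) (f \o param i).

Lemma diffC1 (O : set P) (f : P -> R) z : C1 O f -> O z -> differentiable f z.
Proof. by move=> fC /fC[]. Qed.

Lemma near_transition i j x (f : M -> R) : trans_dom i j x ->
  \near x, (f \o param i) x = ((f \o param j) \o transition i j) x.
Proof.
move=> xij; apply: filterS (open_nbhs_nbhs (conj (@trans_dom_open i j) xij)) => y.
by move=> /transitionP[_ E _]; rewrite /comp -/(transition i j y) E.
Qed.

Lemma br_transition (f g : M -> R) i j x : trans_dom i j x ->
  differentiable (f \o param j) (transition i j x) -> differentiable (g \o param j) (transition i j x) ->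
  br (f \o param i) (g \o param i) x =
  br (f \o param j) (g \o param j) (transition i j x) * jac (transition i j) x.
Proof.
move=> xij df dg; have [F1 F2] := @transition_C1map i j.
rewrite (near_br (near_transition f xij) (near_transition g xij)).
by rewrite br_comp//; [exact: diffC1 F1 xij|exact: diffC1 F2 xij].
Qed.

Lemma C1S_M f g : C1S f -> C1S g -> C1S (fun p => f p * g p).
Proof. by move=> fC gC i; exact: C1M (@chart_codom_open i) (fC i) (gC i). Qed.

End surface.

(** * Coordinates that straighten a graph *)

Section sheared_box.
Context {R : realType}.
Local Notation P := (plane R).

Variables (x w v : P) (eps e d : R) (phi dphi : R -> R).
Hypotheses (e0 : 0 < e) (d0 : 0 < d).
Hypothesis epsE : w.1 * v.2 - w.2 * v.1 = eps.
Hypothesis eps2 : eps * eps = 1.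
Hypothesis phiP : forall t, `|t| < e -> [/\ `|phi t| < d, is_derive t 1 phi (dphi t) & {for t, continuous dphi}].

Definition unit_square : set P := open_square 0 1.

Lemma unit_squareE (z : P) : unit_square z <-> `|z.1| < 1 /\ `|z.2| < 1.
Proof.
rewrite /unit_square /open_square/= subr0 prod_normE/= gt_max.
by split => [/andP[]//|[-> ->]].
Qed.

Lemma open_unit_square : open unit_square. Proof. exact: open_norm_lt. Qed.

(** Affine coordinates with origin [x] and axes [w], [v]. Their determinant [eps] is its own
    inverse, so that it appears in [coframe] where Cramer's rule would divide by it. *)
Definition frame (u : P) : P :=
  (x.1 + (u.1 * w.1 + u.2 * v.1), x.2 + (u.1 * w.2 + u.2 * v.2)).
Definition coframe (y : P) : P :=
  (eps * (v.2 * (y.1 - x.1) - v.1 * (y.2 - x.2)), eps * (w.1 * (y.2 - x.2) - w.2 * (y.1 - x.1))).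
(** Sends the unit square onto the band of half-height [d] around the graph of [phi], with the lower
    half of the square below the graph. *)
Definition shear (z : P) : P := (e * z.1, phi (e * z.1) + d * z.2).
Definition unshear (u : P) : P := (e^-1 * u.1, d^-1 * (u.2 - phi u.1)).

Lemma frameK u : coframe (frame u) = u.
Proof.
case: u => t s; rewrite /coframe /frame/=; congr pair.
  transitivity (eps * (w.1 * v.2 - w.2 * v.1) * t); first by ring.
  by rewrite epsE eps2 mul1r.
transitivity (eps * (w.1 * v.2 - w.2 * v.1) * s); first by ring.
by rewrite epsE eps2 mul1r.
Qed.

Lemma coframeK y : frame (coframe y) = y.
Proof.
case: y => y1 y2; rewrite /coframe /frame/=; congr pair.
  transitivity (x.1 + eps * (w.1 * v.2 - w.2 * v.1) * (y1 - x.1)); first by ring.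
  by rewrite epsE eps2 mul1r addrC subrK.
transitivity (x.2 + eps * (w.1 * v.2 - w.2 * v.1) * (y2 - x.2)); first by ring.
by rewrite epsE eps2 mul1r addrC subrK.
Qed.

Definition strip : set P := [set u : P | `|u.1| < e].

Lemma open_strip : open strip.
Proof.
have -> : strip = fst @^-1` ball (0 : R) e.
  by apply/seteqP; split => u; rewrite /strip /= -ball_normE/= sub0r normrN.
by apply: open_comp; [move=> z _; exact: cvg_fst|exact: ball_open].
Qed.

Lemma phi_C1_strip (f : P -> R) (O : set P) : open O -> C1 O f -> (forall z, O z -> `|f z| < e) ->
  C1 O (phi \o f).
Proof.
move=> oO fC fe; apply: (C1_outer (dh := dphi) oO fC) => z Oz.
by have [_ h1 h2] := phiP (fe _ Oz).
Qed.

Lemma scale_lt (a t : R) : 0 < a -> (`|a * t| < a) = (`|t| < 1).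
Proof. by move=> a0; rewrite normrM gtr0_norm// -[X in _ < X]mulr1 ltr_pM2l. Qed.

Lemma frame_is_diff (z : P) :
  is_diff z (fst \o frame) (linear_form w.1 v.1) /\ is_diff z (snd \o frame) (linear_form w.2 v.2).
Proof.
have h (c a b : R) : is_diff z (fun u : P => c + linear_form a b u) (linear_form a b).
  have := is_diffD (is_diff_cst c z) (is_diff_linear_form z a b) => h.
  by apply: is_diff_eq h _; apply/funext => u /=; rewrite /GRing.add/= /cst add0r.
have E1 : fst \o frame = (fun u : P => x.1 + linear_form w.1 v.1 u) by [].
have E2 : snd \o frame = (fun u : P => x.2 + linear_form w.2 v.2 u) by [].
by rewrite E1 E2.
Qed.

Lemma frame_C1map (O : set P) : open O -> C1map O frame.
Proof.
move=> oO; split; apply: (C1_is_diff oO).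
- by move=> z _; exact: (frame_is_diff z).1.
- by move=> z _; exact: cvg_cst.
- by move=> z _; exact: cvg_cst.
- by move=> z _; exact: (frame_is_diff z).2.
- by move=> z _; exact: cvg_cst.
- by move=> z _; exact: cvg_cst.
Qed.

Lemma jac_frame z : jac frame z = eps.
Proof.
have [h1 h2] := frame_is_diff z.
by rewrite /jac /br (is_diff_dx h1) (is_diff_dy h1) (is_diff_dx h2) (is_diff_dy h2) -epsE; ring.
Qed.

Lemma coframe_C1map (O : set P) : open O -> C1map O coframe.
Proof.
move=> oO; have c (k : R) := C1_cst k oO.
have f1 := C1B oO (C1_fst oO) (c x.1); have f2 := C1B oO (C1_snd oO) (c x.2).
split.
  exact: (C1M oO (c eps) (C1B oO (C1M oO (c v.2) f1) (C1M oO (c v.1) f2))).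
exact: (C1M oO (c eps) (C1B oO (C1M oO (c w.1) f2) (C1M oO (c w.2) f1))).
Qed.

Lemma shear_strip z : unit_square z -> `|e * z.1| < e.
Proof. by move=> /unit_squareE[h _]; rewrite scale_lt. Qed.

Lemma shear_C1map : C1map unit_square shear.
Proof.
have oO := open_unit_square; have c (k : R) := C1_cst k oO.
have f1 := C1M oO (c e) (C1_fst oO).
split; first exact: f1.
exact: (C1D oO (phi_C1_strip oO f1 shear_strip) (C1M oO (c d) (C1_snd oO))).
Qed.

Lemma jac_shear z : unit_square z -> jac shear z = e * d.
Proof.
move=> Qz; have i1 := is_diff_fst z; have i2 := is_diff_snd z.
have h1 : is_diff z (fst \o shear) (linear_form e 0).
  have -> : fst \o shear = linear_form e 0 by apply/funext => u; rewrite /linear_form/=; ring.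
  exact: is_diff_linear_form.
have [_ dp _] := phiP (shear_strip Qz).
have h2 : is_diff z (snd \o shear) (linear_form (dphi (e * z.1) * e) d).
  have ho := @is_diff_outer R phi (fst \o shear) z _ _ _ dp h1.
  have hl : is_diff z (linear_form 0 d) (linear_form 0 d) by exact: is_diff_linear_form.
  have := is_diffD ho hl => h3.
  have E : snd \o shear = (phi \o (fst \o shear)) \+ linear_form 0 d.
    by apply/funext => u; rewrite /shear/= /linear_form; ring.
  rewrite E; apply: is_diff_eq h3 _; apply/funext => u /=; rewrite /GRing.add/= /linear_form; ring.
by rewrite /jac /br (is_diff_dx h1) (is_diff_dy h1) (is_diff_dx h2) (is_diff_dy h2); ring.
Qed.

Lemma unshear_C1map : C1map strip unshear.
Proof.
have oO := open_strip; have c (k : R) := C1_cst k oO.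
split; first exact: (C1M oO (c e^-1) (C1_fst oO)).
have fC := phi_C1_strip oO (C1_fst oO) (fun z => id).
exact: (C1M oO (c d^-1) (C1B oO (C1_snd oO) fC)).
Qed.

Lemma shearK z : unshear (shear z) = z.
Proof. by case: z => t s; rewrite /unshear /shear/= (addrC (phi _)) addrK !mulKf// gt_eqF. Qed.

Lemma unshearK u : shear (unshear u) = u.
Proof. by case: u => t s; rewrite /unshear /shear/= !mulVKf ?gt_eqF// addrC subrK. Qed.

(** The image of the unit square, written as a preimage under the inverse map so that continuity
    gives its openness. The [strip] condition confines [unshear] to the region where [phi] is known
    to be of class C1. *)
Definition box_image : set P := [set y | strip (coframe y)] `&` (unshear \o coframe) @^-1` unit_square.

Lemma open_box_image : open box_image.
Proof.
have cC := C1map_continuous (coframe_C1map openT).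
have o1 : open [set y | strip (coframe y)].
  by apply: (@open_comp _ _ coframe strip) => [y _|]; [apply: cC; rewrite inE|exact: open_strip].
apply: open_preimage_in; [exact: o1| |exact: open_unit_square].
move=> y; rewrite inE => ys; apply: (@continuous_comp _ _ _ coframe unshear); first by apply: cC; rewrite inE.
by apply: (C1map_continuous unshear_C1map); rewrite inE.
Qed.

Lemma box_image_in z : unit_square z -> box_image (frame (shear z)) /\ unshear (coframe (frame (shear z))) = z.
Proof.
by move=> Qz; rewrite /box_image/= frameK shearK; split => //; split => //; exact: shear_strip.
Qed.

Lemma box_image_out y : box_image y -> unit_square (unshear (coframe y)) /\ frame (shear (unshear (coframe y))) = y.
Proof. by move=> [_ h]; split => //; rewrite unshearK coframeK. Qed.

Lemma box_image_box y : box_image y -> exists t s : R, [/\ `|t| < e, `|s| < 2 * d & y = frame (t, s)].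
Proof.
move=> [h1]; rewrite /= => /unit_squareE[_ /= h2]; exists (coframe y).1, (coframe y).2.
have [pd _ _] := phiP h1.
split=> //; last by rewrite -surjective_pairing coframeK.
have : `|(coframe y).2 - phi (coframe y).1| < d.
  by move: h2; rewrite normrM normfV (gtr0_norm d0) ltr_pdivrMl// mulr1.
by move: pd; rewrite !ltr_norml => /andP[? ?] /andP[? ?]; apply/andP; split; lra.
Qed.

Lemma box_map_C1map : C1map unit_square (frame \o shear).
Proof. exact: (C1map_comp open_unit_square shear_C1map (frame_C1map openT)). Qed.

Lemma jac_box_map z : unit_square z -> jac (frame \o shear) z = eps * (e * d).
Proof.
move=> Qz; have [s1 s2] := shear_C1map; have [f1 f2] := frame_C1map openT.
by rewrite (jac_comp (diffC1 s1 Qz) (diffC1 s2 Qz) (diffC1 f1 I) (diffC1 f2 I)) jac_frame jac_shear.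
Qed.

Lemma box_inv_C1map : C1map box_image (unshear \o coframe).
Proof.
have [c1 c2] := coframe_C1map openT.
apply: (C1map_comp open_box_image _ unshear_C1map); last by move=> y [].
by split; [exact: C1_sub c1|exact: C1_sub c2].
Qed.

End sheared_box.

(** * Square patches on the surface *)

Section patches.
Context {R : realType} {M : oriented_surface R}.
Local Notation P := (plane R).
Local Notation Q := (@unit_square R).
Implicit Types (i j : chart_index M).

(** A C1 parametrization by the unit square, inside one chart. The orientation may be reversed, with
    constant sign [psign]: along the boundary, the square is placed so that U fills its lower half,
    which can be incompatible with the orientation. *)
Record surface_patch := SurfacePatch {
  pchart : chart_index M;
  patch_map : P -> P;
  pinv : P -> P;
  pimage : set P;
  psign : R;
  pimage_open : open pimage;
  pimage_codom : pimage `<=` chart_codom pchart;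
  patch_map_C1 : C1map Q patch_map;
  pinv_C1 : C1map pimage pinv;
  patch_mapP : forall z, Q z -> pimage (patch_map z) /\ pinv (patch_map z) = z;
  pinvP : forall y, pimage y -> Q (pinv y) /\ patch_map (pinv y) = y;
  psign2 : psign * psign = 1;
  psign_jac : forall z, Q z -> 0 < psign * jac patch_map z
}.

Implicit Types a : surface_patch.
(** The parametrization of the patch and, next, its inverse coordinates [xi], meaningful on
    [pdom]. *)
Definition psi a z := param (pchart a) (patch_map a z).
Definition xi a p := pinv a (chart (pchart a) p).
Definition pdom a : set M := [set p | dom (pchart a) p /\ pimage a (chart (pchart a) p)].

Lemma psiP a z : Q z -> pdom a (psi a z) /\ xi a (psi a z) = z.
Proof.
move=> Qz; have [h1 h2] := patch_mapP a Qz; have [h3 h4] := param_dom (pimage_codom h1).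
by rewrite /pdom /xi /psi/= h4.
Qed.

Lemma xiP a p : pdom a p -> Q (xi a p) /\ psi a (xi a p) = p.
Proof. by move=> [h1 /pinvP[h2 h3]]; rewrite /psi /xi h3 chartK. Qed.

Lemma pdom_open a : open (pdom a).
Proof.
apply: (open_preimage_in (dom_open _) _ (@pimage_open a)); exact: chart_continuous.
Qed.

Lemma psi_continuous a : {in Q, continuous (psi a)}.
Proof.
move=> z Qz; have Qz' : Q z by rewrite inE in Qz.
apply: (@continuous_comp _ _ _ (patch_map a) (param (pchart a))).
  exact: (C1map_continuous (@patch_map_C1 a)).
by apply: param_cont; rewrite inE; apply: pimage_codom; have [] := patch_mapP a Qz'.
Qed.

Lemma psi_C1 a (f : M -> R) : C1S f -> C1 Q (f \o psi a).
Proof.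
move=> fC; apply: (C1_comp (@open_unit_square R) (@patch_map_C1 a) (fC (pchart a))) => z Qz.
by apply: pimage_codom; have [] := patch_mapP a Qz.
Qed.

(** Source and target of the change of coordinates [ptrans] from the patch to the chart [j], with
    inverse [pback]; it plays the part of [transition] between charts. *)
Definition pzone a j : set P := Q `&` psi a @^-1` dom j.
Definition pcod a j : set P := chart_codom j `&` param j @^-1` pdom a.
Definition ptrans a j : P -> P := chart j \o psi a.
Definition pback a j : P -> P := xi a \o param j.

Lemma pzone_open a j : open (pzone a j).
Proof.
by apply: (open_preimage_in (@open_unit_square R) _ (dom_open j)); exact: psi_continuous.
Qed.

Lemma pcod_open a j : open (pcod a j).
Proof.
by apply: (open_preimage_in (@chart_codom_open _ _ j) _ (@pdom_open a)); exact: param_cont.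
Qed.

Lemma pzone_trans_dom a j z : pzone a j z -> trans_dom (pchart a) j (patch_map a z).
Proof.
move=> [Qz zj]; apply/trans_domP; split=> //.
by apply: pimage_codom; have [] := patch_mapP a Qz.
Qed.

Lemma ptrans_C1 a j : C1map (pzone a j) (ptrans a j).
Proof.
have [m1 m2] := @patch_map_C1 a.
have mC : C1map (pzone a j) (patch_map a) by split; [apply: C1_sub m1 => z []|apply: C1_sub m2 => z []].
exact: (C1map_comp (@pzone_open a j) mC (@transition_C1map _ _ (pchart a) j) (@pzone_trans_dom a j)).
Qed.

Lemma ptrans_jac a j z : pzone a j z -> 0 < psign a * jac (ptrans a j) z.
Proof.
move=> zj; have zt := pzone_trans_dom zj; have [Qz _] := zj.
have [m1 m2] := @patch_map_C1 a; have [t1 t2] := @transition_C1map _ _ (pchart a) j.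
have -> : ptrans a j = transition (pchart a) j \o patch_map a by [].
rewrite (jac_comp (diffC1 m1 Qz) (diffC1 m2 Qz) (diffC1 t1 zt) (diffC1 t2 zt)).
by rewrite mulrCA mulr_gt0 ?transition_jac ?psign_jac.
Qed.

Lemma ptransP a j z : pzone a j z -> pcod a j (ptrans a j z) /\ pback a j (ptrans a j z) = z.
Proof.
move=> [Qz zj]; have [h1 h2] := psiP a Qz; have E : param j (ptrans a j z) = psi a z by exact: chartK.
rewrite /pcod /pback /= E; split => //; split => //; exact: chart_codomP.
Qed.

Lemma pbackP a j y : pcod a j y -> pzone a j (pback a j y) /\ ptrans a j (pback a j y) = y.
Proof.
move=> [yj ya]; have [h1 h2] := xiP ya; have [h3 h4] := param_dom yj.
by rewrite /pzone /ptrans /pback /= h2.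
Qed.

Lemma xi_continuous a : {in pdom a, continuous (xi a)}.
Proof.
move=> p; rewrite inE => -[h1 h2].
apply: (@continuous_comp _ _ _ (chart (pchart a)) (pinv a)); first by apply: chart_continuous; rewrite inE.
by apply: (C1map_continuous (@pinv_C1 a)); rewrite inE.
Qed.

Lemma pback_continuous a j : {in pcod a j, continuous (pback a j)}.
Proof.
move=> y; rewrite inE => -[h1 h2].
apply: (@continuous_comp _ _ _ (param j) (xi a)); first by apply: param_cont; rewrite inE.
by apply: xi_continuous; rewrite inE.
Qed.

Lemma psi_near a j z (f : M -> R) : pzone a j z ->
  \near z, (f \o psi a) z = ((f \o param j) \o ptrans a j) z.
Proof.
move=> zj; apply: filterS (open_nbhs_nbhs (conj (@pzone_open a j) zj)) => y [Qy yj].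
by rewrite /ptrans /= chartK.
Qed.

Lemma br_psi (f h : M -> R) a j z : pzone a j z ->
  differentiable (f \o param j) (ptrans a j z) -> differentiable (h \o param j) (ptrans a j z) ->
  br (f \o psi a) (h \o psi a) z =
  br (f \o param j) (h \o param j) (ptrans a j z) * jac (ptrans a j) z.
Proof.
move=> zj df dh; have [F1 F2] := @ptrans_C1 a j.
rewrite (near_br (psi_near f zj) (psi_near h zj)).
by rewrite br_comp//; [exact: diffC1 F1 zj|exact: diffC1 F2 zj].
Qed.

Lemma box_patch i (x w v : P) (eps e d : R) (phi dphi : R -> R) :
  0 < e -> 0 < d -> w.1 * v.2 - w.2 * v.1 = eps -> eps * eps = 1 ->
  (forall t, `|t| < e -> [/\ `|phi t| < d, is_derive t 1 phi (dphi t) & {for t, continuous dphi}]) ->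
  (forall t s, `|t| < e -> `|s| < 2 * d -> chart_codom i (frame x w v (t, s))) ->
  exists a : surface_patch, pchart a = i /\ patch_map a = frame x w v \o shear e d phi.
Proof.
move=> e0 d0 epsE eps2 phiP box.
have sub : box_image x w v eps e d phi `<=` chart_codom i.
  by move=> y /(box_image_box d0 epsE eps2 phiP)[t [s [te sd ->]]]; exact: box.
have jac0 z : Q z -> 0 < eps * jac (frame x w v \o shear e d phi) z.
  by move=> Qz; rewrite (jac_box_map x e0 epsE phiP Qz) mulrA eps2 mul1r mulr_gt0.
have oI : open (box_image x w v eps e d phi) by apply: open_box_image; eassumption.
have mC : C1map Q (frame x w v \o shear e d phi) by apply: box_map_C1map; eassumption.
have iC : C1map (box_image x w v eps e d phi) (unshear e d phi \o coframe x w v eps).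
  by apply: box_inv_C1map; eassumption.
have mI z : Q z -> box_image x w v eps e d phi ((frame x w v \o shear e d phi) z) /\
  (unshear e d phi \o coframe x w v eps) ((frame x w v \o shear e d phi) z) = z by apply: box_image_in; eassumption.
have iI y : box_image x w v eps e d phi y -> Q ((unshear e d phi \o coframe x w v eps) y) /\
  (frame x w v \o shear e d phi) ((unshear e d phi \o coframe x w v eps) y) = y by apply: box_image_out; eassumption.
by exists (SurfacePatch oI sub mC iC mI iI eps2 jac0).
Qed.

Definition one_sided (U : set M) a := (forall z, Q z -> U (psi a z)) \/ (forall z, Q z -> ~ U (psi a z)).
Definition two_sided (U : set M) a := forall z, Q z -> (U (psi a z) <-> z.2 < 0).

Lemma unit_square0 : Q 0.
Proof. by apply/unit_squareE; rewrite /= normr0. Qed.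

(** A straight box, [phi] being zero, inside a ball on which the chart stays in [W]. *)
Lemma patch_in_open (W : set M) p : open W -> W p ->
  exists a : surface_patch, [/\ pdom a p, xi a p = 0 & forall z, Q z -> W (psi a z)].
Proof.
move=> oW Wp; pose i := chart_at p; have pi : dom i p by exact: dom_chart_at.
set x := chart i p; have xi' : chart_codom i x by exact: chart_codomP.
pose O := chart_codom i `&` param i @^-1` W.
have oO : open O by apply: (open_preimage_in (@chart_codom_open _ _ i) _ oW); exact: param_cont.
have Ox : O x by split => //=; rewrite /x chartK.
have /nbhs_ballP[e /= e0 He] := open_nbhs_nbhs (conj oO Ox).
pose d := e / 2; have d0 : 0 < d by rewrite divr_gt0.
have box t s : `|t| < e -> `|s| < 2 * d -> O (frame x (1, 0) (0, 1) (t, s)).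
  rewrite mulrCA divff// mulr1 => te se; apply: He; rewrite -ball_normE/= distrC.
  by rewrite /frame/= prod_normE/= !mulr1 !mulr0 addr0 add0r !(addrC x.1) !(addrC x.2) !addrK gt_max te.
have phiP (t : R) : `|t| < e -> [/\ `|(fun=> 0 : R) t| < d, is_derive t 1 (fun=> 0 : R) 0 &
    {for t, continuous (fun=> 0 : R)}].
  by move=> _; split; [rewrite normr0|exact: is_derive_cst|exact: cvg_cst].
have epsE : (1, 0 : R).1 * (0 : R, 1).2 - (1 : R, 0).2 * (0, 1 : R).1 = 1 :> R by rewrite /=; ring.
have [a [ai am]] := @box_patch i x (1, 0) (0, 1) 1 e d (fun=> 0) (fun=> 0) e0 d0 epsE
  (mulr1 1) phiP (fun t s te sd => (box t s te sd).1).
have psi0 : psi a 0 = p.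
  have fr0 : frame x (1, 0) (0, 1) (0, 0) = x by rewrite /frame/= !mul0r !addr0 -surjective_pairing.
  by rewrite /psi ai am /comp /shear/= !mulr0 addr0 fr0 chartK.
have [h1 h2] := psiP a unit_square0.
exists a; split; rewrite -?psi0//.
move=> z Qz; have [m1 m2] := patch_mapP a Qz.
rewrite /psi ai am; suff : O (frame x (1, 0) (0, 1) (shear e d (fun=> 0) z)) by case.
have [t1 t2] := (unit_squareE z).1 Qz; apply: box; first by rewrite scale_lt.
by rewrite add0r normrM gtr0_norm//; have := ltr_pM2l d0 `|z.2| 1; rewrite t2 mulr1 => h; rewrite (lt_trans h)//; lra.
Qed.

(** In a frame whose second axis increases [rho], the zero set of [rho] is locally a graph with U
    below it, and the shear along this graph makes it the middle line of the square. *)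
Lemma patch_at_boundary (U W : set M) i (rho : P -> R) p : open U -> boundary U p ->
  open W -> W p -> W `<=` dom i -> smooth (chart i @` W) rho ->
  (exists v, 'D_v rho (chart i p) != 0) -> (forall q, W q -> (U q <-> rho (chart i q) < 0)) ->
  exists a : surface_patch, [/\ pdom a p, xi a p = 0, two_sided U a & forall z, Q z -> W (psi a z)].
Proof.
move=> oU [clU nU] oW Wp Wi rhoS [v0 v0P] UE.
have pi := Wi _ Wp; set x := chart i p; have xi' : chart_codom i x by exact: chart_codomP.
pose O := chart_codom i `&` param i @^-1` W.
have OE : chart i @` W = O.
  apply/seteqP; split => [_ [q Wq <-]|y [yi yW]].
    by split; [exact/chart_codomP/Wi|rewrite /= chartK//; exact: Wi].
  by exists (param i y) => //; have [] := param_dom yi.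
have oO : open O by apply: (open_preimage_in (@chart_codom_open _ _ i) _ oW); exact: param_cont.
have Ox : O x by split => //=; rewrite /x chartK.
have rhoC : C1 O rho by apply: (Ck1_C1 oO); rewrite -OE; exact: (rhoS 1).
have dr := diffC1 rhoC Ox.
(* A negative value would put [p] in the open set U, hence in its interior; a positive one persists
   nearby and would put [p] outside the closure. *)
have rho0 : rho x = 0.
  have [h|h|//] := ltgtP (rho x) 0.
    by exfalso; apply: nU; rewrite /interior; apply: open_nbhs_nbhs; split => //; exact/UE.
  have crho : {for x, continuous rho} by apply: (C1_continuous rhoC); rewrite inE.
  have n1 : nbhs p [set q | 0 < rho (chart i q)].
    have c : {for p, continuous (rho \o chart i)}.
      by apply: continuous_comp => //; apply: chart_continuous; rewrite inE.
    exact: continuous_nbhs_gt c h.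
  have [q [Uq [q1 q2]]] := clU _ (filterI n1 (open_nbhs_nbhs (conj oW Wp))).
  by have /(lt_trans q1) := (UE q q2).1 Uq; rewrite ltxx.
(* [v] is a coordinate direction along which [rho] has a nonzero derivative, signed so as to make it
   positive, and [w] is the other one: the determinant is then 1 or -1. *)
have [w [v [eps [epsE eps2 dpos]]]] : exists w v : P, exists eps : R,
    [/\ w.1 * v.2 - w.2 * v.1 = eps, eps * eps = 1 & 0 < v.1 * dx rho x + v.2 * dy rho x].
  have sg2 (k : R) : k != 0 -> Num.sg k * Num.sg k = 1 by move=> k0; rewrite -expr2 sqr_sg k0.
  have [dy0|dy0] := eqVneq (dy rho x) 0.
    have [dx0|dx0] := eqVneq (dx rho x) 0.
      by move: v0P; rewrite derive_plane// dxE dyE dx0 dy0 !scaler0 addr0 eqxx.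
    exists (0, 1), (Num.sg (dx rho x), 0), (- Num.sg (dx rho x)); split => /=.
    - by ring.
    - by rewrite mulrNN sg2.
    - by rewrite mul0r addr0 -normrEsg normr_gt0.
  exists (1, 0), (0, Num.sg (dy rho x)), (Num.sg (dy rho x)); split => /=.
  - by ring.
  - exact: sg2.
  - by rewrite mul0r add0r -normrEsg normr_gt0.
pose fr := frame x w v; have [fC1 fC2] := frame_C1map x w v openT.
pose O' := fr @^-1` O.
have oO' : open O'.
  by apply: open_comp => // z _; apply: (C1map_continuous (frame_C1map x w v openT)); rewrite inE.
have fr0 : fr 0 = x by rewrite /fr /frame/= !mul0r !addr0 -surjective_pairing.
have HC : C1 O' (rho \o fr).
  by apply: (C1_comp oO' _ rhoC) => //; split; [exact: C1_sub fC1|exact: C1_sub fC2].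
have dH : 0 < dy (rho \o fr) (0, 0).
  have [f1 f2] := frame_is_diff x w v 0.
  have dr' : is_diff (fr 0) rho (linear_form (dx rho x) (dy rho x)) by rewrite fr0; exact: differentiable_is_diff.
  by rewrite (is_diff_dy (is_diff_comp_map f1 f2 dr')).
have O'0 : O' (0, 0) by rewrite /O' /preimage/= fr0.
have H0 : (rho \o fr) (0, 0) = 0 by rewrite /= fr0.
have [e [d [phi [dphi [e0 d0 phi0 phiP box]]]]] := implicit_function oO' HC O'0 H0 dH.
have phiP' t : `|t| < e -> [/\ `|phi t| < d, is_derive t 1 phi (dphi t) & {for t, continuous dphi}].
  by move=> /phiP[].
have [a [ai am]] := box_patch e0 d0 epsE eps2 phiP' (fun t s te sd => (box t s te sd).1.1).
have psi0 : psi a 0 = p.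
  by rewrite /psi ai am /comp /shear/= !mulr0 phi0 addr0 -/fr fr0 chartK.
have [h1 h2] := psiP a unit_square0.
have in_box z : Q z -> `|e * z.1| < e /\ `|phi (e * z.1) + d * z.2| < 2 * d.
  move=> /unit_squareE[t1 t2]; have te : `|e * z.1| < e by rewrite scale_lt.
  split => //; have [pd _ _] := phiP' _ te.
  by rewrite (le_lt_trans (ler_normD _ _))// (_ : 2 * d = d + d) ?ltrD ?scale_lt//; ring.
have psiW z : Q z -> W (psi a z).
  by move=> /in_box[b1 b2]; rewrite /psi ai am; exact: (box _ _ b1 b2).1.2.
exists a; split; rewrite -?psi0//.
move=> z Qz; have [b1 b2] := in_box z Qz; have [[xc _] hlt] := box _ _ b1 b2.
have [_ E] := param_dom xc.
rewrite (UE _ (psiW z Qz)) /psi ai am /comp E.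
apply: (iff_trans hlt); rewrite -subr_gt0 opprD addNKr -mulrN pmulr_rgt0// oppr_gt0.
by [].
Qed.

End patches.

(** * The partition of unity *)

Section partition_of_unity.
Context {R : realType} {M : oriented_surface R}.
Local Notation P := (plane R).
Local Notation Q := (@unit_square R).
Implicit Types (i j : chart_index M) (a : @surface_patch R M) (z : P) (p : M).

Definition bump z : R := sqpos (1 / 4 - z.1 ^+ 2) * sqpos (1 / 4 - z.2 ^+ 2).

Lemma bump_ge0 z : 0 <= bump z.
Proof. by rewrite mulr_ge0 ?sqpos_ge0. Qed.

Lemma sqr_lt_quarter (t : R) : (`|t| < 1 / 2) = (0 < 1 / 4 - t ^+ 2).
Proof.
have [h|h] := ltP `|t| (1 / 2); apply/esym.
  have : `|t| ^+ 2 < (1 / 2) ^+ 2 by rewrite ltrXn2r// nnegrE//; lra.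
  by rewrite real_normK ?num_real// expr_div_n expr1n => h'; lra.
apply/negbTE; rewrite -leNgt.
have : (1 / 2) ^+ 2 <= `|t| ^+ 2 by rewrite lerXn2r// nnegrE//; lra.
by rewrite real_normK ?num_real// expr_div_n expr1n => h'; lra.
Qed.

Lemma bump_gt0 z : `|z| < 1 / 2 -> 0 < bump z.
Proof.
by rewrite prod_normE/= gt_max => /andP[h1 h2]; rewrite mulr_gt0// sqpos_gt0// -sqr_lt_quarter.
Qed.

Lemma bump_out z : 1 / 2 <= `|z| -> bump z = 0.
Proof.
rewrite prod_normE/= le_max => /orP[h|h]; rewrite /bump.
  by rewrite sqpos_le0 ?mul0r// leNgt -sqr_lt_quarter -leNgt.
by rewrite (@sqpos_le0 _ (_ - z.2 ^+ 2)) ?mulr0// leNgt -sqr_lt_quarter -leNgt.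
Qed.

Lemma bump_C1 (O : set P) : open O -> C1 O bump.
Proof.
move=> oO; have c := C1_cst (1 / 4 : R) oO.
have f1 := C1B oO c (C1M oO (C1_fst oO) (C1_fst oO)).
have f2 := C1B oO c (C1M oO (C1_snd oO) (C1_snd oO)).
exact: (C1M oO (C1_sqpos oO f1) (C1_sqpos oO f2)).
Qed.

Definition half_square : set P := [set z : P | `|z| <= 1 / 2].

Lemma half_square_unit : half_square `<=` Q.
Proof. by move=> z /= h; rewrite /unit_square /open_square /= subr0; apply: (le_lt_trans h); lra. Qed.

Lemma half_square_compact : compact half_square.
Proof.
have -> : half_square = (`[- (1 / 2), 1 / 2]%classic `*` `[- (1 / 2), 1 / 2]%classic : set P).
  apply/seteqP; split => z; rewrite /half_square /= prod_normE/= ge_max !in_itv/= !ler_norml.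
    by move=> /andP[].
  by move=> [-> ->].
by apply: compact_setX; exact: segment_compact.
Qed.

(** A compact set, hence closed in a Hausdorff space, off which [beta] vanishes: its open complement
    is where the extension by zero causes no loss of regularity. *)
Definition pcore a : set M := psi a @` half_square.

Lemma pcore_closed a : closed (pcore a).
Proof.
apply: (compact_closed (@surface_hausdorff _ M)).
apply: continuous_compact; last exact: half_square_compact.
apply: continuous_in_subspaceT => z /set_mem/half_square_unit Qz.
by apply: psi_continuous; exact: mem_set.
Qed.

Definition beta a p : R := if asbool (pdom a p) then bump (xi a p) else 0.

Lemma beta_in a p : pdom a p -> beta a p = bump (xi a p).
Proof. by rewrite /beta; case: asboolP. Qed.

Lemma beta_out a p : ~ pcore a p -> beta a p = 0.
Proof.
rewrite /beta; case: asboolP => // ap; have [Qx xE] := xiP ap.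
move=> h; apply: bump_out; rewrite leNgt; apply/negP => h'.
by apply: h; exists (xi a p) => //; exact: ltW.
Qed.

Lemma beta_ge0 a p : 0 <= beta a p.
Proof. by rewrite /beta; case: asboolP => // _; exact: bump_ge0. Qed.

Lemma beta_psi a z : Q z -> beta a (psi a z) = bump z.
Proof. by move=> Qz; have [h1 h2] := psiP a Qz; rewrite beta_in// h2. Qed.

Lemma pcod_trans_dom a j y : pcod a j y -> trans_dom j (pchart a) y.
Proof. by move=> [yj [h _]]; apply/trans_domP. Qed.

Lemma pback_C1map a j : C1map (pcod a j) (pback a j).
Proof.
have [t1 t2] := @transition_C1map _ _ j (pchart a).
have tC : C1map (pcod a j) (transition j (pchart a)).
  by split; [apply: C1_sub t1 => y|apply: C1_sub t2 => y]; exact: pcod_trans_dom.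
by apply: (C1map_comp (@pcod_open _ _ a j) tC (@pinv_C1 _ _ a)) => y [_ []].
Qed.

(** Two open sets cover the chart: the patch, where [beta] is a bump in C1 coordinates, and the
    complement of the closed core, where it is 0. *)
Lemma beta_C1 a : C1S (beta a).
Proof.
move=> j y yj; have [ya|ya] := pselect (pcod a j y).
  have h : C1 (pcod a j) (bump \o pback a j).
    exact: (C1_comp (@pcod_open _ _ a j) (pback_C1map a j) (bump_C1 openT)).
  have E w : pcod a j w -> (bump \o pback a j) w = (beta a \o param j) w.
    by move=> [_ wa]; rewrite /= beta_in.
  exact: (C1_eq (@pcod_open _ _ a j) E h ya).
pose O := chart_codom j `&` param j @^-1` (~` pcore a).
have oO : open O.
  apply: (open_preimage_in (@chart_codom_open _ _ j)); first exact: param_cont.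
  exact/closed_openC/pcore_closed.
have Oy : O y.
  split => // -[z /half_square_unit Qz zE]; apply: ya; split => //.
  by rewrite /preimage/= -zE; have [] := psiP a Qz.
have E w : O w -> 0 = (beta a \o param j) w by move=> [_ wa]; rewrite /= beta_out.
exact: (C1_eq oO E (C1_cst 0 oO) Oy).
Qed.

Variable U : set M.
Hypothesis cM : compact [set: M].
Hypothesis oU : open U.
Hypothesis sU : smooth_boundary U.

Lemma patch_exists p : exists a, [/\ pdom a p, xi a p = 0 & one_sided U a \/ two_sided U a].
Proof.
have [bp|bp] := pselect (boundary U p).
  have [i [W [rho [[oW Wp] Wi rhoS rho0 UE]]]] := sU bp.
  have [|a [h1 h2 h3 _]] := patch_at_boundary oU bp oW Wp Wi rhoS _ UE.
    by apply: rho0; exists p.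
  by exists a; split => //; right.
have [Up|Up] := pselect (U p).
  by have [a [h1 h2 h3]] := patch_in_open oU Up; exists a; split => //; left; left.
have oC : open (~` closure U) by apply: closed_openC; exact: closed_closure.
have pC : (~` closure U) p.
  by move=> clp; apply: bp; split => // /interior_subset.
have [a [h1 h2 h3]] := patch_in_open oC pC; exists a; split => //; left; right.
by move=> z Qz Uz; apply: (h3 z Qz); exact: subset_closure.
Qed.

Lemma patch_cover : exists (m : nat) (a : 'I_m -> @surface_patch R M),
  (forall k, one_sided U (a k) \/ two_sided U (a k)) /\
  (forall p, exists k, pdom (a k) p /\ `|xi (a k) p| < 1 / 2).
Proof.
have [a aP] := choice patch_exists.
pose f p := pdom (a p) `&` xi (a p) @^-1` [set z | `|z| < 1 / 2].
have of_ p : open (f p).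
  apply: (open_preimage_in (@pdom_open _ _ (a p))); first exact: xi_continuous.
  have -> : [set z : P | `|z| < 1 / 2] = [set z : P | `|z - 0| < 1 / 2].
    by apply/seteqP; split => z /=; rewrite subr0.
  exact: open_norm_lt.
have fp p : f p p by have [h1 h2 _] := aP p; split => //=; rewrite h2 normr0 divr_gt0.
have [D cov] : exists D : seq M, forall p, exists2 q, q \in D & f q p.
  (* Compactness in its near-covering form, along the filter of finite sequences ordered by
     inclusion: locally, any sequence containing one centre will do. *)
  pose F := filter_from [set: seq M] (fun s => [set s' : seq M | {subset s <= s'}]).
  have FF : Filter F.
    apply: filter_from_filter; first by exists [::].
    move=> s1 s2 _ _; exists (s1 ++ s2) => // s' h; split => q qs; apply: h; rewrite mem_cat qs ?orbT//.
  have near_cov := (compact_near_coveringP _).1 cM (seq M) F (fun s p => exists2 q, q \in s & f q p) FF.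
  have [|s _ sP] := near_cov.
    move=> p _; exists (f p, [set s : seq M | p \in s]); last by move=> [q s] /= [fq ps]; exists p.
    split; first exact: open_nbhs_nbhs (conj (of_ p) (fp p)).
    by exists [:: p] => // s h; apply: h; rewrite inE.
  by exists s => p; have := sP s (fun=> id) p I.
exists (size D), (fun k => a (tnth (in_tuple D) k)); split.
  by move=> k; have [] := aP (tnth (in_tuple D) k).
move=> p; have [q qD fqp] := cov p.
have /tnthP[k kE] : q \in in_tuple D by [].
by exists k; rewrite -kE.
Qed.

(** The functions [beta] divided by their sum, which is positive because the half-size patches
    already cover. Vanishing beyond radius 1 / 2 in its own patch is what removes the outer sides
    from Green's formula there. *)
Lemma partition_of_unity_exists : exists (m : nat) (a : 'I_m -> @surface_patch R M) (chi : 'I_m -> M -> R),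
  [/\ forall k, one_sided U (a k) \/ two_sided U (a k),
      forall k, C1S (chi k),
      forall k p, 0 <= chi k p,
      forall p, \sum_k chi k p = 1 &
      forall k p, ~ pdom (a k) p -> chi k p = 0] /\
  (forall k z, Q z -> 1 / 2 <= `|z| -> chi k (psi (a k) z) = 0) /\
  (forall p, exists k, pdom (a k) p).
Proof.
have [m [a [aU acov]]] := patch_cover.
pose S p := \sum_k beta (a k) p.
have S0 p : 0 < S p.
  have [k [h1 h2]] := acov p; rewrite /S (bigD1 k)//= ltr_pwDl//.
    by rewrite beta_in// bump_gt0.
  by apply: sumr_ge0 => l _; exact: beta_ge0.
exists m, a, (fun k p => beta (a k) p * (S p)^-1); split; [split|split] => //.
- have SC : C1S S.
    by move=> j; exact: (C1_sum (index_enum 'I_m) (@chart_codom_open _ _ j) (fun k => @beta_C1 (a k) j)).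
  move=> k j; apply: (C1M (@chart_codom_open _ _ j) (@beta_C1 (a k) j)).
  by apply: (C1V (@chart_codom_open _ _ j) (SC j)) => y _; rewrite gt_eqF// S0.
- by move=> k p; rewrite mulr_ge0 ?beta_ge0// invr_ge0 ltW// S0.
- by move=> p; rewrite -mulr_suml divff// gt_eqF// S0.
- by move=> k p h; rewrite /beta; case: asboolP => // _; rewrite mul0r.
- by move=> k z Qz h; rewrite beta_psi// bump_out// mul0r.
- by move=> p; have [k [h _]] := acov p; exists k.
Qed.

End partition_of_unity.

(** * The differential form of an immersed surface *)

Section vectors.
Context {R : realType}.
Implicit Types u v w n x a b p q : 'rV[R]_3.
Local Notation "u $ k" := (u 0 (inord k)) (at level 2, k at level 0, format "u $ k").

Lemma ord3P (k : 'I_3) : [\/ k = inord 0, k = inord 1 | k = inord 2].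
Proof.
by case: k => [[|[|[|//]]] h]; [constructor 1|constructor 2|constructor 3]; apply: val_inj; rewrite /= inordK.
Qed.

Lemma sum3E (F : 'I_3 -> R) : \sum_k F k = F (inord 0) + F (inord 1) + F (inord 2).
Proof.
rewrite !big_ord_recl big_ord0 addr0 addrA.
by congr (F _ + F _ + F _); apply: val_inj; rewrite /= inordK.
Qed.

Lemma dotvE u v : dotv u v = u$0 * v$0 + u$1 * v$1 + u$2 * v$2.
Proof. exact: sum3E. Qed.

Lemma crossv0 u v : (crossv u v)$0 = u$1 * v$2 - u$2 * v$1.
Proof. by rewrite mxE/= inordK. Qed.
Lemma crossv1 u v : (crossv u v)$1 = u$2 * v$0 - u$0 * v$2.
Proof. by rewrite mxE/= inordK. Qed.
Lemma crossv2 u v : (crossv u v)$2 = u$0 * v$1 - u$1 * v$0.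
Proof. by rewrite mxE/= inordK. Qed.

Definition crossvE := (crossv0, crossv1, crossv2).

Lemma rowD u v k : (u + v) 0 k = u 0 k + v 0 k. Proof. by rewrite mxE. Qed.
Lemma rowN u k : (- u) 0 k = - u 0 k. Proof. by rewrite mxE. Qed.
Lemma rowZ c u k : (c *: u) 0 k = c * u 0 k. Proof. by rewrite mxE. Qed.
Lemma row0 k : (0 : 'rV[R]_3) 0 k = 0. Proof. by rewrite mxE. Qed.

Definition vecE := (crossvE, rowD, rowN, rowZ, row0, dotvE).

Lemma row3P u v : u$0 = v$0 -> u$1 = v$1 -> u$2 = v$2 -> u = v.
Proof. by move=> h0 h1 h2; apply/rowP => k; case: (ord3P k) => ->. Qed.

Lemma dotvC u v : dotv u v = dotv v u.
Proof. by rewrite !dotvE; ring. Qed.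
Lemma dotvDl u v w : dotv (u + v) w = dotv u w + dotv v w.
Proof. by rewrite !dotvE !mxE; ring. Qed.
Lemma dotvZl c u v : dotv (c *: u) v = c * dotv u v.
Proof. by rewrite !dotvE !mxE; ring. Qed.
Lemma dotvZr c u v : dotv u (c *: v) = c * dotv u v.
Proof. by rewrite !dotvE !mxE; ring. Qed.
Lemma dotv_ge0 u : 0 <= dotv u u.
Proof. by rewrite dotvE -!expr2 !addr_ge0// sqr_ge0. Qed.
Lemma dotv_eq0 u : dotv u u = 0 -> u = 0.
Proof.
rewrite dotvE -!expr2 => /eqP; rewrite paddr_eq0 ?addr_ge0 ?sqr_ge0//.
rewrite paddr_eq0 ?sqr_ge0// !sqrf_eq0 => /andP[/andP[/eqP h0 /eqP h1] /eqP h2].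
by apply: row3P; rewrite ?mxE.
Qed.
Lemma normv_sqr u : normv u ^+ 2 = dotv u u.
Proof. by rewrite sqr_sqrtr// dotv_ge0. Qed.
Lemma normv_ge0 u : 0 <= normv u. Proof. exact: sqrtr_ge0. Qed.
Lemma normvZ c u : normv (c *: u) = `|c| * normv u.
Proof. by rewrite /normv dotvZl dotvZr mulrA -expr2 sqrtrM ?sqr_ge0// sqrtr_sqr. Qed.
Lemma lagrange u v : dotv u u * dotv v v - dotv u v ^+ 2 = dotv (crossv u v) (crossv u v).
Proof. by rewrite !dotvE !crossvE; ring. Qed.
Lemma dotv_cauchy u v : `|dotv u v| <= normv u * normv v.
Proof.
rewrite -sqrtrM ?dotv_ge0// -sqrtr_sqr ler_wsqrtr//.
by rewrite -subr_ge0 lagrange dotv_ge0.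
Qed.
Lemma normv_crossv u v : normv (crossv u v) <= normv u * normv v.
Proof.
rewrite -sqrtrM ?dotv_ge0//; apply: ler_wsqrtr.
by rewrite -lagrange lerBlDr lerDl sqr_ge0.
Qed.

Definition detv u v w := dotv u (crossv v w).

Lemma binet u v a b : dotv (crossv u v) (crossv a b) = dotv u a * dotv v b - dotv u b * dotv v a.
Proof. by rewrite !dotvE !crossvE; ring. Qed.

(** The double product shows that [n] crossed with the product of [a] and [b] is zero, so that this
    product is its own component along [n]. *)
Lemma crossv_normal n a b : dotv n n = 1 -> dotv n a = 0 -> dotv n b = 0 ->
  crossv a b = detv n a b *: n.
Proof.
move=> nn na nb.
have E u : dotv n n *: u - dotv n u *: n = crossv (crossv n u) n.
  by apply: row3P; rewrite !vecE; ring.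
have := E (crossv a b); rewrite nn scale1r.
have -> : crossv n (crossv a b) = dotv n b *: a - dotv n a *: b.
  by apply: row3P; rewrite !vecE; ring.
rewrite na nb !scale0r subrr.
have -> : crossv 0 n = 0 by apply: row3P; rewrite !vecE; ring.
by move/eqP; rewrite subr_eq0 => /eqP.
Qed.

Lemma crossv_double a b : dotv a b *: a + - dotv a a *: b = crossv a (crossv a b).
Proof. by apply: row3P; rewrite !vecE; ring. Qed.
Lemma crossv_comb a b (s t k l : R) :
  crossv (s *: a + t *: b) (k *: a + l *: b) = (s * l - k * t) *: crossv a b.
Proof. by apply: row3P; rewrite !vecE; ring. Qed.
Lemma crossvr0 a : crossv a 0 = 0.
Proof. by apply: row3P; rewrite !vecE; ring. Qed.
Lemma dotv_crossv_l a b : dotv (crossv a b) a = 0.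
Proof. by rewrite !vecE; ring. Qed.
Lemma dotv_crossv_r a b : dotv (crossv a b) b = 0.
Proof. by rewrite !vecE; ring. Qed.

Lemma det2E (A : 'M[R]_2) : \det A = A 0 0 * A 1 1 - A 0 1 * A 1 0.
Proof.
rewrite (expand_det_row _ ord0) !big_ord_recl big_ord0 /cofactor !det_mx11 !mxE /=.
have -> : lift ord0 ord0 = 1 :> 'I_2 by exact: val_inj.
have -> : lift 1 0 = 0 :> 'I_2 by exact: val_inj.
by rewrite expr0 expr1 !mul1r; ring.
Qed.

Lemma det2_matrix (E : 'I_2 -> 'I_2 -> R) :
  \det (\matrix_(a, b) E a b) = E 0 0 * E 1 1 - E 0 1 * E 1 0.
Proof. by rewrite det2E !mxE. Qed.

(* The tangential part of [x] is rotated by a quarter turn by [crossv n]. *)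
Lemma detv_tangential x n a b : dotv n n = 1 -> dotv n a = 0 -> dotv n b = 0 ->
  dotv x a * detv x n b - dotv x b * detv x n a =
  detv n a b * (dotv x n ^+ 2 - dotv x x).
Proof.
move=> nn na nb.
have -> : dotv x a * detv x n b - dotv x b * detv x n a =
    dotv x n * dotv x (crossv a b) - dotv x x * detv n a b.
  by rewrite /detv !vecE; ring.
rewrite (crossv_normal nn na nb) dotvZr; ring.
Qed.

(* The integrand of d omega, omega = - (det(x, n, dx) + <x, n> det(x, n, dn)) / 2; [a], [b] are the
   partial derivatives of [x], and [p], [q] those of [n]. *)
Lemma support_identity x n a b p q D k : dotv n n = 1 -> dotv n a = 0 -> dotv n b = 0 ->
  dotv n p = 0 -> dotv n q = 0 -> crossv a b = D *: n -> detv n p q = k * D ->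
  let h := dotv x n in
  dotv (crossv a n + crossv x p) b - dotv (crossv b n + crossv x q) a +
  (dotv (dotv x p *: crossv x n + h *: (crossv a n + crossv x p)) q -
   dotv (dotv x q *: crossv x n + h *: (crossv b n + crossv x q)) p) =
  - 2 * (D * (1 - k * ((3 * h ^+ 2 - dotv x x) / 2))).
Proof.
move=> nn na nb np nq ab kD h.
have detD : detv n a b = D by rewrite /detv ab dotvZr nn mulr1.
have e1 : detv x p b = h * detv n p b by rewrite {1}/detv (crossv_normal nn np nb) dotvZr mulrC.
have e2 : detv x a q = h * detv n a q by rewrite {1}/detv (crossv_normal nn na nq) dotvZr mulrC.
have e3 : detv x p q = h * (k * D) by rewrite {1}/detv (crossv_normal nn np nq) dotvZr mulrC kD.
have e4 := detv_tangential x nn np nq; rewrite kD -/h in e4.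
have -> : dotv (crossv a n + crossv x p) b - dotv (crossv b n + crossv x q) a +
  (dotv (dotv x p *: crossv x n + h *: (crossv a n + crossv x p)) q -
   dotv (dotv x q *: crossv x n + h *: (crossv b n + crossv x q)) p) =
  - 2 * detv n a b + detv x p b + detv x a q + (dotv x p * detv x n q - dotv x q * detv x n p)
  - h * (detv n a q + detv n p b) + 2 * h * detv x p q.
  by rewrite /detv !vecE; ring.
(* The mean curvature terms produced by [e1] and [e2] cancel against the bracket with factor [h];
   what remains is -2 D + k D (3 h^2 - |x|^2). *)
by rewrite e1 e2 e3 e4 detD; field.
Qed.

Lemma minor_opp (a b c d a' b' c' d' : R) : a = - a' -> b = - b' -> c = - c' -> d = - d' ->
  a * d - b * c = a' * d' - b' * c'.
Proof. by move=> -> -> -> ->; rewrite !mulrNN. Qed.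

(** The same identity in the form delivered by the product rule: the factor -1/2 sits inside the
    field, and the derivative of the support function still shows its vanishing part <dX, N>. *)
Lemma support_identity_half x n a b p q D k : dotv n n = 1 -> dotv n a = 0 -> dotv n b = 0 ->
  dotv n p = 0 -> dotv n q = 0 -> crossv a b = D *: n -> detv n p q = k * D ->
  dotv (- 2^-1 *: (crossv a n + crossv x p)) b - dotv (- 2^-1 *: (crossv b n + crossv x q)) a +
  (dotv ((dotv a n + dotv x p) *: (- 2^-1 *: crossv x n) +
         dotv x n *: (- 2^-1 *: (crossv a n + crossv x p))) q -
   dotv ((dotv b n + dotv x q) *: (- 2^-1 *: crossv x n) +
         dotv x n *: (- 2^-1 *: (crossv b n + crossv x q))) p) =
  D * (1 - k * ((3 * dotv x n ^+ 2 - dotv x x) / 2)).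
Proof.
move=> nn na nb np nq ab kD.
have := support_identity x nn na nb np nq ab kD; rewrite /=.
rewrite (dotvC a n) (dotvC b n) na nb !add0r.
rewrite !(scalerA, dotvDl, dotvZl); set r := D * _ => h.
have -> : r = - 2^-1 * (- 2 * r) by field.
by rewrite -h; ring.
Qed.

End vectors.

(** * Calculus of vector fields along the plane *)

Section vector_fields.
Context {R : realType}.
Local Notation P := (plane R).
Local Notation V3 := 'rV[R]_3.
Implicit Types (X Y : P -> V3).

(** Componentwise, so that the scalar calculus applies; [derive3E] identifies it with the derivative
    in the normed space. *)
Definition D3 (v : P) X z : V3 := \row_k 'D_v (fun y => X y 0 k) z.
Definition diff3 X z := forall k, differentiable (fun y => X y 0 k) z.
Definition C13 (O : set P) X := forall k, C1 O (fun y => X y 0 k).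

Lemma C13_diff3 O X z : C13 O X -> O z -> diff3 X z.
Proof. by move=> XC Oz k; exact: diffC1 (XC k) Oz. Qed.

Lemma derive3E v X z : derivable X z v -> 'D_v X z = D3 v X z.
Proof. by move=> dX; rewrite derive_mx//; apply/rowP => k; rewrite !mxE. Qed.

Lemma derive_comb v (a b c d : P -> R) z : differentiable a z -> differentiable b z ->
  differentiable c z -> differentiable d z ->
  'D_v (fun y => a y * b y - c y * d y) z =
  'D_v a z * b z + a z * 'D_v b z - ('D_v c z * d z + c z * 'D_v d z).
Proof.
move=> da db dc dd; have h (f : P -> R) : differentiable f z -> derivable f z v by exact: diff_derivable.
rewrite deriveB; [|by apply: derivableM; exact: h|by apply: derivableM; exact: h].
rewrite (deriveM (h _ da) (h _ db)) (deriveM (h _ dc) (h _ dd)) /GRing.scale/=.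
by rewrite (mulrC (b z)) (mulrC (d z)) (addrC (a z * _)) (addrC (c z * _)).
Qed.

Lemma D3_crossv v X Y z : diff3 X z -> diff3 Y z ->
  D3 v (fun y => crossv (X y) (Y y)) z = crossv (D3 v X z) (Y z) + crossv (X z) (D3 v Y z).
Proof.
move=> dX dY; apply: row3P; rewrite !vecE !mxE.
- by under eq_fun do rewrite crossv0; rewrite derive_comb//; ring.
- by under eq_fun do rewrite crossv1; rewrite derive_comb//; ring.
- by under eq_fun do rewrite crossv2; rewrite derive_comb//; ring.
Qed.

Lemma derive_dotv v X Y z : diff3 X z -> diff3 Y z ->
  'D_v (fun y => dotv (X y) (Y y)) z = dotv (D3 v X z) (Y z) + dotv (X z) (D3 v Y z).
Proof.
move=> dX dY; rewrite /dotv.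
have h (f : P -> R) : differentiable f z -> derivable f z v by exact: diff_derivable.
under eq_fun do rewrite sum3E.
have hM k : derivable (fun y => X y 0 k * Y y 0 k) z v by apply: derivableM; exact: h.
have EM k : 'D_v (fun y => X y 0 k * Y y 0 k) z =
    D3 v X z 0 k * Y z 0 k + X z 0 k * D3 v Y z 0 k.
  by rewrite deriveM; [rewrite !mxE /GRing.scale/=; ring|exact: h|exact: h].
rewrite (deriveD (derivableD (hM (inord 0)) (hM (inord 1))) (hM (inord 2))).
by rewrite (deriveD (hM (inord 0)) (hM (inord 1))) !sum3E !EM; ring.
Qed.

Lemma D3_scale v (f : P -> R) X z : differentiable f z -> diff3 X z ->
  D3 v (fun y => f y *: X y) z = 'D_v f z *: X z + f z *: D3 v X z.
Proof.
move=> df dX; apply/rowP => k; rewrite !mxE.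
under eq_fun do rewrite mxE.
rewrite deriveM ?/GRing.scale/=; first by ring.
  exact: diff_derivable.
exact: diff_derivable.
Qed.

Lemma C13_crossv O X Y : open O -> C13 O X -> C13 O Y -> C13 O (fun y => crossv (X y) (Y y)).
Proof.
move=> oO XC YC k; case: (ord3P k) => ->.
- by under eq_fun do rewrite crossv0; apply: C1B => //; apply: C1M.
- by under eq_fun do rewrite crossv1; apply: C1B => //; apply: C1M.
- by under eq_fun do rewrite crossv2; apply: C1B => //; apply: C1M.
Qed.

Lemma C13_dotv O X Y : open O -> C13 O X -> C13 O Y -> C1 O (fun y => dotv (X y) (Y y)).
Proof.
move=> oO XC YC; under eq_fun do rewrite dotvE.
by apply: C1D => //; [apply: C1D => //|]; apply: C1M.
Qed.

Lemma C13_scale O f X : open O -> C1 O f -> C13 O X -> C13 O (fun y => f y *: X y).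
Proof. by move=> oO fC XC k; under eq_fun do rewrite mxE; apply: C1M. Qed.

Lemma C1_sqrt (O : set P) (f : P -> R) : open O -> C1 O f -> (forall z, O z -> 0 < f z) -> C1 O (fun z => Num.sqrt (f z)).
Proof.
move=> oO fC f0; apply: (@C1_outer R O Num.sqrt (fun r => (2 * Num.sqrt r)^-1) f oO fC) => z Oz.
split; first exact: is_derive1_sqrt (f0 _ Oz).
apply: continuousV; first by rewrite mulf_neq0// gt_eqF// sqrtr_gt0 f0.
by apply: continuousM; [exact: cvg_cst|exact: sqrt_continuous].
Qed.

Lemma C13_normalize O X : open O -> C13 O X -> (forall z, O z -> X z != 0) ->
  C13 O (fun z => (normv (X z))^-1 *: X z).
Proof.
move=> oO XC X0; apply: C13_scale => //.
have p z : O z -> 0 < dotv (X z) (X z).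
  by move=> Oz; rewrite lt_def dotv_ge0 andbT; apply: contra (X0 _ Oz) => /eqP/dotv_eq0 ->.
apply: C1V => //; first by apply: C1_sqrt => //; exact: C13_dotv.
by move=> z Oz; rewrite gt_eqF// sqrtr_gt0 p.
Qed.

Lemma dotvN_D3 v X z : diff3 X z -> (\near z, dotv (X z) (X z) = 1) -> dotv (X z) (D3 v X z) = 0.
Proof.
move=> dX /(near_eq_derive v); rewrite derive_dotv// derive_cst dotvC.
by move=> /eqP; rewrite -mulr2n mulrn_eq0/= => /eqP.
Qed.

Lemma dotv_D3_orth v X Y z : diff3 X z -> diff3 Y z -> (\near z, dotv (X z) (Y z) = 0) ->
  dotv (D3 v X z) (Y z) = - dotv (X z) (D3 v Y z).
Proof.
move=> dX dY /(near_eq_derive v); rewrite derive_dotv// derive_cst => /eqP.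
by rewrite addr_eq0 => /eqP.
Qed.

End vector_fields.

(** * Normal, Gauss map and curvature in arbitrary charts *)

Section immersed_surface.
Context {R : realType} {M : oriented_surface R} (g : riemannian_metric M) (phi : M -> 'rV[R]_3).
Hypothesis phiC2 : isometric_immersion_C2 g phi.
Local Notation P := (plane R).
Local Notation V3 := 'rV[R]_3.
Local Notation e0 := (plane_basis R 0).
Local Notation e1 := (plane_basis R 1).
Local Notation N := (gauss_map phi).
Implicit Types (i j : chart_index M).

Let oc i : open (chart_codom i) := @chart_codom_open _ _ i.

Lemma coord_linear_continuous k : exists l : {linear V3 -> R}, continuous l /\ forall u, l u = u 0 k.
Proof.
have lin : linear (fun u : V3 => u 0 k : R) by move=> c u v; rewrite !mxE.
pose m := GRing.isLinear.Build R V3 R _ (fun u : V3 => u 0 k : R) lin.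
pose l : {linear V3 -> R} := HB.pack (fun u : V3 => u 0 k : R) m.
by exists l; split => //; exact: coord_continuous.
Qed.

Lemma Ck1_C13 (O : set P) (X : P -> V3) : open O -> Ck 1 O X -> C13 O X.
Proof.
move=> oO XC k; have [l [lc lE]] := coord_linear_continuous k.
have := Ck1_C1 oO (Ck1_linear oO lc XC).
by apply: C1_eq => // z _; rewrite /= lE.
Qed.

Lemma imm_derivable i v y : chart_codom i y -> derivable (phi \o param i) y v.
Proof. by move=> yi; have [[_ h] _ _] := phiC2 i; exact: (h v).1. Qed.

Lemma imm_D3 i v y : chart_codom i y -> 'D_v (phi \o param i) y = D3 v (phi \o param i) y.
Proof. by move=> yi; apply: derive3E; exact: imm_derivable. Qed.

Lemma imm_Ck1 i : Ck 1 (chart_codom i) (phi \o param i).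
Proof.
by have [[h0 h] _ _] := phiC2 i; split => // v; split; [exact: (h v).1|exact: (h v).2.1].
Qed.

Lemma imm_C13 i : C13 (chart_codom i) (phi \o param i).
Proof. exact: Ck1_C13 (@imm_Ck1 i). Qed.

Lemma imm_D3_C13 i v : C13 (chart_codom i) (D3 v (phi \o param i)).
Proof.
have [[_ h] _ _] := phiC2 i; have := Ck1_C13 (@oc i) (h v).2.
by move=> H k; apply: C1_eq (H k) => // y yi; rewrite imm_D3.
Qed.

Lemma D3_coord v (X : P -> V3) z k : D3 v X z 0 k = 'D_v (fun y => X y 0 k) z.
Proof. by rewrite mxE. Qed.

Lemma D3_plane v (X : P -> V3) z : diff3 X z -> D3 v X z = v.1 *: D3 e0 X z + v.2 *: D3 e1 X z.
Proof. move=> dX; apply/rowP => k; have := derive_plane v (dX k).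
by rewrite -!D3_coord => ->; rewrite [RHS]rowD; congr (_ + _); rewrite [RHS]rowZ. Qed.

Definition normal i y := crossv (D3 e0 (phi \o param i) y) (D3 e1 (phi \o param i) y).
Definition density i y := normv (normal i y).

(** If the partials a and b had zero cross product, the tangent vector (<a, b>, -<a, a>) would be
    killed by the differential. Injectivity gives <a, a> = 0, thus a = 0, which injectivity excludes
    again. *)
Lemma normal_neq0 i y : chart_codom i y -> normal i y != 0.
Proof.
move=> yi; apply/eqP => n0; have [_ inj _] := phiC2 i.
set a := D3 e0 (phi \o param i) y; set b := D3 e1 (phi \o param i) y.
have dX := C13_diff3 (@imm_C13 i) yi.
have a0 : a <> 0.
  move=> a0; have : e0 = 0 by apply: (inj y yi); rewrite imm_D3.
  by move/(congr1 fst) => /eqP; rewrite plane_basis0 oner_eq0.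
apply: a0; apply: dotv_eq0.
pose v : P := (dotv a b, - dotv a a).
have : v = 0.
  apply: (inj y yi); rewrite imm_D3// D3_plane// -/a -/b /=.
  by rewrite crossv_double (n0 : crossv a b = 0) crossvr0.
by move/(congr1 snd)/eqP; rewrite /v/= oppr_eq0 => /eqP.
Qed.

Lemma density_gt0 i y : chart_codom i y -> 0 < density i y.
Proof.
move=> /normal_neq0 n0; rewrite sqrtr_gt0 lt_def dotv_ge0 andbT.
by apply: contra n0 => /eqP/dotv_eq0 ->.
Qed.

Lemma det_first_form i y : chart_codom i y -> \det (first_form g i y) = density i y ^+ 2.
Proof.
move=> yi; have [_ _ gE] := phiC2 i.
rewrite det2_matrix !gE// !imm_D3// /density normv_sqr -lagrange expr2.
move: (D3 e0 _ y) (D3 e1 _ y) => u v; by rewrite (dotvC v u).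
Qed.

Lemma sqrt_det_first_form i y : chart_codom i y -> Num.sqrt (\det (first_form g i y)) = density i y.
Proof. by move=> yi; rewrite det_first_form// sqrtr_sqr gtr0_norm// density_gt0. Qed.

Lemma D3_transition (Z : M -> V3) i j y v : trans_dom i j y ->
  diff3 (Z \o param j) (transition i j y) ->
  D3 v (Z \o param i) y = 'D_v (fst \o transition i j) y *: D3 e0 (Z \o param j) (transition i j y) +
    'D_v (snd \o transition i j) y *: D3 e1 (Z \o param j) (transition i j y).
Proof.
move=> yij dZ; apply/rowP => k.
have rowE (s t : R) (u w : V3) : (s *: u + t *: w) 0 k = s * u 0 k + t * w 0 k by rewrite rowD !rowZ.
rewrite [RHS]rowE 3!D3_coord.
rewrite (near_eq_derive _ (near_transition (fun p => Z p 0 k) yij)).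
have [F1 F2] := @transition_C1map _ _ i j.
have d1 := differentiable_is_diff (diffC1 F1 yij).
have d2 := differentiable_is_diff (diffC1 F2 yij).
have dz := differentiable_is_diff (dZ k).
rewrite (is_diff_linear_formE v (is_diff_comp_map d1 d2 dz)).
rewrite (is_diff_linear_formE v d1) (is_diff_linear_formE v d2).
by rewrite dxE dyE /linear_form /GRing.scale/=; ring.
Qed.

Lemma normal_transition i j y : trans_dom i j y ->
  normal i y = jac (transition i j) y *: normal j (transition i j y).
Proof.
move=> yij; have [/trans_domP[yj _] _ _] := transitionP yij.
have dX := C13_diff3 (@imm_C13 j) yj.
by rewrite /normal !(D3_transition _ yij dX) crossv_comb /jac /br !dxE !dyE.
Qed.

Lemma density_transition i j y : trans_dom i j y ->
  density i y = jac (transition i j) y * density j (transition i j y).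
Proof.
by move=> yij; rewrite /density (normal_transition yij) normvZ gtr0_norm// transition_jac.
Qed.

(** A change of chart multiplies the normal by a positive Jacobian determinant, which normalization
    removes; so any chart may replace the preferred one. *)
Lemma gaussE i y : chart_codom i y -> N (param i y) = (density i y)^-1 *: normal i y.
Proof.
move=> yi; set p := param i y; pose c := chart_at p.
have yic : trans_dom i c y by apply/trans_domP; split => //; exact: dom_chart_at.
have [/trans_domP[yc _] _ _] := transitionP yic.
have -> : N p = (density c (transition i c y))^-1 *: normal c (transition i c y).
  by rewrite /gauss_map/= -/p -/c !imm_D3.
rewrite (density_transition yic) (normal_transition yic) scalerA; congr (_ *: _).
by rewrite invfM mulrAC mulVf ?mul1r// gt_eqF// transition_jac.
Qed.

Lemma gauss_C13 i : C13 (chart_codom i) (N \o param i).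
Proof.
have nC : C13 (chart_codom i) (normal i).
  by apply: C13_crossv => //; exact: imm_D3_C13.
have := C13_normalize (@oc i) nC (@normal_neq0 i) => H k.
by apply: C1_eq (H k) => // y yi; rewrite /= gaussE.
Qed.

Lemma gauss_unit i y : chart_codom i y -> dotv (N (param i y)) (N (param i y)) = 1.
Proof.
move=> yi; rewrite gaussE// dotvZl dotvZr -normv_sqr -/(density i y).
by rewrite mulrA -invfM -expr2 mulVf// expf_neq0// gt_eqF// density_gt0.
Qed.

Lemma gauss_orth i y : chart_codom i y ->
  dotv (N (param i y)) (D3 e0 (phi \o param i) y) = 0 /\ dotv (N (param i y)) (D3 e1 (phi \o param i) y) = 0.
Proof.
move=> yi; rewrite gaussE// !dotvZl /normal.
by rewrite dotv_crossv_l dotv_crossv_r mulr0.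
Qed.

Lemma near_codom i y (Q : P -> Prop) : chart_codom i y -> (forall z, chart_codom i z -> Q z) -> \near y, Q y.
Proof. by move=> yi H; apply: filterS (open_nbhs_nbhs (conj (@oc i) yi)). Qed.

(** Differentiating <N, dX> = 0 turns the products of first derivatives of N and X into minus the
    second form; the two signs cancel in each product of the determinant. Binet-Cauchy identifies
    the result with <X_1 x X_2, N_1 x N_2>, where X_1 x X_2 is the density times N. *)
Lemma gauss_curvature_det p : let c := chart_at p in let y := chart c p in
  detv (N p) (D3 e0 (N \o param c) y) (D3 e1 (N \o param c) y) = gauss_curvature g phi p * density c y.
Proof.
move=> c y; have pc : dom c p by exact: dom_chart_at.
have yc : chart_codom c y by exact: chart_codomP.
have yp : param c y = p by exact: chartK.
set X := phi \o param c; set Nc := N \o param c.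
have dN := C13_diff3 (@gauss_C13 c) yc.
have dX v := C13_diff3 (@imm_D3_C13 c v) yc.
have Dy := density_gt0 yc.
pose S v w := dotv (D3 v (D3 w X) y) (N p).
have sE v w : dotv ('D_v (fun x => 'D_w X x) y) (N p) = S v w.
  have [[_ h] _ _] := phiC2 c.
  rewrite /S (near_eq_derive v (near_codom yc (fun z => @imm_D3 c w z))).
  have d : derivable (fun x => 'D_w X x) y v by exact: ((h w).2.2 v).1.
  have d' : derivable (D3 w X) y v.
    by apply: (near_eq_derivable _ d); apply: (near_codom yc) => z; exact: imm_D3.
  by rewrite (derive3E d').
have nE v w : (w = e0 \/ w = e1) -> dotv (D3 v Nc y) (D3 w X y) = - S v w.
  move=> we; rewrite (dotv_D3_orth v dN (dX w)); first by rewrite /S dotvC /Nc/= yp.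
  by apply: (near_codom yc) => z zc; have [h0 h1] := gauss_orth zc; case: we => ->; [exact: h0|exact: h1].
have KE : gauss_curvature g phi p * density c y ^+ 2 = S e0 e0 * S e1 e1 - S e0 e1 * S e1 e0.
  rewrite /gauss_curvature -/c -/y det_first_form// divfK ?expf_neq0 ?gt_eqF//.
  rewrite det2_matrix.
  by congr (_ * _ - _ * _); [exact: (sE e0 e0)|exact: (sE e1 e1)|exact: (sE e0 e1)|exact: (sE e1 e0)].
have nn : normal c y = density c y *: N p.
  by rewrite -yp gaussE// scalerA divff ?scale1r// gt_eqF.
apply: (mulfI (_ : density c y != 0)); first by rewrite gt_eqF.
have -> : density c y * (gauss_curvature g phi p * density c y) = gauss_curvature g phi p * density c y ^+ 2.
  by ring.
rewrite KE /detv -dotvZl -nn dotvC /normal binet -/X -/Nc.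
have n00 := nE e0 e0 (or_introl erefl); have n01 := nE e0 e1 (or_intror erefl).
have n10 := nE e1 e0 (or_introl erefl); have n11 := nE e1 e1 (or_intror erefl).
exact: (minor_opp n00 n01 n10 n11).
Qed.

Definition support p := dotv (phi p) (N p).
(** Pairing with dX gives the first half of omega, pairing with h dN the second, since det (X, N, v)
    = <X x N, v>. *)
Definition form_field p : V3 := (- 2^-1) *: crossv (phi p) (N p).

(* [omega = sum_k form_coef1 k * d (phi k) + form_coef2 k * d (N k)] *)
Definition form_coef1 (k : 'I_3) p : R := form_field p 0 k.
Definition form_coef2 (k : 'I_3) p : R := (support p *: form_field p) 0 k.

Lemma form_field_C13 i : C13 (chart_codom i) (form_field \o param i).
Proof.
apply: C13_scale; [exact: oc|exact: C1_cst|].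
by apply: C13_crossv; [exact: oc|exact: imm_C13|exact: gauss_C13].
Qed.

Lemma support_C1 i : C1 (chart_codom i) (support \o param i).
Proof. by apply: C13_dotv; [exact: oc|exact: imm_C13|exact: gauss_C13]. Qed.

Lemma form_coef1_C1 k : C1S (form_coef1 k).
Proof. by move=> i; exact: form_field_C13. Qed.

Lemma form_coef2_C1 k : C1S (form_coef2 k).
Proof.
move=> i; have := C13_scale (@oc i) (@support_C1 i) (@form_field_C13 i); exact.
Qed.

Lemma phi_C1 k : C1S (fun p => phi p 0 k).
Proof. by move=> i; exact: imm_C13. Qed.

Lemma gauss_C1 k : C1S (fun p => N p 0 k).
Proof. by move=> i; exact: gauss_C13. Qed.

Definition curvature_weight p := (3 * support p ^+ 2 - dotv (phi p) (phi p)) / 2.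

Definition exterior_derivative i y := \sum_(k < 3)
  (br (form_coef1 k \o param i) ((fun p => phi p 0 k) \o param i) y +
   br (form_coef2 k \o param i) ((fun p => N p 0 k) \o param i) y).

Lemma br_dotv (X Y : P -> V3) z :
  \sum_(k < 3) br (fun y => X y 0 k) (fun y => Y y 0 k) z =
  dotv (D3 e0 X z) (D3 e1 Y z) - dotv (D3 e1 X z) (D3 e0 Y z).
Proof.
rewrite /dotv -sumrB; apply: eq_bigr => k _.
by rewrite !D3_coord /br -!dxE -!dyE.
Qed.

Lemma D3_form_field v i y : chart_codom i y ->
  D3 v (form_field \o param i) y = - 2^-1 *:
    (crossv (D3 v (phi \o param i) y) (N (param i y)) + crossv (phi (param i y)) (D3 v (N \o param i) y)).
Proof.
move=> yi; have dX := C13_diff3 (@imm_C13 i) yi; have dN := C13_diff3 (@gauss_C13 i) yi.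
have dc : diff3 (fun y => crossv (phi (param i y)) (N (param i y))) y.
  exact: C13_diff3 (C13_crossv (@oc i) (@imm_C13 i) (@gauss_C13 i)) yi.
have := D3_scale v (differentiable_cst (- 2^-1 : R) y) dc.
rewrite /form_field => ->; rewrite derive_cst scale0r add0r; congr (_ *: _).
exact: D3_crossv.
Qed.

Lemma exterior_derivative_preferred p : let c := chart_at p in let y := chart c p in
  exterior_derivative c y = density c y * (1 - gauss_curvature g phi p * curvature_weight p).
Proof.
move=> c y; have pc : dom c p by exact: dom_chart_at.
have yc : chart_codom c y by exact: chart_codomP.
have yp : param c y = p by exact: chartK.
have dX := C13_diff3 (@imm_C13 c) yc; have dN := C13_diff3 (@gauss_C13 c) yc.
have dF := C13_diff3 (@form_field_C13 c) yc; have dS := diffC1 (@support_C1 c) yc.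
rewrite /exterior_derivative big_split/=.
rewrite (br_dotv (form_field \o param c) (phi \o param c)).
rewrite (br_dotv (fun z => support (param c z) *: form_field (param c z)) (N \o param c)).
rewrite !(D3_scale _ dS dF) !D3_form_field//.
have := gauss_curvature_det p; rewrite -/c -/y /=.
have nn : normal c y = density c y *: N p.
  by rewrite -yp gaussE// scalerA divff ?scale1r// gt_eqF// density_gt0.
move: nn; rewrite /normal.
have [na nb] := gauss_orth yc; have := gauss_unit yc.
have nu v : dotv (N (param c y)) (D3 v (N \o param c) y) = 0.
  exact: (@dotvN_D3 R v (N \o param c) y dN (near_codom yc (@gauss_unit c))).
have sv v : 'D_v (support \o param c) y = dotv (D3 v (phi \o param c) y) (N (param c y)) +
    dotv (phi (param c y)) (D3 v (N \o param c) y) by exact: derive_dotv dX dN.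
rewrite !sv; move: (nu e0) (nu e1) na nb; rewrite /curvature_weight /form_field /support /comp !yp.
move: (D3 e0 _ y) (D3 e1 _ y) (D3 e0 _ y) (D3 e1 _ y) (N p) (phi p) (density c y) (gauss_curvature g phi p).
move=> p0 p1 a b n x D K n0 n1 na nb nn ab kD.
exact: (support_identity_half x nn na nb n0 n1 ab kD).
Qed.

(** The curvature is defined in the preferred chart at each point, where the formula has been
    computed. Both sides are multiplied by the same Jacobian determinant under a change of chart,
    which extends it to all charts. *)
Lemma exterior_derivativeE i y : chart_codom i y ->
  exterior_derivative i y =
  density i y * (1 - gauss_curvature g phi (param i y) * curvature_weight (param i y)).
Proof.
move=> yi; set p := param i y; pose c := chart_at p.
have pc : dom c p by exact: dom_chart_at.
have yic : trans_dom i c y by apply/trans_domP.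
have [/trans_domP[yc _] _ _] := transitionP yic.
rewrite (density_transition yic) -mulrA -exterior_derivative_preferred.
rewrite /exterior_derivative mulr_sumr; apply: eq_bigr => k _.
have br1 := br_transition yic (diffC1 (@form_coef1_C1 k c) yc) (diffC1 (@phi_C1 k c) yc).
have br2 := br_transition yic (diffC1 (@form_coef2_C1 k c) yc) (diffC1 (@gauss_C1 k c) yc).
apply: (etrans (congr2 +%R br1 br2)); rewrite -mulrDl; exact: mulrC.
Qed.

Variable r : R.
Hypothesis phi_r : forall p, normv (phi p) <= r.

Lemma phi_sqr_le p : dotv (phi p) (phi p) <= r ^+ 2.
Proof.
by rewrite -normv_sqr; apply: lerXn2r; rewrite ?nnegrE ?normv_ge0//; exact: le_trans (normv_ge0 _) (phi_r p).
Qed.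

Lemma gauss_norm p : normv (N p) = 1.
Proof.
have pc : dom (chart_at p) p by exact: dom_chart_at.
have := gauss_unit (chart_codomP pc); rewrite chartK// /normv => ->; exact: sqrtr1.
Qed.

Lemma support_le p : `|support p| <= normv (phi p).
Proof. by have := dotv_cauchy (phi p) (N p); rewrite gauss_norm mulr1. Qed.

Lemma curvature_weight_le p : `|curvature_weight p| <= r ^+ 2.
Proof.
have h1 : support p ^+ 2 <= dotv (phi p) (phi p).
  by rewrite -normv_sqr -real_normK ?num_real//; apply: lerXn2r; rewrite ?nnegrE ?normv_ge0//; exact: support_le.
have h2 := phi_sqr_le p; have h3 := sqr_ge0 (support p).
by rewrite /curvature_weight ler_norml; apply/andP; split; lra.
Qed.

Lemma density_le i y : chart_codom i y ->
  density i y <= r ^+ 2 * (`|gauss_curvature g phi (param i y)| * density i y) + exterior_derivative i y.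
Proof.
move=> yi; rewrite exterior_derivativeE//; set K := gauss_curvature _ _ _; set q := curvature_weight _.
have D0 := density_gt0 yi.
have h : K * q <= r ^+ 2 * `|K|.
  apply: (le_trans (ler_norm _)); rewrite normrM mulrC ler_wpM2r//; exact: curvature_weight_le.
have := ler_wpM2r (ltW D0) h; lra.
Qed.

Lemma form_le p (u w : V3) :
  `|\sum_k (form_coef1 k p * u 0 k + form_coef2 k p * w 0 k)| <= r / 2 * normv u + r ^+ 2 / 2 * normv w.
Proof.
have E : \sum_k (form_coef1 k p * u 0 k + form_coef2 k p * w 0 k) =
    - 2^-1 * (dotv (crossv (phi p) (N p)) u + support p * dotv (crossv (phi p) (N p)) w).
  rewrite big_split/= -[X in X + _]/(dotv (form_field p) u) -[X in _ + X]/(dotv (support p *: form_field p) w).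
  by rewrite !dotvZl; ring.
have r0 : 0 <= r := le_trans (normv_ge0 _) (phi_r p).
have c1 : normv (crossv (phi p) (N p)) <= r.
  by apply: (le_trans (normv_crossv _ _)); rewrite gauss_norm mulr1; exact: phi_r.
have b z : `|dotv (crossv (phi p) (N p)) z| <= r * normv z.
  by apply: (le_trans (dotv_cauchy _ _)); rewrite ler_wpM2r// normv_ge0.
have b2 : `|support p * dotv (crossv (phi p) (N p)) w| <= r * (r * normv w).
  by rewrite normrM ler_pM//; exact: le_trans (support_le p) (phi_r p).
rewrite E normrM normrN (@gtr0_norm _ 2^-1) ?invr_gt0//.
have := ler_normD (dotv (crossv (phi p) (N p)) u) (support p * dotv (crossv (phi p) (N p)) w).
have := b u; rewrite expr2; lra.
Qed.

End immersed_surface.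

Lemma integral_zero_outside d (T : measurableType d) (R : realType) (m : {measure set T -> \bar R})
    (A B : set T) (f : T -> \bar R) : B `<=` A -> (forall x, A x -> ~ B x -> f x = 0%E) ->
  (\int[m]_(x in A) f x = \int[m]_(x in B) f x)%E.
Proof.
move=> BA f0; rewrite integral_mkcond [RHS]integral_mkcond; apply: eq_integral => x _.
rewrite !patchE; have [xB|xB] := boolP (x \in B).
  by rewrite mem_set//; apply: BA; exact: set_mem.
have [xA|//] := boolP (x \in A); apply: f0; first exact: set_mem.
by move=> h; move: xB; rewrite mem_set.
Qed.

(** * Green's formula on a patch *)

Section patch_green.
Context {R : realType} {M : oriented_surface R}.
Local Notation P := (plane R).
Local Notation PM := (measurableTypeR R * measurableTypeR R)%type.
Local Notation mu := (@lebesgue_measure R).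
Local Notation lam := (lebesgue_plane R).
Local Notation Q := (@unit_square R).
Implicit Types (i j : chart_index M) (z : P) (p : M).

Variables (a : @surface_patch R M) (F h : M -> R).
Hypotheses (FC : C1S F) (hC : C1S h).
Hypothesis F_far : forall z, Q z -> 1 / 2 <= `|z| -> F (psi a z) = 0.
Hypothesis F_out : forall p, ~ pdom a p -> F p = 0.

Local Notation f1 := (F \o psi a).
Local Notation h1 := (h \o psi a).

Let oQ : open Q. Proof. exact: open_unit_square. Qed.
Let f1C : C1 Q f1. Proof. exact: psi_C1. Qed.
Let h1C : C1 Q h1. Proof. exact: psi_C1. Qed.

Lemma near_refl_eq (g : P -> R) z : \near z, g z = g z.
Proof. by near=> y. Unshelve. all: by end_near. Qed.

Lemma br_zero_left (f g : P -> R) z : (\near z, f z = 0) -> br f g z = 0.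
Proof.
move=> f0; have -> : br f g z = br (fun=> 0) g z by apply: near_br; [exact: f0|exact: near_refl_eq].
by rewrite /br -!dxE -!dyE !derive_cst !mul0r subrr.
Qed.

Lemma br_far z : Q z -> 1 / 2 < `|z| -> br f1 h1 z = 0.
Proof.
move=> Qz zf; apply: br_zero_left.
have n1 := continuous_nbhs_gt (@norm_continuous R P z) zf.
have n2 := open_nbhs_nbhs (conj oQ Qz).
by apply: filterS2 n1 n2 => y yf Qy; apply: F_far => //; exact: ltW.
Qed.

Lemma square_in_unit z : `|z| <= 7 / 8 -> Q z.
Proof. by move=> zs; rewrite /unit_square /open_square/= subr0; apply: (le_lt_trans zs); lra. Qed.

Lemma box_in_unit (c : R) : c <= 7 / 8 -> (`[- c, c] `*` `[- c, c] : set P) `<=` Q.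
Proof.
move=> c1 z []; rewrite /= !in_itv/= => /andP[h1 h2] /andP[h3 h4]; apply: square_in_unit.
by rewrite prod_normE/= ge_max !ler_norml; apply/andP; split; apply/andP; split; lra.
Qed.

Let cbr : {in Q, continuous (br f1 h1)}. Proof. exact: br_C1_continuous. Qed.

Lemma br_bounded : exists C, forall z, Q z -> `|br f1 h1 z| <= C.
Proof.
have sub : (`[- (3 / 4), 3 / 4] `*` `[- (3 / 4), 3 / 4] : set P) `<=` Q by apply: box_in_unit; lra.
have [C C0 H] := box_bound sub cbr.
exists C => z Qz; have [zf|zn] := ltP (1 / 2) `|z|; first by rewrite br_far// normr0.
have : (`|z.1| <= 1 / 2) && (`|z.2| <= 1 / 2) by rewrite -ge_max; move: zn; rewrite prod_normE.
move=> /andP[z1 z2]; rewrite [X in br _ _ X]surjective_pairing.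
by apply: H; rewrite in_itv/= -ler_norml; lra.
Qed.

Let mQ : measurable (Q : set PM). Proof. exact: open_measurable_plane. Qed.

Lemma lam_Q_fin : (lam Q < +oo)%E.
Proof.
have -> : Q = (`]-1, 1[%classic `*` `]-1, 1[%classic : set PM).
  apply/seteqP; split => z; [move/unit_squareE => [] |move=> [] ]; rewrite /= !in_itv/=.
    by rewrite !ltr_norml => -> ->.
  by move=> z1 z2; apply/unit_squareE; rewrite !ltr_norml.
rewrite lebesgue_plane_box; [|exact: measurable_itv|exact: measurable_itv].
by rewrite !lebesgue_measure_itv/= ifT ?lte_fin -?EFinM ?ltry//; lra.
Qed.

Lemma br_measurable (A : set PM) : measurable A -> A `<=` Q -> measurable_fun A (br f1 h1 : PM -> R).
Proof.
move=> mA AQ; apply: (measurable_funS mQ AQ); exact: continuous_measurable_plane.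
Qed.

Lemma br_integrable (A : set PM) : measurable A -> A `<=` Q -> lam.-integrable A (fun z => (br f1 h1 z)%:E).
Proof.
move=> mA AQ; have [C H] := br_bounded; apply: (@integrable_plane _ _ _ C) => //.
- by apply: le_lt_trans lam_Q_fin; apply: le_measure; rewrite ?inE.
- exact: br_measurable.
- by move=> z /AQ; exact: H.
Qed.

(** Coefficients vanish beyond radius 1/2, so they are null on the sides at distance 3/4, and
    heights up to 7/8 leave the margin required by Green's formula inside the unit square. *)
Definition core_interval : set R := `[- (3 / 4), 3 / 4]%classic.
Definition lower_core (s : R) : set PM := `[- (3 / 4), 3 / 4]%classic `*` `[- (3 / 4), s]%classic.

Let green s1 : - (3 / 4) < s1 -> s1 <= 3 / 4 ->
  (\int[lam]_(z in lower_core s1) (br f1 h1 z)%:E =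
   (- \int[mu]_(x in core_interval) (f1 (x, s1) * dx h1 (x, s1)))%:E)%E.
Proof.
move=> s1l s1u.
have far (x s : R) : `|x| <= 7 / 8 -> `|s| <= 7 / 8 -> 3 / 4 <= `|x| \/ 3 / 4 <= `|s| -> f1 (x, s) = 0.
  move=> x1 s2 xs; apply: F_far.
    by apply: square_in_unit; rewrite prod_normE/= ge_max x1 s2.
  by rewrite prod_normE/= le_max; apply/orP; case: xs => ?; [left|right]; lra.
have n34 : `|3 / 4 : R| = 3 / 4 by rewrite ger0_norm//; lra.
apply: (@green_box R Q (- (3 / 4)) (3 / 4) (- (7 / 8)) (- (3 / 4)) s1 (7 / 8) f1 h1 oQ) => //; try lra.
- move=> z []; rewrite /= !in_itv/= => /andP[z1 z2] /andP[z3 z4]; apply: (@box_in_unit (7 / 8)) => //.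
  by split; rewrite /= in_itv/=; apply/andP; split; lra.
- move=> s; rewrite in_itv/= => sI; have s7 : `|s| <= 7 / 8 by rewrite ler_norml.
  by split; apply: far; rewrite ?normrN ?n34//; try lra; left.
- move=> x; rewrite in_itv/= => xI; have x7 : `|x| <= 7 / 8 by rewrite ler_norml; move: xI => /andP[? ?]; apply/andP; split; lra.
  by apply: far; rewrite ?normrN ?n34//; try lra; right.
Qed.

Let br_outside z : (3 / 4 < `|z.1| \/ 3 / 4 < `|z.2|) -> Q z -> br f1 h1 z = 0.
Proof.
by move=> zf Qz; apply: br_far => //; rewrite prod_normE/= lt_max; apply/orP; case: zf => ?; [left|right]; lra.
Qed.

Lemma patch_green_one (U : set M) : one_sided U a ->
  (\int[lam]_(z in Q `&` psi a @^-1` U) (br f1 h1 z)%:E = 0)%E.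
Proof.
move=> [Ua|Ua]; last first.
  have -> : Q `&` psi a @^-1` U = set0 by apply/seteqP; split => // z [/Ua].
  by rewrite integral_set0.
have -> : Q `&` psi a @^-1` U = Q by apply/seteqP; split => [z []//|z Qz]; split => //; exact: Ua.
rewrite (@integral_zero_outside _ _ _ _ _ (lower_core (3 / 4))); last 2 first.
- by apply: box_in_unit; lra.
- move=> z Qz zn; congr EFin; apply: br_outside Qz.
  have [z1|z1] := ltP (3 / 4) `|z.1|; first by left.
  right; rewrite ltNge; apply/negP => z2; apply: zn.
  by split; rewrite /= in_itv/= -ler_norml.
rewrite green; [|lra|lra].
rewrite /Rintegral integral0_eq ?oppr0// => x; rewrite /core_interval /= in_itv/= => xI; congr EFin.
rewrite F_far ?mul0r//.
  by apply: square_in_unit; rewrite prod_normE/= ge_max !ler_norml; move: xI => /andP[? ?]; apply/andP; split; apply/andP; split; lra.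
by rewrite prod_normE/= le_max (@ger0_norm _ (3 / 4)); [apply/orP; right; lra|lra].
Qed.

(** U is the open lower half of the square. Adding the segment of height 0, which has measure zero,
    gives a closed rectangle where only the top side contributes. *)
Lemma patch_green_two (U : set M) : two_sided U a ->
  (\int[lam]_(z in Q `&` psi a @^-1` U) (br f1 h1 z)%:E =
   (- \int[mu]_(x in core_interval) (f1 (x, 0) * dx h1 (x, 0)))%:E)%E.
Proof.
move=> Ua; rewrite -green; [|lra|lra].
set B := lower_core 0.
pose N : set PM := `[- (3 / 4), 3 / 4]%classic `*` `[0, 0]%classic.
have mB : measurable B by apply: measurableX; exact: measurable_itv.
have mN : measurable N by apply: measurableX; exact: measurable_itv.
have BQ : B `<=` Q.
  move=> z []; rewrite /= !in_itv/= => /andP[z1 z2] /andP[z3 z4]; apply: (@box_in_unit (7 / 8)) => //.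
  by split; rewrite /= in_itv/=; apply/andP; split; lra.
rewrite (negligible_integral mN mB); last 2 first.
- exact: br_integrable.
- rewrite lebesgue_plane_box; [|exact: measurable_itv|exact: measurable_itv].
  by rewrite !lebesgue_measure_itv/= ltxx mule0.
apply: integral_zero_outside.
  move=> z [Bz Nz]; split; [exact: BQ|apply/(Ua z (BQ _ Bz))].
  move: Bz => [b1]; rewrite /= !in_itv/= => /andP[b2 b3].
  rewrite lt_neqAle b3 andbT; apply/eqP => z0; apply: Nz.
  by split => //; rewrite /= in_itv/= z0 lexx.
move=> z [Qz /(Ua z Qz) zneg] zn; congr EFin; apply: br_outside Qz.
have [z1|z1] := ltP (3 / 4) `|z.1|; first by left.
right; rewrite ltNge; apply/negP => z2; apply: zn.
move: z2; rewrite ler_norml => /andP[z2 z3].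
split; first by split; rewrite /= in_itv/= -?ler_norml// z2 ltW.
by move=> [_]; rewrite /= in_itv/= => /andP[]; rewrite leNgt zneg.
Qed.

Lemma F_core p : ~ pcore a p -> F p = 0.
Proof.
move=> pc; have [pa|] := pselect (pdom a p); last exact: F_out.
have [Qx xE] := xiP pa; rewrite -xE; apply: F_far => //.
rewrite leNgt; apply/negP => h'; apply: pc; exists (xi a p) => //; exact: ltW.
Qed.

Lemma br_chart_far j y : chart_codom j y -> ~ pcod a j y -> br (F \o param j) (h \o param j) y = 0.
Proof.
move=> yj ya; apply: br_zero_left.
pose O := chart_codom j `&` param j @^-1` (~` pcore a).
have oO : open O.
  apply: (open_preimage_in (@chart_codom_open _ _ j)); first exact: param_cont.
  exact/closed_openC/pcore_closed.
have Oy : O y.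
  split => // -[z /half_square_unit Qz zE]; apply: ya; split => //.
  by rewrite /preimage/= -zE; have [] := psiP a Qz.
by apply: filterS (open_nbhs_nbhs (conj oO Oy)) => w [_ wc]; exact: F_core.
Qed.

Lemma psi_preimage j (A : set M) : A `<=` dom j ->
  Q `&` psi a @^-1` A = pzone a j `&` ptrans a j @^-1` (chart j @` A).
Proof.
move=> Aj; apply/seteqP; split => [z [Qz Az]|z [[Qz zj] [p Ap pE]]].
  by split; [split => //; exact: Aj|exists (psi a z)].
split => //; rewrite /preimage/=.
have -> : psi a z = p; last by [].
by rewrite -(chartK zj) -[chart j _]/(ptrans a j z) -pE chartK//; exact: Aj.
Qed.

Lemma psi_preimage_measurable j (A : set M) : A `<=` dom j -> measurable (chart j @` A : set PM) ->
  measurable (Q `&` psi a @^-1` A : set PM).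
Proof.
move=> Aj mA; rewrite (psi_preimage Aj).
have mF : measurable_fun (pzone a j : set PM) (ptrans a j : PM -> PM).
  apply: continuous_map_measurable_plane; first exact: pzone_open.
  exact: C1map_continuous (@ptrans_C1 _ _ a j).
by apply: mF => //; apply: open_measurable_plane; exact: pzone_open.
Qed.

Lemma psign_abs (x : R) : 0 < psign a * x -> `|x| = psign a * x.
Proof.
move=> p0; rewrite -(gtr0_norm p0) normrM.
have : `|psign a| * `|psign a| = 1 by rewrite -normrM psign2 normr1.
move=> /eqP; rewrite -expr2 sqrf_eq1 => /orP[/eqP ->|/eqP h']; first by rewrite mul1r.
by have := normr_ge0 (psign a); rewrite h' => ?; lra.
Qed.

(** The bracket is pulled back with the signed Jacobian determinant and the measure with its
    absolute value, whence the factor [psign]. The part of [A] outside the patch contributes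
    nothing, the coefficient being zero near each of its points. *)
Lemma transfer j (A : set M) : A `<=` dom j -> measurable (chart j @` A : set PM) ->
  lam.-integrable (chart j @` A) (fun y => (br (F \o param j) (h \o param j) y)%:E) /\
  (\int[lam]_(y in chart j @` A) (br (F \o param j) (h \o param j) y)%:E =
   \int[lam]_(z in Q `&` psi a @^-1` A) (psign a * br f1 h1 z)%:E)%E.
Proof.
move=> Aj mA; set E : set PM := chart j @` A; set g := br (F \o param j) (h \o param j).
have EC : E `<=` chart_codom j by move=> _ [p Ap <-]; exact/chart_codomP/Aj.
have moC : measurable (chart_codom j : set PM) by apply: open_measurable_plane; exact: chart_codom_open.
have mg : measurable_fun E (g : PM -> R).
  have cg := br_C1_continuous (@FC j) (@hC j).
  exact: (measurable_funS moC EC (continuous_measurable_plane (@chart_codom_open _ _ j) cg)).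
have mP : measurable (pcod a j : set PM) by apply: open_measurable_plane; exact: pcod_open.
pose E' := E `&` pcod a j; have mE' : measurable (E' : set PM) by exact: measurableI.
have E'P : E' `<=` pcod a j by move=> y [].
have E'E : E' `<=` E by move=> y [].
have g0 y : E y -> ~ E' y -> g y = 0.
  by move=> Ey nE'; apply: br_chart_far; [exact: EC|move=> ya; exact: nE'].
have mgE' : measurable_fun E' (g : PM -> R) by exact: measurable_funS mg.
have J0 z : pzone a j z -> jac (ptrans a j) z != 0.
  by move=> /ptrans_jac; apply: contraTneq => ->; rewrite mulr0 ltxx.
have cv_abs := ge0_change_of_variables (@pzone_open _ _ a j) (@pcod_open _ _ a j) (@ptrans_C1 _ _ a j) J0
  (@pback_continuous _ _ a j) (@ptransP _ _ a j) (@pbackP _ _ a j) mE' E'P.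
have [_ cv] := integral_change_of_variables (@pzone_open _ _ a j) (@pcod_open _ _ a j) (@ptrans_C1 _ _ a j) J0
  (@pback_continuous _ _ a j) (@ptransP _ _ a j) (@pbackP _ _ a j) mE' E'P mgE'.
have setE : pzone a j `&` ptrans a j @^-1` E' = Q `&` psi a @^-1` A.
  rewrite (psi_preimage Aj); apply/seteqP; split => z [z1 z2]; split => //; first by case: z2.
  by split => //; have [] := ptransP z1.
have mS := psi_preimage_measurable Aj mA.
have pE z : pzone a j z -> g (ptrans a j z) * `|jac (ptrans a j) z| = psign a * br f1 h1 z.
  move=> zj; have [[tj _] _] := ptransP zj.
  rewrite (br_psi zj (diffC1 (@FC j) tj) (diffC1 (@hC j) tj)) (psign_abs (ptrans_jac zj)) -/g.
  by ring.
have psign1 : `|psign a| = 1.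
  have := psign_abs (ltac:(by rewrite psign2) : 0 < psign a * psign a).
  by rewrite psign2.
have pN z : pzone a j z -> `|g (ptrans a j z)| * `|jac (ptrans a j) z| = `|br f1 h1 z|.
  by move=> /pE /(congr1 (fun x : R => `|x|)); rewrite !normrM normr_id psign1 mul1r.
split; last first.
  rewrite (integral_zero_outside _ E'E); last by move=> y Ey nE'; rewrite g0.
  by rewrite cv setE; apply: eq_integral => z; rewrite inE (psi_preimage Aj) => -[zj _]; rewrite pE.
apply/integrableP; split; first exact/measurable_EFinP.
rewrite (integral_zero_outside _ E'E); last by move=> y Ey nE'; rewrite g0//= normr0.
rewrite cv_abs//; last by apply: measurableT_comp => //; exact/measurable_EFinP.
rewrite setE.
have /integrableP[_] := br_integrable mS (@subIsetl _ _ _).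
apply: le_lt_trans; rewrite le_eqVlt; apply/orP; left; apply/eqP; apply: eq_integral => z.
rewrite inE (psi_preimage Aj) => -[zj _].
exact: (congr1 EFin (pN z zj)).
Qed.

End patch_green.

(** * The length of the boundary *)

Section edges.
Context {R : realType} {M : oriented_surface R}.
Local Notation P := (plane R).
Local Notation Q := (@unit_square R).
Local Notation e0 := (plane_basis R 0).
Variable U : set M.
Hypothesis oU : open U.
Implicit Types (a b : @surface_patch R M) (p : M) (s t : R).

Lemma is_derive_near_unique (f g : R -> R) s (d d' : R) : (\near s, f s = g s) ->
  is_derive s 1 f d -> is_derive s 1 g d' -> d = d'.
Proof. by move=> n [_ <-] [_ <-]; exact: near_eq_derive. Qed.

Definition edge a t : M := psi a (t, 0).
Definition coedge a p : R := (xi a p).1.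

Lemma edge_in t : `|t| < 1 -> Q (t, 0).
Proof. by move=> t1; apply/unit_squareE; rewrite /= normr0. Qed.

Lemma coedge_edge a t : `|t| < 1 -> pdom a (edge a t) /\ coedge a (edge a t) = t.
Proof. by move=> /edge_in /(psiP a)[h1 h2]; rewrite /coedge /edge h2. Qed.

Lemma edge_boundary a t : two_sided U a -> `|t| < 1 -> boundary U (edge a t).
Proof.
move=> Ua t1; have Qt := edge_in t1; split; last first.
  by move=> /interior_subset /(Ua _ Qt); rewrite /= ltxx.
move=> B nB.
have c : {for (t, 0), continuous (psi a)} by apply: psi_continuous; rewrite inE.
have cB : nbhs ((t, 0) : P) (psi a @^-1` B) := c _ nB.
have nQ : nbhs ((t, 0) : P) (psi a @^-1` B `&` Q).
  exact: filterI cB (open_nbhs_nbhs (conj (@open_unit_square R) Qt)).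
move/nbhs_ballP : nQ => [e /= e0 He].
have [h1 h2] : (psi a @^-1` B `&` Q) (t, - (e / 2)).
  apply: He; rewrite -ball_normE/= prod_normE/= subrr normr0 sub0r opprK gt_max e0/=.
  by rewrite ger0_norm; lra.
by exists (psi a (t, - (e / 2))); split => //; apply/(Ua _ h2) => /=; lra.
Qed.

(** A negative second coordinate would put the point in the open set U, a positive one outside its
    closure. *)
Lemma boundary_edge a p : two_sided U a -> pdom a p -> boundary U p ->
  `|coedge a p| < 1 /\ edge a (coedge a p) = p.
Proof.
move=> Ua ap [clU nU]; have [Qx xE] := xiP ap.
have h0 : 0 <= (xi a p).2.
  rewrite leNgt; apply/negP => h; apply: nU; apply: open_nbhs_nbhs; split => //.
  by rewrite -xE; apply/(Ua _ Qx).
have h1 : (xi a p).2 <= 0.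
  rewrite leNgt; apply/negP => h.
  have c : {for p, continuous (snd \o xi a)}.
    by apply: continuous_comp; [apply: xi_continuous; rewrite inE|exact: cvg_snd].
  have n1 := continuous_nbhs_gt c h.
  have [q [Uq [q1 q2]]] := clU _ (filterI n1 (open_nbhs_nbhs (conj (@pdom_open _ _ a) ap))).
  have [Qq qE] := xiP q2; move: Uq; rewrite -qE => /(Ua _ Qq) /(lt_trans q1).
  by rewrite ltxx.
have E : xi a p = (coedge a p, 0).
  by rewrite /coedge {1}(surjective_pairing (xi a p)); congr pair; apply/eqP; rewrite eq_le h0 h1.
split; first by have [] := (unit_squareE (xi a p)).1 Qx.
by rewrite /edge -E.
Qed.

Section two_edges.
Variables a b : @surface_patch R M.
Hypotheses (Ua : two_sided U a) (Ub : two_sided U b).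

(** The parameters on the edge of [b] whose point lies in the patch [a]; [reparam] converts them
    into parameters on the edge of [a]. *)
Definition overlap : set R := [set s | `|s| < 1 /\ pdom a (edge b s)].
Definition reparam s : R := coedge a (edge b s).
Definition dreparam s : R := dx (fst \o (xi a \o psi b)) (s, 0).

Let O : set P := Q `&` psi b @^-1` pdom a.
Let oO : open O.
Proof.
apply: (open_preimage_in (@open_unit_square R) _ (@pdom_open _ _ a)); exact: psi_continuous.
Qed.

Let CO : C1map O (xi a \o psi b).
Proof.
have [m1 m2] := @patch_map_C1 _ _ b.
have mC : C1map O (patch_map b) by split; [apply: C1_sub m1 => z []|apply: C1_sub m2 => z []].
apply: (C1map_comp oO mC (@pback_C1map _ _ a (pchart b))) => z [Qz za].
by split => //; apply: pimage_codom; have [] := patch_mapP b Qz.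
Qed.

Lemma overlap_open : open overlap.
Proof.
have -> : overlap = (fun s => (s, 0) : P) @^-1` O.
  apply/seteqP; split => s [h1 h2]; split => //; first exact: edge_in.
  by have [] := (unit_squareE (s, 0)).1 h1.
apply: open_comp => // s _.
by apply: (@continuous_pair R R R id (cst 0) s); [exact: cvg_id|exact: cvg_cst].
Qed.

Lemma reparam_derive s : overlap s ->
  is_derive s 1 reparam (dreparam s) /\ {for s, continuous dreparam}.
Proof.
move=> [s1 sa]; have Os : O (s, 0) by split => //; exact: edge_in.
have [F1 _] := CO; split; first exact: is_derive_slice_x (diffC1 F1 Os).
by apply: continuous_slice_x; apply: (C1_dx F1); rewrite inE.
Qed.

Lemma reparamP s : overlap s -> [/\ `|reparam s| < 1, edge a (reparam s) = edge b s & pdom b (edge a (reparam s))].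
Proof.
move=> [s1 sa]; have [h1 h2] := boundary_edge Ua sa (edge_boundary Ub s1).
by split => //; rewrite h2; have [] := coedge_edge b s1.
Qed.

End two_edges.

Lemma reparamK a b s : two_sided U a -> two_sided U b -> overlap a b s ->
  overlap b a (reparam a b s) /\ reparam b a (reparam a b s) = s.
Proof.
move=> Ua Ub sI; have [h1 h2 h3] := reparamP Ua Ub sI; have [s1 _] := sI.
by split; [split|rewrite {1}/reparam h2; have [] := coedge_edge b s1].
Qed.

(** The two reparametrizations are inverse to each other, so the chain rule makes the product of
    their derivatives 1. *)
Lemma dreparam_neq0 a b s : two_sided U a -> two_sided U b -> overlap a b s -> dreparam a b s != 0.
Proof.
move=> Ua Ub sI; have [tI _] := reparamK Ua Ub sI.
have [d1 _] := reparam_derive sI; have [d2 _] := reparam_derive tI.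
have dc := is_derive1_comp d2 d1.
have n : \near s, (reparam b a \o reparam a b) s = id s.
  apply: filterS (open_nbhs_nbhs (conj (@overlap_open a b) sI)) => u uI /=.
  by have [] := reparamK Ua Ub uI.
have := is_derive_near_unique n dc (is_derive_id _ _).
by apply: contra_eqN => /eqP ->; rewrite mulr0 eq_sym oner_eq0.
Qed.

Section edge_speed.
Variable Z : M -> 'rV[R]_3.
Hypothesis ZC : forall k, C1S (fun p => Z p 0 k).

Definition edge_speed a t := normv (D3 e0 (Z \o psi a) (t, 0)).

Lemma edge_C13 a : C13 Q (Z \o psi a).
Proof. by move=> k; exact: (psi_C1 a (@ZC k)). Qed.

Lemma edge_speed_continuous a t : `|t| < 1 -> {for t, continuous (edge_speed a)}.
Proof.
move=> /edge_in Qt.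
have c k : {for t, continuous (fun t => D3 e0 (Z \o psi a) (t, 0) 0 k)}.
  have -> : (fun t => D3 e0 (Z \o psi a) (t, 0) 0 k) =
      (fun t => dx (fun y => (Z \o psi a) y 0 k) (t, 0)) by apply/funext => u; rewrite D3_coord dxE.
  by apply: continuous_slice_x; apply: (C1_dx (@edge_C13 a k)); rewrite inE.
pose D t := D3 e0 (Z \o psi a) (t, 0).
apply: (@continuous_comp _ _ _ (fun t => dotv (D t) (D t)) Num.sqrt); last exact: sqrt_continuous.
have -> : (fun t => dotv (D t) (D t)) = (fun t => D t 0 (inord 0) * D t 0 (inord 0) +
    D t 0 (inord 1) * D t 0 (inord 1) + D t 0 (inord 2) * D t 0 (inord 2)).
  by apply/funext => u; rewrite dotvE.
by do 2?[apply: continuousD]; apply: continuousM; exact: c.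
Qed.

Lemma edge_speed_reparam a b s : two_sided U a -> two_sided U b -> overlap a b s ->
  edge_speed b s = edge_speed a (reparam a b s) * `|dreparam a b s|.
Proof.
move=> Ua Ub sI; have [s1 _] := sI; have [h1 h2 h3] := reparamP Ua Ub sI.
have [dr _] := reparam_derive sI.
rewrite /edge_speed mulrC -normvZ; congr normv; apply/rowP => k.
rewrite rowZ !D3_coord !dxE.
have da := is_derive_slice_x (diffC1 (@edge_C13 a k) (edge_in h1)).
have db := is_derive_slice_x (diffC1 (@edge_C13 b k) (edge_in s1)).
have dc := is_derive1_comp da dr.
have n : \near s, ((fun t => (Z \o psi a) (t, 0) 0 k) \o reparam a b) s = (Z \o psi b) (s, 0) 0 k.
  apply: filterS (open_nbhs_nbhs (conj (@overlap_open a b) sI)) => u uI /=.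
  by have [_ e _] := reparamP Ua Ub uI; rewrite -[psi a _]/(edge a (reparam a b u)) e.
by rewrite -(is_derive_near_unique n dc db) mulrC.
Qed.

End edge_speed.
End edges.

(** * Integrals over finite disjoint unions *)

Section finite_unions.
Context d (T : measurableType d) (R : realType) (m : {measure set T -> \bar R}) (I : finType).
Implicit Types (F : I -> set T).

Lemma bigsetU_fin F : \big[setU/set0]_(i <- index_enum I) F i = \bigcup_i F i.
Proof.
rewrite -bigcup_seq; apply/seteqP; split => [x [i _ Fx]|x [i _ Fx]]; first by exists i.
by exists i => //=; rewrite mem_index_enum.
Qed.

Lemma ge0_integral_fin_bigcup F (f : T -> \bar R) : (forall i, measurable (F i)) ->
  trivIset setT F -> measurable_fun (\bigcup_i F i) f -> (forall x, (\bigcup_i F i) x -> 0 <= f x)%E ->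
  (\int[m]_(x in \bigcup_i F i) f x = \sum_i \int[m]_(x in F i) f x)%E.
Proof.
rewrite -bigsetU_fin => mF tF mf f0.
by apply: ge0_integral_bigsetU => //; [exact: index_enum_uniq|exact: sub_trivIset tF].
Qed.

Lemma integral_fin_bigcup F (f : T -> R) : (forall i, measurable (F i)) ->
  trivIset setT F -> measurable_fun (\bigcup_i F i) f ->
  (\int[m]_(x in \bigcup_i F i) (f x)%:E = \sum_i \int[m]_(x in F i) (f x)%:E)%E.
Proof.
rewrite -bigsetU_fin => mF tF mf.
apply: integral_bigsetU_EFin => //; [exact: index_enum_uniq|exact: sub_trivIset tF|].
exact/measurable_EFinP.
Qed.

End finite_unions.

(** * Cutting the edges into disjoint pieces *)

Section boundary_cells.
Context {R : realType} {M : oriented_surface R}.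
Local Notation P := (plane R).
Local Notation mu := (@lebesgue_measure R).
Variable U : set M.
Hypothesis oU : open U.
Variables (m : nat) (a : 'I_m -> @surface_patch R M) (chi : 'I_m -> M -> R).
Hypotheses (chiC : forall k, C1S (chi k)) (chi0 : forall k p, 0 <= chi k p)
  (chi1 : forall p, \sum_k chi k p = 1).
Variable Z : M -> 'rV[R]_3.
Hypothesis ZC : forall k, C1S (fun p => Z p 0 k).
Implicit Types (k b : 'I_m) (s t : R).

Definition short_interval : set R := [set t | `|t| < 1 / 2].

Lemma open_abs_lt (c : R) : open [set t : R | `|t| < c].
Proof.
have -> : [set t : R | `|t| < c] = ball (0 : R) c.
  by apply/seteqP; split => t; rewrite -ball_normE/= sub0r normrN.
exact: ball_open.
Qed.

Lemma short_lt1 t : `|t| <= 1 / 2 -> `|t| < 1.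
Proof. by move=> h; apply: (le_lt_trans h); lra. Qed.

Definition closed_edge k : set M := edge (a k) @` [set t | `|t| <= 1 / 2].

Lemma edge_continuous k t : `|t| < 1 -> {for t, continuous (edge (a k))}.
Proof.
move=> t1; apply: (@continuous_comp _ _ _ (fun t => (t, 0) : P) (psi (a k))).
  by apply: (@continuous_pair R R R id (cst 0) t); [exact: cvg_id|exact: cvg_cst].
by apply: psi_continuous; rewrite inE; exact: edge_in.
Qed.

Lemma closed_edge_closed k : closed (closed_edge k).
Proof.
apply: (compact_closed (@surface_hausdorff _ M)); apply: continuous_compact.
  by apply: continuous_in_subspaceT => t /set_mem /short_lt1; exact: edge_continuous.
have -> : [set t : R | `|t| <= 1 / 2] = `[- (1 / 2), 1 / 2]%classic.
  by apply/seteqP; split => t; rewrite /= in_itv/= ler_norml.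
exact: segment_compact.
Qed.

(* Only the fresh parts of the edges are disjoint, as the supremum defining the boundary length requires;
   up to finitely many points they still exhaust the edges. *)
Definition fresh b : set R := [set t | [/\ two_sided U (a b), `|t| < 1 / 2 &
  forall k, (k < b)%N -> two_sided U (a k) -> ~ closed_edge k (edge (a b) t)]].

Lemma fresh_open b : open (fresh b).
Proof.
have [Ub|Ub] := pselect (two_sided U (a b)); last first.
  have -> : fresh b = set0 by apply/seteqP; split => // t [].
  exact: open0.
pose O := \bigcup_(k in [set k : 'I_m | (k < b)%N /\ two_sided U (a k)]) closed_edge k.
have cO : closed O.
  by apply: closed_bigcup => [|k _]; [exact: finite_finset|exact: closed_edge_closed].
have -> : fresh b = short_interval `&` edge (a b) @^-1` (~` O).
  apply/seteqP; split => t.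
    by move=> [_ t1 h]; split => // -[k [kb Uk]]; exact: h.
  by move=> [t1 h]; split => // k kb Uk kt; apply: h; exists k.
apply: open_preimage_in; [exact: open_abs_lt| |exact: closed_openC].
by move=> t; rewrite inE => /ltW/short_lt1; exact: edge_continuous.
Qed.

(** The part of the [k]-th edge that lies on the fresh part of the [b]-th one, in the parameter of
    the [k]-th. *)
Definition cell k b : set R := [set t | [/\ `|t| < 1 / 2, overlap (a b) (a k) t &
  fresh b (reparam (a b) (a k) t)]].

Lemma cell_open k b : open (cell k b).
Proof.
have -> : cell k b = (short_interval `&` overlap (a b) (a k)) `&` reparam (a b) (a k) @^-1` fresh b.
  by apply/seteqP; split => t; [move=> [h1 h2 h3]|move=> [[h1 h2] h3]].
apply: open_preimage_in; [|move=> t|exact: fresh_open].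
  by apply: openI; [exact: open_abs_lt|exact: overlap_open].
rewrite inE => -[_ tI]; have [[d _] _] := reparam_derive tI.
exact/differentiable_continuous/derivable1_diffP.
Qed.

Lemma cell_two_sided k b t : cell k b t -> two_sided U (a b).
Proof. by move=> [_ _ []]. Qed.

Lemma cell_edge k b t : two_sided U (a k) -> cell k b t ->
  fresh b (reparam (a b) (a k) t) /\ edge (a b) (reparam (a b) (a k) t) = edge (a k) t.
Proof.
move=> Uk tc; have Ub := cell_two_sided tc; have [_ tI h] := tc.
by have [_ h2 _] := reparamP oU Ub Uk tI.
Qed.

Lemma cell_trivIset k : two_sided U (a k) -> trivIset setT (cell k).
Proof.
move=> Uk; have H b b' t : (b < b')%N -> cell k b t -> cell k b' t -> False.
  move=> bb' tb tb'; have [[Ub s1 _] e1] := cell_edge Uk tb; have [[_ _ n] e2] := cell_edge Uk tb'.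
  apply: (n b bb' Ub); rewrite e2 -e1; exists (reparam (a b) (a k) t) => //; exact: ltW.
apply/trivIsetP => b b' _ _ bb'; apply/seteqP; split => // t [tb tb'].
have : (b < b')%N || (b' < b)%N by rewrite -neq_ltn.
by move=> /orP[h|h]; [case: (H b b' t h tb tb')|case: (H b' b t h tb' tb)].
Qed.

(* Where an endpoint of another edge falls on the [k]-th edge: the cells cover all the other points. *)
Definition corners k : set R :=
  (fun x : 'I_m * bool => coedge (a k) (edge (a x.1) ((-1) ^+ x.2 * (1 / 2)))) @` setT.

Lemma corners_countable k : countable (corners k).
Proof. by apply: finite_set_countable; apply: finite_image; exact: finite_finset. Qed.

(** Take the least [b] whose closed edge contains the point. It is not an endpoint of that edge, [t]
    being no corner, and no earlier edge contains it; so it is fresh for [b]. *)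
Lemma cell_cover k t : two_sided U (a k) -> `|t| < 1 / 2 -> ~ corners k t -> exists b, cell k b t.
Proof.
move=> Uk t2 tn; have t1 := short_lt1 (ltW t2).
have [kd kE] := coedge_edge (a k) t1.
pose good b := two_sided U (a b) /\ closed_edge b (edge (a k) t).
have gk : `[< good k >] by apply/asboolP; split => //; exists t => //; exact: ltW.
have [b /asboolP[Ub [s s2 sE]] bmin] :=
  @arg_minnP _ k (fun b => `[< good b >]) (fun b : 'I_m => nat_of_ord b) gk.
have s1 := short_lt1 s2.
have [bd bE] := coedge_edge (a b) s1.
have tI : overlap (a b) (a k) t by split => //; rewrite -sE.
have rE : reparam (a b) (a k) t = s by rewrite /reparam -sE.
exists b; split => //; rewrite rE; split => //.
  rewrite lt_neqAle s2 andbT; apply/eqP => s3; apply: tn.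
  (* The boolean selects the endpoint: (-1) to the power [s < 0] is the sign of [s], here of
     absolute value 1/2. *)
  exists (b, s < 0) => //=; rewrite -[in RHS]kE -sE; congr (coedge _ (edge _ _)).
  by rewrite {2}(realEsign (num_real s)) s3.
move=> l lb Ul le; have : (b <= l)%N.
  by apply: bmin; apply/asboolP; split => //; rewrite -sE.
by rewrite leqNgt lb.
Qed.

Definition edge_density k t := chi k (edge (a k) t) * edge_speed Z (a k) t.

Lemma edge_density_ge0 k t : 0 <= edge_density k t.
Proof. by rewrite mulr_ge0// normv_ge0. Qed.

Lemma chi_edge_continuous k b t : `|t| < 1 -> {for t, continuous (fun t => chi k (edge (a b) t))}.
Proof.
move=> t1; apply: (@continuous_slice_x R (chi k \o psi (a b))).
by apply: (C1_continuous (psi_C1 (a b) (@chiC k))); rewrite inE; exact: edge_in.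
Qed.

Lemma weighted_measurable k b (A : set R) : measurable A -> A `<=` short_interval ->
  measurable_fun A (fun t => (chi k (edge (a b) t) * edge_speed Z (a b) t)%:E).
Proof.
move=> mA As; apply/measurable_EFinP.
apply: (@measurable_funS _ _ _ _ short_interval) => //.
  by apply: open_measurable; exact: open_abs_lt.
apply: open_continuous_measurable_fun; first exact: open_abs_lt.
move=> t; rewrite inE => /ltW /short_lt1 t1; apply: continuousM; first exact: chi_edge_continuous.
exact: edge_speed_continuous.
Qed.

Lemma speed_measurable b (A : set R) : measurable A -> A `<=` short_interval ->
  measurable_fun A (fun t => (edge_speed Z (a b) t)%:E).
Proof.
move=> mA As; apply/measurable_EFinP.
apply: (@measurable_funS _ _ _ _ short_interval) => //.
  by apply: open_measurable; exact: open_abs_lt.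
apply: open_continuous_measurable_fun; first exact: open_abs_lt.
by move=> t; rewrite inE => /ltW /short_lt1 t1; exact: edge_speed_continuous.
Qed.

(** The cells miss at most the corners, which are finitely many and of measure zero. *)
Lemma cell_decomposition k : two_sided U (a k) ->
  (\int[mu]_(t in short_interval) (edge_density k t)%:E <=
   \sum_b \int[mu]_(t in cell k b) (edge_density k t)%:E)%E.
Proof.
move=> Uk; have mc b : measurable (cell k b) by apply: open_measurable; exact: cell_open.
have cs b : cell k b `<=` short_interval by move=> t [].
have mU : measurable (\bigcup_b cell k b) by exact: fin_bigcup_measurable.
have Us : \bigcup_b cell k b `<=` short_interval by move=> t [b _ /cs].
have mS : measurable short_interval by apply: open_measurable; exact: open_abs_lt.
have mN : measurable (corners k : set (measurableTypeR R)).
  by apply: countable_measurable; [exact: measurable_set1|exact: corners_countable].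
rewrite -ge0_integral_fin_bigcup//; last 3 first.
- exact: cell_trivIset.
- exact: weighted_measurable.
- by move=> t _; rewrite lee_fin edge_density_ge0.
rewrite [leLHS](ge0_negligible_integral mN)//; last 3 first.
- exact: weighted_measurable.
- by move=> t _; rewrite lee_fin edge_density_ge0.
- by apply: countable_lebesgue_measure0; exact: corners_countable.
apply: ge0_subset_integral => //.
- exact: measurableD.
- exact: weighted_measurable.
- by move=> t _; rewrite lee_fin edge_density_ge0.
- by move=> t [t2 tn]; have [b tb] := cell_cover Uk t2 tn; exists b.
Qed.

(** The cell is rewritten in the parameter of the [b]-th edge. The derivative of the
    reparametrization is absorbed by the speed, and the cell becomes a subset of the fresh part. *)
Lemma cell_change k b : two_sided U (a k) ->
  (\int[mu]_(t in cell k b) (edge_density k t)%:E <=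
   \int[mu]_(s in fresh b) (chi k (edge (a b) s) * edge_speed Z (a b) s)%:E)%E.
Proof.
move=> Uk; have r0 s : (0 <= (chi k (edge (a b) s) * edge_speed Z (a b) s)%:E)%E.
  by rewrite lee_fin mulr_ge0// normv_ge0.
have [Ub|Ub] := pselect (two_sided U (a b)); last first.
  have -> : cell k b = set0 by apply/seteqP; split => // t /cell_two_sided.
  by rewrite integral_set0 integral_ge0.
have mc : measurable (cell k b) by apply: open_measurable; exact: cell_open.
have mf : measurable (fresh b) by apply: open_measurable; exact: fresh_open.
have fs : fresh b `<=` short_interval by move=> t [].
have cs : cell k b `<=` short_interval by move=> t [].
have dt t : overlap (a k) (a b) t -> [/\ is_derive t 1 (reparam (a k) (a b)) (dreparam (a k) (a b) t),
    {for t, continuous (dreparam (a k) (a b))} & dreparam (a k) (a b) t != 0].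
  by move=> tI; have [h1 h2] := reparam_derive tI; split => //; exact: (dreparam_neq0 oU Uk Ub).
have cr : {in overlap (a b) (a k), continuous (reparam (a b) (a k))}.
  move=> t; rewrite inE => tI; have [[d _] _] := reparam_derive tI.
  exact/differentiable_continuous/derivable1_diffP.
have md : measurable_fun (cell k b) (edge_density k) by apply/measurable_EFinP; exact: weighted_measurable.
rewrite (@change_of_variables_line _ (overlap (a k) (a b)) (overlap (a b) (a k)) (cell k b)
  (reparam (a k) (a b)) (dreparam (a k) (a b)) (reparam (a b) (a k)) (edge_density k)) //; last 6 first.
- exact: overlap_open.
- exact: overlap_open.
- by move=> t tI; exact: (reparamK oU Uk Ub tI).
- by move=> t tI; exact: (reparamK oU Ub Uk tI).
- by move=> t [].
- by move=> t _; exact: edge_density_ge0.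
set A := _ `&` _.
have Af : A `<=` fresh b.
  by move=> s [sI [_ _ h]]; have [_ e] := reparamK oU Uk Ub sI; rewrite -e.
have mA : measurable A.
  apply: open_measurable; apply: open_preimage_in; [exact: overlap_open| |exact: cell_open].
  move=> t; rewrite inE => tI; have [[d _] _] := reparam_derive tI.
  exact/differentiable_continuous/derivable1_diffP.
apply: (@le_trans _ _ (\int[mu]_(s in A) (chi k (edge (a b) s) * edge_speed Z (a b) s)%:E)%E).
  rewrite le_eqVlt; apply/orP; left; apply/eqP; apply: eq_integral => s.
  rewrite inE => -[sI _]; have [_ e _] := reparamP oU Uk Ub sI.
  by rewrite /edge_density e -mulrA -(edge_speed_reparam oU ZC Uk Ub sI).
by apply: ge0_subset_integral => //; exact: weighted_measurable.
Qed.

(** Each weighted edge is distributed over the fresh parts; on a given fresh part the weights of all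
    [k] add up to 1, so that it is counted once. *)
Lemma boundary_weighted_le :
  (\sum_(k | `[< two_sided U (a k) >]) \int[mu]_(t in short_interval) (edge_density k t)%:E <=
   \sum_b \int[mu]_(s in fresh b) (edge_speed Z (a b) s)%:E)%E.
Proof.
have r0 k b s : (0 <= (chi k (edge (a b) s) * edge_speed Z (a b) s)%:E)%E.
  by rewrite lee_fin mulr_ge0// normv_ge0.
have mf b : measurable (fresh b) by apply: open_measurable; exact: fresh_open.
have fs b : fresh b `<=` short_interval by move=> t [].
apply: (@le_trans _ _ (\sum_k \sum_b \int[mu]_(s in fresh b) (chi k (edge (a b) s) * edge_speed Z (a b) s)%:E)%E).
  rewrite big_mkcond; apply: lee_sum => k _; case: ifPn => [/asboolP Uk|_].
    by apply: (le_trans (cell_decomposition Uk)); apply: lee_sum => b _; exact: cell_change.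
  by apply: sume_ge0 => b _; exact: integral_ge0.
rewrite exchange_big/=; apply: lee_sum => b _.
rewrite -ge0_integral_sum//; [|exact: mf|by move=> k; exact: weighted_measurable].
rewrite le_eqVlt; apply/orP; left; apply/eqP; apply: eq_integral => s _.
by rewrite sumEFin -mulr_suml chi1 mul1r.
Qed.

End boundary_cells.

(** An arc requires explicit finite endpoints; boundedness makes the infimum and the supremum
    available. The empty set is written ]0, 0[. *)
Lemma open_interval_oo (R : realType) (X : set R) (c : R) : open X -> is_interval X ->
  X `<=` [set t | `|t| < c] -> exists lo hi : R, X = `]lo, hi[%classic.
Proof.
move=> oX iX Xc; have [->|/set0P X0] := eqVneq X set0.
  by exists 0, 0; apply/seteqP; split => // t; rewrite /= in_itv/= => /andP[h1 /(lt_trans h1)]; rewrite ltxx.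
exists (inf X), (sup X).
have lb : has_lbound X by exists (- c) => t /Xc /=; rewrite ltr_norml => /andP[/ltW].
have ub : has_ubound X by exists c => t /Xc /=; rewrite ltr_norml => /andP[_ /ltW].
apply/seteqP; split => t.
  move=> Xt; have /nbhs_ballP[e /= e0 He] := open_nbhs_nbhs (conj oX Xt).
  have X1 : X (t - e / 2) by apply: He; rewrite -ball_normE/= opprB addrC subrK ger0_norm; lra.
  have X2 : X (t + e / 2) by apply: He; rewrite -ball_normE/= opprD addrA subrr sub0r normrN ger0_norm; lra.
  have h1 := ge_inf lb X1; have h2 := ub_le_sup ub X2.
  by rewrite /= in_itv/=; apply/andP; split; lra.
rewrite /= in_itv/= => /andP[/(inf_lt X0)[u Xu ut] /(sup_gt X0)[w Xw tw]].
by apply: (iX u w Xu Xw); rewrite !ltW.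
Qed.

(** * Fresh edges as families of arcs in the curve integrals *)

Section arcs.
Context {R : realType} {M : oriented_surface R} (g : riemannian_metric M).
Local Notation P := (plane R).
Local Notation mu := (@lebesgue_measure R).

Definition arc_integral (f : chart_index M -> plane R -> plane R -> R) (c : surface_arc M) : \bar R :=
  (\int[@lebesgue_measure R]_(t in `]arc_lo c, arc_hi c[)
     (let i := arc_chart c in
      let x := arc_fun c t in
      let v := 'D_1 (arc_fun c) t in
      let speed := Num.sqrt (g i x v v) in
      f i x (speed^-1 *: v) * speed)%:E)%E.

Lemma curve_integral_ge (S : set M) f (T : finType) (c : T -> surface_arc M) :
  (forall k, regular_simple_arc S (c k)) -> trivIset setT (fun k => arc_image (c k)) ->
  (\sum_k arc_integral f (c k) <= curve_integral g S f)%E.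
Proof.
move=> rc tc; apply: ereal_sup_ubound.
exists #|T|, (fun k => c (enum_val k)); split => //.
  apply/trivIsetP => k l _ _ kl; move/trivIsetP : tc; apply => //.
  by apply: contra kl => /eqP/enum_val_inj ->.
transitivity (\sum_(k in T) arc_integral f (c k))%E; first exact: eq_bigl.
exact: (big_enum_val (fun k => arc_integral f (c k))).
Qed.

Variable U : set M.
Hypothesis oU : open U.

Section one_arc.
Variables (a : @surface_patch R M) (lo hi : R).
Definition edge_arc : surface_arc M :=
  SurfaceArc (pchart a) lo hi (fun t => patch_map a (t, 0)).

Hypothesis inI : forall t, `]lo, hi[%classic t -> `|t| < 1 /\ two_sided U a.

Lemma edge_arc_image : arc_image edge_arc = edge a @` `]lo, hi[%classic.
Proof. by []. Qed.

Let k1 := fst \o patch_map a.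
Let k2 := snd \o patch_map a.

Lemma edge_arc_diff t : `|t| < 1 ->
  is_diff t (fun t => patch_map a (t, 0)) (fun v => (v * dx k1 (t, 0), v * dx k2 (t, 0)) : P).
Proof.
move=> /edge_in Qt; have [m1 m2] := @patch_map_C1 _ _ a.
have D (h : P -> R) : differentiable h (t, 0) -> is_diff t (fun t => h (t, 0)) (fun v => v * dx h (t, 0)).
  move=> dh; have [d1 d2] := is_derive_slice_x dh.
  have d1' : differentiable (fun t => h (t, 0)) t by exact/derivable1_diffP.
  apply: DiffDef => //; apply/funext => v; rewrite (diff1E d1') derive1E d2.
  by rewrite /GRing.scale/=.
have := is_diff_pair (D k1 (diffC1 m1 Qt)) (D k2 (diffC1 m2 Qt)).
by congr (is_diff _ _ _); apply/funext => s; rewrite /k1 /k2/= -surjective_pairing.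
Qed.

Lemma edge_arc_derive t v : `|t| < 1 ->
  derivable (fun t => patch_map a (t, 0)) t v /\
  'D_v (fun t => patch_map a (t, 0)) t = (v * dx k1 (t, 0), v * dx k2 (t, 0)).
Proof.
move=> /edge_arc_diff d; have [df dfE] := d.
by split; [exact: diff_derivable|rewrite deriveE// dfE].
Qed.

Lemma edge_arc_velocity t : `|t| < 1 ->
  'D_1 (arc_fun edge_arc) t = (dx k1 (t, 0), dx k2 (t, 0)) /\ 'D_1 (arc_fun edge_arc) t != 0.
Proof.
move=> t1; have [_ ->] := edge_arc_derive 1 t1; rewrite !mul1r; split => //.
apply/eqP => -[h1 h2]; have := psign_jac a (edge_in t1).
by rewrite /jac /br -/k1 -/k2 h1 h2 mul0r mulr0 subrr mulr0 ltxx.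
Qed.

Lemma edge_arc_regular : regular_simple_arc (boundary U) edge_arc.
Proof.
split.
- move=> _ [t /inI[t1 _] <-]; apply: pimage_codom.
  by have [] := patch_mapP a (edge_in t1).
- by rewrite edge_arc_image => _ [t /inI[t1 Ua] <-]; exact: (edge_boundary Ua t1).
- move=> s t; rewrite !inE => /inI[s1 _] /inI[t1 _] /= e.
  have [_ h1] := patch_mapP a (edge_in s1); have [_ h2] := patch_mapP a (edge_in t1).
  have E : ((s, 0) : P) = (t, 0) by rewrite -h1 -h2 e.
  by have := congr1 fst E.
- split=> [t|v].
    rewrite inE => /inI[t1 _]; apply: differentiable_continuous.
    by have [] := edge_arc_diff t1.
  split=> [t /inI[t1 _]|t]; first by have [] := edge_arc_derive v t1.
  rewrite inE => tI; have [t1 _] := inI tI; have [m1 m2] := @patch_map_C1 _ _ a.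
  have oI : open (`]lo, hi[%classic : set R) by exact: itv_open.
  have E s : `]lo, hi[%classic s -> (v * dx k1 (s, 0), v * dx k2 (s, 0)) = 'D_v (arc_fun edge_arc) s.
    by move=> /inI[s1 _]; have [_ ->] := edge_arc_derive v s1.
  apply: (for_continuous_eq oI tI E).
  have c (h : P -> R) : C1 (@unit_square R) h -> {for t, continuous (fun s => v * dx h (s, 0))}.
    move=> hC; apply: continuousM; first exact: cvg_cst.
    by apply: continuous_slice_x; apply: (C1_dx hC); rewrite inE; exact: edge_in.
  exact: (@continuous_pair R R R _ _ t (c _ m1) (c _ m2)).
- by move=> t /inI[t1 _]; have [] := edge_arc_velocity t1.
Qed.

Variable Z : M -> 'rV[R]_3.
Hypothesis ZC : forall k, C1S (fun p => Z p 0 k).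
Variable f : chart_index M -> plane R -> plane R -> R.
Hypothesis fZ : forall i x v, chart_codom i x -> v != 0 ->
  f i x ((Num.sqrt (g i x v v))^-1 *: v) * Num.sqrt (g i x v v) = normv (D3 v (Z \o param i) x).

(** The hypothesis [fZ] covers both integrands at once: Z = phi for the length, Z = N for the length
    of the Gauss image. *)
Lemma edge_arc_integral : arc_integral f edge_arc =
  (\int[mu]_(t in `]lo, hi[) (edge_speed Z a t)%:E)%E.
Proof.
apply: eq_integral => t; rewrite inE => /inI[t1 _]; congr EFin.
have [vE v0] := edge_arc_velocity t1; have Qt := edge_in t1.
have xc : chart_codom (pchart a) (patch_map a (t, 0)).
  by apply: pimage_codom; have [] := patch_mapP a Qt.
apply: (etrans (fZ xc v0)); rewrite /edge_speed; congr normv; apply/rowP => k.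
rewrite !D3_coord vE dxE.
have [m1 m2] := @patch_map_C1 _ _ a.
have d1 := differentiable_is_diff (diffC1 m1 Qt); have d2 := differentiable_is_diff (diffC1 m2 Qt).
have dz := differentiable_is_diff (diffC1 (@ZC k (pchart a)) xc).
rewrite (is_diff_linear_formE _ dz).
have := is_diff_dx (is_diff_comp_map d1 d2 dz) => E.
by rewrite /linear_form /= -E.
Qed.

End one_arc.

Variables (m : nat) (a : 'I_m -> @surface_patch R M).
Variable Z : M -> 'rV[R]_3.
Hypothesis ZC : forall k, C1S (fun p => Z p 0 k).
Variable f : chart_index M -> plane R -> plane R -> R.
Hypothesis fZ : forall i x v, chart_codom i x -> v != 0 ->
  f i x ((Num.sqrt (g i x v v))^-1 *: v) * Num.sqrt (g i x v v) = normv (D3 v (Z \o param i) x).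

Local Notation fresh := (fresh U a).

Lemma fresh_disjoint (b b' : 'I_m) s s' : (b < b')%N -> fresh b s -> fresh b' s' ->
  edge (a b) s = edge (a b') s' -> False.
Proof.
move=> bb' [Ub s1 _] [_ _ n] e; apply: (n b bb' Ub).
by exists s => //; exact: ltW.
Qed.

(** A fresh part is open, hence a countable disjoint union of open intervals, whereas the supremum
    ranges over finite families of arcs. The partial sums are bounded by it, and then so is their
    limit. *)
Lemma fresh_speed_le :
  (\sum_b \int[mu]_(s in fresh b) (edge_speed Z (a b) s)%:E <= curve_integral g (boundary U) f)%E.
Proof.
have ex b : exists I : nat -> set R,
    [/\ forall q, open (I q) /\ is_interval (I q), trivIset setT I & fresh b = \bigcup_q I q].
  exact: (OpenSetDisjointItvs.open_disjoint_itv (@fresh_open _ _ U m a b)).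
have [I IP] := choice ex.
have If b q : I b q `<=` fresh b by have [_ _ ->] := IP b; move=> t It; exists q.
have ex2 (x : 'I_m * nat) : exists y : R * R, I x.1 x.2 = `]y.1, y.2[%classic.
  have [h _ _] := IP x.1; have [oX iX] := h x.2.
  have [|lo [hi E]] := @open_interval_oo R _ (1 / 2) oX iX; last by exists (lo, hi).
  by move=> t /If[].
have [y yP] := choice ex2.
pose c (x : 'I_m * nat) := edge_arc (a x.1) (y x).1 (y x).2.
have inI x t : `](y x).1, (y x).2[%classic t -> `|t| < 1 /\ two_sided U (a x.1).
  by rewrite -yP => /If[Ub t2 _]; split => //; exact: (short_lt1 (ltW t2)).
have cE x : arc_integral f (c x) = (\int[mu]_(t in I x.1 x.2) (edge_speed Z (a x.1) t)%:E)%E.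
  by rewrite (edge_arc_integral (@inI x) ZC fZ) yP.
have cI x : arc_image (c x) = edge (a x.1) @` I x.1 x.2 by rewrite yP.
have disj x x' : x != x' -> arc_image (c x) `&` arc_image (c x') = set0.
  move=> xx'; apply/seteqP; split => // p; rewrite !cI => -[[s Is sE] [s' Is' sE']].
  have fs := If _ _ _ Is; have fs' := If _ _ _ Is'.
  have e : edge (a x.1) s = edge (a x'.1) s' by rewrite sE.
  have [h|h|h] := ltngtP x.1 x'.1.
  - exact: (fresh_disjoint h fs fs' e).
  - exact: (fresh_disjoint h fs' fs (esym e)).
  have {h} h : x.1 = x'.1 by exact: val_inj.
  have [_ s1 _] := fs; have [_ s1' _] := fs'.
  have [_ h1] := coedge_edge (a x.1) (short_lt1 (ltW s1)).
  have [_ h2] := coedge_edge (a x'.1) (short_lt1 (ltW s1')).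
  have ss : s = s'.
    have : coedge (a x.1) (edge (a x.1) s) = coedge (a x'.1) (edge (a x'.1) s') by rewrite e h.
    by rewrite h1 h2.
  have [_ tI _] := IP x.1.
  have q : x.2 != x'.2.
    apply: contra xx' => /eqP q; apply/eqP; rewrite (surjective_pairing x) (surjective_pairing x').
    by rewrite h q.
  have Is2 : I x.1 x'.2 s by rewrite h ss.
  by move: q; rewrite (tI x.2 x'.2 Logic.I Logic.I (ex_intro _ s (conj Is Is2))) eqxx.
have fin N : (\sum_b \sum_(0 <= q < N) \int[mu]_(t in I b q) (edge_speed Z (a b) t)%:E <=
    curve_integral g (boundary U) f)%E.
  rewrite (eq_bigr (fun b => \sum_(q < N) \int[mu]_(t in I b q) (edge_speed Z (a b) t)%:E)%E); last first.
    by move=> b _; rewrite big_mkord.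
  rewrite pair_bigA/=.
  have := @curve_integral_ge (boundary U) f ('I_m * 'I_N)%type (fun x => c (x.1, val x.2)).
  rewrite (eq_bigr (fun x : 'I_m * 'I_N => \int[mu]_(t in I x.1 x.2) (edge_speed Z (a x.1) t)%:E)%E).
    apply; first by move=> x; exact: (edge_arc_regular (@inI _)).
    apply/trivIsetP => x x' _ _ xx'; apply: disj; apply: contra xx' => /eqP[h1 h2].
    by apply/eqP; rewrite (surjective_pairing x) (surjective_pairing x') h1; congr pair; exact: val_inj.
  by move=> x _; rewrite cE.
have mI b q : measurable (I b q : set (measurableTypeR R)).
  by apply: open_measurable; have [h _ _] := IP b; have [] := h q.
have int0 b q : (0 <= \int[mu]_(t in I b q) (edge_speed Z (a b) t)%:E)%E.
  by apply: integral_ge0 => t _; rewrite lee_fin normv_ge0.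
have E b : (\int[mu]_(s in fresh b) (edge_speed Z (a b) s)%:E =
    \sum_(0 <= q <oo) \int[mu]_(t in I b q) (edge_speed Z (a b) t)%:E)%E.
  have [_ tI FE] := IP b; rewrite FE ge0_integral_bigcup//.
  - rewrite -FE; apply: (speed_measurable a ZC) => //; last by move=> t [].
    by apply: open_measurable; exact: fresh_open.
  - by move=> t _; rewrite lee_fin normv_ge0.
rewrite (eq_bigr _ (fun b _ => E b)) -nneseries_sum; last by move=> b q _.
apply: lime_le; first by apply: is_cvg_nneseries => q _ _; apply: sume_ge0 => b _.
apply: nearW => N; rewrite exchange_big/=; exact: fin.
Qed.

End arcs.

(** The integrals of [c1] and [c2] may be infinite and [h] has no sign. Moving the negative part of
    [h], of finite integral, to the left leaves nonnegative functions only. *)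
Lemma integral_le_add d (T : measurableType d) (R : realType) (m : {measure set T -> \bar R})
    (D : set T) (c1 c2 h : T -> R) : measurable D ->
  measurable_fun D c1 -> measurable_fun D c2 -> m.-integrable D (EFin \o h) ->
  (forall x, D x -> 0 <= c1 x) -> (forall x, D x -> 0 <= c2 x) ->
  (forall x, D x -> c1 x <= c2 x + h x) ->
  (\int[m]_(x in D) (c1 x)%:E <= \int[m]_(x in D) (c2 x)%:E + \int[m]_(x in D) (h x)%:E)%E.
Proof.
move=> mD m1 m2 ih c10 c20 c12.
have mh : measurable_fun D (EFin \o h) by case/integrableP : ih.
have mhp := measurable_funepos mh; have mhn := measurable_funeneg mh.
have m1' : measurable_fun D (EFin \o c1) by exact/measurable_EFinP.
have m2' : measurable_fun D (EFin \o c2) by exact/measurable_EFinP.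
have fn : (\int[m]_(x in D) (EFin \o h)^\-%E x)%E \is a fin_num.
  by apply: integrable_neg_fin_num.
rewrite (integralE _ _ (fun x => (h x)%:E)) addeA leeBrDr//.
rewrite -ge0_integralD//; [|by move=> x Dx; rewrite lee_fin c10..].
rewrite -ge0_integralD//; [|by move=> x Dx; rewrite lee_fin c20..].
apply: ge0_le_integral => //.
- by move=> x Dx; rewrite adde_ge0// lee_fin c10.
- exact: emeasurable_funD.
- exact: emeasurable_funD.
move=> x Dx; rewrite funeposE funenegE -EFinN -!EFin_max -!EFinD lee_fin.
have := c12 x Dx; rewrite !maxEle; case: ifPn; case: ifPn; lra.
Qed.

(** * Partitions of an open set of the surface *)

Section surface_pieces.
Context {R : realType} {M : oriented_surface R}.
Local Notation PM := (measurableTypeR R * measurableTypeR R)%type.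
Implicit Types (i j : chart_index M) (A B : set M).

Lemma chart_image j A : A `<=` dom j -> chart j @` A = chart_codom j `&` param j @^-1` A.
Proof.
move=> Aj; apply/seteqP; split => [_ [p Ap <-]|y [yj yA]].
  by split; [exact/chart_codomP/Aj|rewrite /preimage/= chartK//; exact: Aj].
by exists (param j y) => //; have [] := param_dom yj.
Qed.

(** Measurability is read in every chart, so that it is stable under set operations between pieces
    coming from different charts. *)
Definition surface_borel A := forall j, measurable (chart_codom j `&` param j @^-1` A : set PM).

(** One chart containing the set decides: in another chart the set is the preimage under a
    continuous transition map. *)
Lemma surface_borel_chart j A : A `<=` dom j -> measurable (chart j @` A : set PM) -> surface_borel A.
Proof.
move=> Aj mA i.
have -> : chart_codom i `&` param i @^-1` A = trans_dom i j `&` transition i j @^-1` (chart j @` A).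
  apply/seteqP; split => [y [yi yA]|y [yij [p Ap pE]]].
    by split; [apply/trans_domP; split => //; exact: Aj|exists (param i y)].
  have [_ E _] := transitionP yij; have /trans_domP[yi _] := yij.
  by split => //; rewrite /preimage/= -E -pE chartK//; exact: Aj.
have mF : measurable_fun (trans_dom i j : set PM) (transition i j : PM -> PM).
  apply: continuous_map_measurable_plane; first exact: trans_dom_open.
  exact: C1map_continuous (@transition_C1map _ _ i j).
by apply: mF => //; apply: open_measurable_plane; exact: trans_dom_open.
Qed.

Lemma surface_borel_open A : open A -> surface_borel A.
Proof.
move=> oA j; apply: open_measurable_plane.
by apply: (open_preimage_in (@chart_codom_open _ _ j) _ oA); exact: param_cont.
Qed.

Lemma surface_borelD A B : surface_borel A -> surface_borel B -> surface_borel (A `\` B).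
Proof.
move=> mA mB j; have -> : chart_codom j `&` param j @^-1` (A `\` B) =
  (chart_codom j `&` param j @^-1` A) `\` (chart_codom j `&` param j @^-1` B).
  apply/seteqP; split => [y [h1 [h2 h3]]|y [[h1 h2] h3]]; first by split => // -[_ /h3].
  by split => //; split => // h4; exact: h3.
exact: measurableD (mA j) (mB j).
Qed.

Lemma surface_borelU A B : surface_borel A -> surface_borel B -> surface_borel (A `|` B).
Proof.
move=> mA mB j; have -> : chart_codom j `&` param j @^-1` (A `|` B) =
  (chart_codom j `&` param j @^-1` A) `|` (chart_codom j `&` param j @^-1` B).
  by apply/seteqP; split => [y [h1 [h2|h2]]|y [[h1 h2]|[h1 h2]]]; [left|right|split => //; left|split => //; right].
exact: measurableU (mA j) (mB j).
Qed.

Lemma surface_borel_bigcup (I : finType) (D : set I) (F : I -> set M) :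
  (forall k, surface_borel (F k)) -> surface_borel (\bigcup_(k in D) F k).
Proof.
move=> mF j; have -> : chart_codom j `&` param j @^-1` (\bigcup_(k in D) F k) =
  \bigcup_(k in D) (chart_codom j `&` param j @^-1` F k).
  by rewrite preimage_bigcup setI_bigcupr.
by apply: fin_bigcup_measurable => [|k _]; [exact: finite_finset|exact: mF].
Qed.

Lemma surface_borel_image j A : A `<=` dom j -> surface_borel A -> measurable (chart j @` A : set PM).
Proof. by move=> Aj mA; rewrite chart_image. Qed.

Lemma surface_integral_ge (g : riemannian_metric M) (A : set M) (f : M -> R) (T : finType)
    (i : T -> chart_index M) (B : T -> set M) :
  (forall k, B k `<=` A `&` dom (i k)) ->
  (forall k, measurable (chart (i k) @` B k : set PM)) -> trivIset setT B ->
  (\sum_k \int[lebesgue_plane R]_(x in chart (i k) @` B k)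
      (f (param (i k) x) * Num.sqrt (\det (first_form g (i k) x)))%:E <= surface_integral g A f)%E.
Proof.
move=> BA mB tB; apply: ereal_sup_ubound.
exists #|T|, (fun k => i (enum_val k)), (fun k => B (enum_val k)); split => //.
  apply/trivIsetP => k l _ _ kl; move/trivIsetP : tB; apply => //.
  by apply: contra kl => /eqP/enum_val_inj ->.
set F := fun k => (\int[lebesgue_plane R]_(x in chart (i k) @` B k)
      (f (param (i k) x) * Num.sqrt (\det (first_form g (i k) x)))%:E)%E.
transitivity (\sum_(k in T) F k)%E; first exact: eq_bigl.
exact: (big_enum_val F).
Qed.

(* A finite disjoint family of pieces of U is completed to a partition of U by the traces of the
   patches, made disjoint. *)
Section completion.
Variables (U : set M) (n m : nat) (i0 : 'I_n -> chart_index M) (B0 : 'I_n -> set M)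
  (a : 'I_m -> @surface_patch R M).
Hypotheses (oU : open U) (B0U : forall k, B0 k `<=` U `&` dom (i0 k))
  (mB0 : forall k, measurable (chart (i0 k) @` B0 k : set PM)) (tB0 : trivIset setT B0)
  (acov : forall p, exists k, pdom (a k) p).

Definition piece (x : 'I_n + 'I_m) : set M :=
  match x with
  | inl k => B0 k
  | inr l => (U `&` pdom (a l)) `\`
      ((\bigcup_(l' in [set l' : 'I_m | (l' < l)%N]) pdom (a l')) `|` \bigcup_k B0 k)
  end.

Definition piece_chart (x : 'I_n + 'I_m) : chart_index M :=
  match x with inl k => i0 k | inr l => pchart (a l) end.

Lemma piece_sub x : piece x `<=` U `&` dom (piece_chart x).
Proof. by case: x => [k|l] /=; [exact: B0U|move=> p [[Up [pl _]] _]]. Qed.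

Lemma piece_measurable x : measurable (chart (piece_chart x) @` piece x : set PM).
Proof.
case: x => [k|l] /=; first exact: mB0.
apply: surface_borel_image; first by move=> p [[_ [pl _]] _].
apply: surface_borelD; first by apply: surface_borel_open; apply: openI => //; exact: pdom_open.
apply: surface_borelU; apply: surface_borel_bigcup => k.
  by apply: surface_borel_open; exact: pdom_open.
by apply: (surface_borel_chart (j := i0 k)) (mB0 k) => p /B0U[].
Qed.

Lemma piece_trivIset : trivIset setT piece.
Proof.
have H (l l' : 'I_m) p : (l < l')%N -> piece (inr l) p -> piece (inr l') p -> False.
  by move=> ll' [[_ pl] _] [_ n']; apply: n'; left; exists l.
move=> [k|l] [k'|l'] _ _ [p [h1 h2]].
- by congr inl; apply: (tB0 Logic.I Logic.I); exists p.
- by case: h2 => _ h2; exfalso; apply: h2; right; exists k.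
- by case: h1 => _ h1; exfalso; apply: h1; right; exists k'.
congr inr; have [h|h|h] := ltngtP l l'; last exact: val_inj.
  by case: (H _ _ _ h h1 h2).
by case: (H _ _ _ h h2 h1).
Qed.

Lemma piece_cover : \bigcup_x piece x = U.
Proof.
apply/seteqP; split => [p [x _ /piece_sub[]]//|p Up].
have [[k _ kp]|nB] := pselect ((\bigcup_k B0 k) p); first by exists (inl k).
have [l0 l0p] := acov p.
have g0 : `[< pdom (a l0) p >] by exact/asboolP.
have [l /asboolP lp lmin] := @arg_minnP _ l0 (fun l => `[< pdom (a l) p >]) (fun l : 'I_m => nat_of_ord l) g0.
exists (inr l) => //; split => // -[[l' /= l'l l'p]|//].
by have := lmin l' (asboolT l'p); rewrite leqNgt l'l.
Qed.

End completion.
End surface_pieces.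

Lemma detv_comb (R : realType) (n a b : 'rV[R]_3) (s t k l : R) :
  detv n (s *: a + t *: b) (k *: a + l *: b) = (s * l - k * t) * detv n a b.
Proof. by rewrite /detv crossv_comb dotvZr. Qed.

(** * Measurability of the curvature integrand *)

Section curvature_density.
Context {R : realType} {M : oriented_surface R} (g : riemannian_metric M) (phi : M -> 'rV[R]_3).
Hypothesis phiC2 : isometric_immersion_C2 g phi.
Local Notation P := (plane R).
Local Notation PM := (measurableTypeR R * measurableTypeR R)%type.
Local Notation e0 := (plane_basis R 0).
Local Notation e1 := (plane_basis R 1).
Local Notation N := (gauss_map phi).
Implicit Types (i j : chart_index M).

(** The preferred chart may jump with the point, so the definition of the curvature says nothing
    about its regularity. Multiplied by the density it is a determinant that is continuous in every
    chart, which settles measurability. *)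
Lemma curvature_density i y : chart_codom i y ->
  gauss_curvature g phi (param i y) * density phi i y =
  detv (N (param i y)) (D3 e0 (N \o param i) y) (D3 e1 (N \o param i) y).
Proof.
move=> yi; set p := param i y; pose c := chart_at p.
have pc : dom c p by exact: dom_chart_at.
have yic : trans_dom i c y by apply/trans_domP.
have [/trans_domP[yc _] _ _] := transitionP yic.
have dN := C13_diff3 (gauss_C13 phiC2 (i := c)) yc.
rewrite (density_transition phiC2 yic) mulrCA -(gauss_curvature_det phiC2 p).
have t0 := D3_transition e0 yic dN; have t1 := D3_transition e1 yic dN.
rewrite !dxE in t0; rewrite !dyE in t1.
move: t0 t1 {dN}; move: (gauss_map phi) => G t0 t1.
by rewrite t0 t1 detv_comb.
Qed.

Definition continuous3 (X : P -> 'rV[R]_3) y := forall k, {for y, continuous (fun z => X z 0 k)}.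

Lemma continuous3_crossv X Y y : continuous3 X y -> continuous3 Y y ->
  continuous3 (fun z => crossv (X z) (Y z)) y.
Proof.
move=> cX cY k; have H k1 k2 k3 k4 :
    {for y, continuous (fun z => X z 0 k1 * Y z 0 k2 - X z 0 k3 * Y z 0 k4)}.
  by apply: continuousB; apply: continuousM; [exact: cX|exact: cY|exact: cX|exact: cY].
have E k1 k2 k3 k4 : (forall z, crossv (X z) (Y z) 0 k = X z 0 k1 * Y z 0 k2 - X z 0 k3 * Y z 0 k4) ->
    {for y, continuous (fun z => crossv (X z) (Y z) 0 k)}.
  move=> e; have -> : (fun z => crossv (X z) (Y z) 0 k) =
      (fun z => X z 0 k1 * Y z 0 k2 - X z 0 k3 * Y z 0 k4) by apply/funext => z; exact: e.
  exact: H.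
case: (ord3P k) => kE; rewrite kE in E *; apply: E => z.
- exact: crossv0.
- exact: crossv1.
- exact: crossv2.
Qed.

Lemma continuous3_dotv X Y y : continuous3 X y -> continuous3 Y y ->
  {for y, continuous (fun z => dotv (X z) (Y z))}.
Proof.
move=> cX cY; have -> : (fun z => dotv (X z) (Y z)) = (fun z => X z 0 (inord 0) * Y z 0 (inord 0) +
    X z 0 (inord 1) * Y z 0 (inord 1) + X z 0 (inord 2) * Y z 0 (inord 2)).
  by apply/funext => z; rewrite dotvE.
by do 2?[apply: continuousD]; apply: continuousM; by [exact: cX|exact: cY].
Qed.

Lemma C13_continuous3 (O : set P) X y : C13 O X -> O y -> continuous3 X y.
Proof. by move=> XC Oy k; apply: (C1_continuous (XC k)); rewrite inE. Qed.

Lemma density_continuous i : {in chart_codom i, continuous (density phi i)}.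
Proof.
move=> y; rewrite inE => yi.
have nC : C13 (chart_codom i) (normal phi i).
  by apply: C13_crossv; [exact: chart_codom_open|exact: imm_D3_C13|exact: imm_D3_C13].
have c := C13_continuous3 nC yi.
apply: (@continuous_comp _ _ _ (fun z => dotv (normal phi i z) (normal phi i z)) Num.sqrt).
  exact: continuous3_dotv.
exact: sqrt_continuous.
Qed.

Lemma gauss_D3_continuous i (v : P) y : v = e0 \/ v = e1 -> chart_codom i y ->
  continuous3 (D3 v (N \o param i)) y.
Proof.
move=> ve yi k; have NC := gauss_C13 phiC2 (i := i) k.
have yi' : y \in chart_codom i by rewrite inE.
case: ve => ->.
  have -> : (fun z => D3 e0 (N \o param i) z 0 k) = dx (fun z => (N \o param i) z 0 k).
    by apply/funext => z; rewrite D3_coord dxE.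
  exact: (C1_dx NC).
have -> : (fun z => D3 e1 (N \o param i) z 0 k) = dy (fun z => (N \o param i) z 0 k).
  by apply/funext => z; rewrite D3_coord dyE.
exact: (C1_dy NC).
Qed.

Lemma curvature_density_continuous i : {in chart_codom i, continuous (fun y =>
  detv (N (param i y)) (D3 e0 (N \o param i) y) (D3 e1 (N \o param i) y))}.
Proof.
move=> y; rewrite inE => yi.
apply: continuous3_dotv; first exact: (C13_continuous3 (gauss_C13 phiC2 (i := i)) yi).
by apply: continuous3_crossv; apply: gauss_D3_continuous => //; [left|right].
Qed.

Lemma density_measurable i (A : set PM) : measurable A -> A `<=` chart_codom i ->
  measurable_fun A (density phi i : PM -> R).
Proof.
move=> mA Ai; have oi := @chart_codom_open _ _ i.
exact: (measurable_funS (open_measurable_plane oi) Ai (continuous_measurable_plane oi (density_continuous (i := i)))).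
Qed.

Lemma curvature_density_measurable i (A : set PM) : measurable A -> A `<=` chart_codom i ->
  measurable_fun A (fun y : PM => `|gauss_curvature g phi (param i y)| * density phi i y).
Proof.
move=> mA Ai; have oi := @chart_codom_open _ _ i.
have m := measurable_funS (open_measurable_plane oi) Ai (continuous_measurable_plane oi (curvature_density_continuous (i := i))).
have := measurableT_comp (@normr_measurable R setT) m.
apply: eq_measurable_fun => y; rewrite inE => /Ai yi /=.
by rewrite -curvature_density// normrM (gtr0_norm (density_gt0 phiC2 yi)).
Qed.

End curvature_density.

Lemma br_suml (R : realType) (n : nat) (f : 'I_n -> plane R -> R) (h : plane R -> R) (z : plane R) :
  (forall l, differentiable (f l) z) -> br (fun y => \sum_l f l y) h z = \sum_l br (f l) h z.
Proof.
move=> df; have E v : 'D_v (fun y => \sum_l f l y) z = \sum_l 'D_v (f l) z.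
  rewrite -derive_sum; last by move=> l; exact: diff_derivable.
  by congr (derive _ z v); apply/funext => y; rewrite fct_sumE.
rewrite /br -!dxE -!dyE !E !mulr_suml -sumrB; apply: eq_bigr => l _.
by rewrite -!dxE -!dyE.
Qed.

(** * The inequality *)

Section assembly.
Context {R : realType} {M : oriented_surface R} (g : riemannian_metric M) (phi : M -> 'rV[R]_3).
Hypothesis phiC2 : isometric_immersion_C2 g phi.
Local Notation P := (plane R).
Local Notation PM := (measurableTypeR R * measurableTypeR R)%type.
Local Notation mu := (@lebesgue_measure R).
Local Notation lam := (lebesgue_plane R).
Local Notation Q := (@unit_square R).
Local Notation e0 := (plane_basis R 0).
Local Notation N := (gauss_map phi).
Local Notation term := ('I_3 * bool)%type.
Implicit Types (i j : chart_index M).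

(** The six terms f dg of omega, indexed by a coordinate and a boolean: [true] for those in dX,
    [false] for those in dN. *)
Definition coef (s : term) : M -> R := if s.2 then form_coef1 phi s.1 else form_coef2 phi s.1.
Definition prim (s : term) : M -> R := if s.2 then (fun p => phi p 0 s.1) else (fun p => N p 0 s.1).

Lemma coef_C1 s : C1S (coef s).
Proof. by rewrite /coef; case: s.2; [exact: form_coef1_C1|exact: form_coef2_C1]. Qed.

Lemma prim_C1 s : C1S (prim s).
Proof. by rewrite /prim; case: s.2; [exact: phi_C1|exact: gauss_C1]. Qed.

Lemma sum_term (F : term -> R) : \sum_s F s = \sum_(k < 3) (F (k, true) + F (k, false)).
Proof.
rewrite (eq_bigr (fun s => F (s.1, s.2))); last by move=> [].
rewrite -(pair_bigA _ (fun k b => F (k, b)))/=; apply: eq_bigr => k _.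
by rewrite big_bool.
Qed.

Lemma exterior_derivative_term j y :
  exterior_derivative phi j y = \sum_s br (coef s \o param j) (prim s \o param j) y.
Proof. by rewrite sum_term. Qed.

Variables (U : set M) (m : nat) (a : 'I_m -> @surface_patch R M) (chi : 'I_m -> M -> R).
Hypothesis oU : open U.
Hypothesis aU : forall k, one_sided U (a k) \/ two_sided U (a k).
Hypothesis chiC : forall k, C1S (chi k).
Hypothesis chi0 : forall k p, 0 <= chi k p.
Hypothesis chi1 : forall p, \sum_k chi k p = 1.
Hypothesis chi_out : forall k p, ~ pdom (a k) p -> chi k p = 0.
Hypothesis chi_far : forall k z, Q z -> 1 / 2 <= `|z| -> chi k (psi (a k) z) = 0.
Hypothesis acov : forall p, exists k, pdom (a k) p.

Definition local_coef (l : 'I_m) s p := chi l p * coef s p.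

Lemma local_coef_C1 l s : C1S (local_coef l s).
Proof. exact: C1S_M (@chiC l) (@coef_C1 s). Qed.

Lemma local_coef_far l s z : Q z -> 1 / 2 <= `|z| -> local_coef l s (psi (a l) z) = 0.
Proof. by move=> Qz zf; rewrite /local_coef chi_far// mul0r. Qed.

Lemma local_coef_out l s p : ~ pdom (a l) p -> local_coef l s p = 0.
Proof. by move=> pl; rewrite /local_coef chi_out// mul0r. Qed.

Local Notation index := (term * 'I_m)%type.

Definition chart_br (x : index) j y := br (local_coef x.2 x.1 \o param j) (prim x.1 \o param j) y.
Definition patch_br (x : index) z :=
  br (local_coef x.2 x.1 \o psi (a x.2)) (prim x.1 \o psi (a x.2)) z.

(** The partition of unity is inserted inside the first argument of the bracket, where the weights
    add up to 1; the derivatives of the weights therefore cancel in the sum. *)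
Lemma exterior_derivative_local j y : chart_codom j y ->
  exterior_derivative phi j y = \sum_x chart_br x j y.
Proof.
move=> yj; rewrite exterior_derivative_term -(pair_bigA _ (fun s l => chart_br (s, l) j y))/=.
apply: eq_bigr => s _; rewrite /chart_br /= -br_suml; last first.
  by move=> l; exact: diffC1 (@local_coef_C1 l s j) yj.
congr (br _ _ y); apply/funext => z /=.
by rewrite /local_coef -mulr_suml chi1 mul1r.
Qed.

Section one_piece.
Variables (j : chart_index M) (A : set M).
Hypotheses (Aj : A `<=` dom j) (mA : measurable (chart j @` A : set PM)).

Let transferA x := @transfer R M (a x.2) (local_coef x.2 x.1) (prim x.1) (@local_coef_C1 x.2 x.1)
  (@prim_C1 x.1) (@local_coef_far x.2 x.1) (@local_coef_out x.2 x.1) j A Aj mA.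

Let codomA y : (chart j @` A) y -> chart_codom j y.
Proof. by move=> [p Ap <-]; exact/chart_codomP/Aj. Qed.

Lemma exterior_derivative_integrable :
  lam.-integrable (chart j @` A) (fun y => (exterior_derivative phi j y)%:E).
Proof.
have h : lam.-integrable (chart j @` A) (fun y => \sum_x (chart_br x j y)%:E)%E.
  by apply: integrable_sum => // x _; have [] := transferA x.
apply: eq_integrable h => // y; rewrite inE => /codomA yj.
by rewrite exterior_derivative_local// sumEFin.
Qed.

Lemma exterior_derivative_integral :
  (\int[lam]_(y in chart j @` A) (exterior_derivative phi j y)%:E =
   \sum_x \int[lam]_(z in Q `&` psi (a x.2) @^-1` A) (psign (a x.2) * patch_br x z)%:E)%E.
Proof.
transitivity (\int[lam]_(y in chart j @` A) \sum_x (chart_br x j y)%:E)%E.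
  apply: eq_integral => y; rewrite inE => /codomA yj.
  by rewrite exterior_derivative_local// sumEFin.
rewrite integral_sum//; last by move=> x; have [] := transferA x.
by apply: eq_bigr => x _; have [_ ->] := transferA x.
Qed.

Variable r : R.
Hypothesis phi_r : forall p, normv (phi p) <= r.

Lemma piece_area_le :
  (\int[lam]_(y in chart j @` A) (1 * Num.sqrt (\det (first_form g j y)))%:E <=
   (r ^+ 2)%:E * \int[lam]_(y in chart j @` A)
      (`|gauss_curvature g phi (param j y)| * Num.sqrt (\det (first_form g j y)))%:E +
   \int[lam]_(y in chart j @` A) (exterior_derivative phi j y)%:E)%E.
Proof.
have AC : chart j @` A `<=` chart_codom j by [].
have mK := curvature_density_measurable phiC2 mA AC.
have K0 y : (chart j @` A) y -> 0 <= `|gauss_curvature g phi (param j y)| * density phi j y.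
  by move=> _; rewrite mulr_ge0// normv_ge0.
have -> : (\int[lam]_(y in chart j @` A) (1 * Num.sqrt (\det (first_form g j y)))%:E =
    \int[lam]_(y in chart j @` A) (density phi j y)%:E)%E.
  apply: eq_integral => y; rewrite inE => /codomA yj.
  by rewrite mul1r (sqrt_det_first_form phiC2 yj).
have -> : (\int[lam]_(y in chart j @` A)
      (`|gauss_curvature g phi (param j y)| * Num.sqrt (\det (first_form g j y)))%:E =
    \int[lam]_(y in chart j @` A) (`|gauss_curvature g phi (param j y)| * density phi j y)%:E)%E.
  by apply: eq_integral => y; rewrite inE => /codomA yj; rewrite (sqrt_det_first_form phiC2 yj).
have E : ((r ^+ 2)%:E * \int[lam]_(y in chart j @` A)
      (`|gauss_curvature g phi (param j y)| * density phi j y)%:E =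
    \int[lam]_(y in chart j @` A)
      (r ^+ 2 * (`|gauss_curvature g phi (param j y)| * density phi j y))%:E)%E.
  under [RHS]eq_integral do rewrite EFinM.
  rewrite ge0_integralZl//; first exact/measurable_EFinP.
  by rewrite lee_fin sqr_ge0.
rewrite E.
apply: (@integral_le_add _ _ _ lam (chart j @` A) (density phi j)
  (fun y => r ^+ 2 * (`|gauss_curvature g phi (param j y)| * density phi j y)) (exterior_derivative phi j)) => //.
- exact: (density_measurable phiC2).
- by apply: measurable_funM => //; exact: measurable_cst.
- exact: exterior_derivative_integrable.
- by move=> y _; exact: normv_ge0.
- by move=> y /K0 h; rewrite mulr_ge0// sqr_ge0.
- by move=> y /codomA yj; exact: (density_le phiC2 phi_r yj).
Qed.

End one_piece.

(** What Green's formula leaves of one term of omega on one patch: the integral along its edge for a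
    two-sided patch, nothing for a one-sided one. *)
Definition boundary_term (x : index) : R :=
  if `[< two_sided U (a x.2) >] then
    - (psign (a x.2) * \int[mu]_(t in @core_interval R)
         (local_coef x.2 x.1 (psi (a x.2) (t, 0)) * dx (prim x.1 \o psi (a x.2)) (t, 0)))
  else 0.

Lemma patch_br_integral x :
  (\int[lam]_(z in Q `&` psi (a x.2) @^-1` U) (psign (a x.2) * patch_br x z)%:E = (boundary_term x)%:E)%E.
Proof.
have mQU : measurable (Q `&` psi (a x.2) @^-1` U : set PM).
  apply: open_measurable_plane.
  by apply: (open_preimage_in (@open_unit_square R) _ oU); exact: psi_continuous.
have bi := br_integrable (@local_coef_C1 x.2 x.1) (@prim_C1 x.1) (@local_coef_far x.2 x.1)
  mQU (@subIsetl _ _ _).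
under eq_integral do rewrite EFinM.
rewrite integralZl// /boundary_term; case: asboolP => [Ux|Ux].
  rewrite (patch_green_two (@local_coef_C1 x.2 x.1) (@prim_C1 x.1) (@local_coef_far x.2 x.1) Ux).
  by rewrite -EFinM mulrN.
have [Ux'|//] := aU x.2.
rewrite (patch_green_one (@local_coef_C1 x.2 x.1) (@prim_C1 x.1) (@local_coef_far x.2 x.1) Ux').
by rewrite mule0.
Qed.

(** The pieces are merely measurable, so Green's formula does not apply to them one by one. Once
    everything is transferred to a fixed patch, summing over the pieces restores the trace of U, to
    which it does apply. *)
Lemma pieces_integral (T : finType) (J : T -> chart_index M) (A : T -> set M) :
  (forall k, A k `<=` dom (J k)) -> (forall k, measurable (chart (J k) @` A k : set PM)) ->
  trivIset setT A -> \bigcup_k A k = U ->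
  (\sum_k \int[lam]_(y in chart (J k) @` A k) (exterior_derivative phi (J k) y)%:E =
   (\sum_x boundary_term x)%:E)%E.
Proof.
move=> AJ mA tA AU.
under eq_bigr => k _ do rewrite (exterior_derivative_integral (@AJ k) (mA k)).
rewrite exchange_big/= -sumEFin; apply: eq_bigr => x _.
rewrite -patch_br_integral.
have -> : Q `&` psi (a x.2) @^-1` U = \bigcup_k (Q `&` psi (a x.2) @^-1` A k).
  by rewrite -AU preimage_bigcup setI_bigcupr.
have mk k : measurable (Q `&` psi (a x.2) @^-1` A k : set PM).
  exact: (psi_preimage_measurable (a x.2) (@AJ k) (mA k)).
rewrite integral_fin_bigcup//.
- move=> k l _ _ [z [[_ h1] [_ h2]]]; apply: (tA k l Logic.I Logic.I).
  by exists (psi (a x.2) z).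
- have mU : measurable (\bigcup_k (Q `&` psi (a x.2) @^-1` A k) : set PM) by exact: fin_bigcup_measurable.
  apply: measurable_funM; first exact: measurable_cst.
  apply: (br_measurable (a x.2) (@local_coef_C1 x.2 x.1) (@prim_C1 x.1) mU).
  by move=> z [k _ []].
Qed.

Variable r : R.
Hypothesis r0 : 0 < r.
Hypothesis phi_r : forall p, normv (phi p) <= r.

Local Notation wX := (edge_density a chi phi).
Local Notation wN := (edge_density a chi N).

Lemma edge_form_le l t : `|t| < 1 ->
  `|\sum_s local_coef l s (psi (a l) (t, 0)) * dx (prim s \o psi (a l)) (t, 0)| <=
  r / 2 * wX l t + r ^+ 2 / 2 * wN l t.
Proof.
move=> t1; set p := psi (a l) (t, 0).
have -> : \sum_s local_coef l s p * dx (prim s \o psi (a l)) (t, 0) =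
    chi l p * \sum_k (form_coef1 phi k p * D3 e0 (phi \o psi (a l)) (t, 0) 0 k +
      form_coef2 phi k p * D3 e0 (N \o psi (a l)) (t, 0) 0 k).
  rewrite sum_term mulr_sumr; apply: eq_bigr => k _.
  by rewrite !D3_coord !dxE /local_coef mulrDr !mulrA.
rewrite normrM (ger0_norm (chi0 _ _)) /edge_density -/p -[edge _ _]/p.
have := ler_wpM2l (chi0 l p) (form_le phiC2 phi_r p (D3 e0 (phi \o psi (a l)) (t, 0)) (D3 e0 (N \o psi (a l)) (t, 0))).
move=> h; apply: (le_trans h); rewrite le_eqVlt; apply/orP; left; apply/eqP.
by rewrite /edge_speed; ring.
Qed.

Lemma psign_norm (b : @surface_patch R M) : `|psign b| = 1.
Proof.
have := psign2 b; rewrite -expr2 => /eqP; rewrite sqrf_eq1 => /orP[|] /eqP ->.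
  exact: normr1.
by rewrite normrN1.
Qed.

Let edge_form l s t := local_coef l s (psi (a l) (t, 0)) * dx (prim s \o psi (a l)) (t, 0).

Let edge_form_continuous l s t : `|t| < 1 -> {for t, continuous (edge_form l s)}.
Proof.
move=> /edge_in Qt; have Qt' : (t, 0) \in Q by rewrite inE.
have c1 : {for t, continuous (fun t => (local_coef l s \o psi (a l)) (t, 0))}.
  by apply: continuous_slice_x; apply: (C1_continuous (psi_C1 (a l) (@local_coef_C1 l s))).
have c2 : {for t, continuous (fun t => dx (prim s \o psi (a l)) (t, 0))}.
  by apply: continuous_slice_x; apply: (C1_dx (psi_C1 (a l) (@prim_C1 s))).
exact: continuousM c1 c2.
Qed.

Lemma core_lt1 t : @core_interval R t -> `|t| < 1.
Proof. by rewrite /core_interval /= in_itv/= -ler_norml => h; apply: (le_lt_trans h); lra. Qed.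

Lemma short_core : short_interval (R := R) `<=` @core_interval R.
Proof. by move=> t; rewrite /short_interval /core_interval /= in_itv/= -ler_norml => h; lra. Qed.

Let edge_form_integrable l s : mu.-integrable (@core_interval R) (fun t => (edge_form l s t)%:E).
Proof.
apply: continuous_compact_integrable; first exact: segment_compact.
by apply: continuous_in_subspaceT => t /set_mem /core_lt1; exact: edge_form_continuous.
Qed.

Lemma boundary_termE l s : two_sided U (a l) ->
  ((boundary_term (s, l))%:E = \int[mu]_(t in @core_interval R) (- psign (a l) * edge_form l s t)%:E)%E.
Proof.
move=> Ul; under eq_integral do rewrite EFinM.
have fi := edge_form_integrable l s.
have mc : measurable (@core_interval R : set (measurableTypeR R)) by exact: measurable_itv.
rewrite integralZl// /boundary_term /= asboolT// -mulNr EFinM; congr (_ * _)%E.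
by rewrite /Rintegral fineK// integrable_fin_num.
Qed.

Lemma edge_bound l : two_sided U (a l) ->
  ((\sum_s boundary_term (s, l))%:E <=
   (r / 2)%:E * \int[mu]_(t in short_interval (R := R)) (wX l t)%:E +
   (r ^+ 2 / 2)%:E * \int[mu]_(t in short_interval (R := R)) (wN l t)%:E)%E.
Proof.
move=> Ul; have mc : measurable (@core_interval R : set (measurableTypeR R)) by exact: measurable_itv.
have ms : measurable (short_interval : set (measurableTypeR R)).
  by apply: open_measurable; exact: open_abs_lt.
have rr0 : 0 <= r / 2 by rewrite divr_ge0// ltW.
have rr1 : 0 <= r ^+ 2 / 2 by rewrite divr_ge0// sqr_ge0.
have X0 t : 0 <= wX l t by exact: edge_density_ge0.
have N0 t : 0 <= wN l t by exact: edge_density_ge0.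
have phC := phi_C1 phiC2; have NC := gauss_C1 phiC2.
have mX : measurable_fun (short_interval : set (measurableTypeR R)) (fun t => (wX l t)%:E).
  by apply: (weighted_measurable a chiC (fun k => @phC k)).
have mN : measurable_fun (short_interval : set (measurableTypeR R)) (fun t => (wN l t)%:E).
  by apply: (weighted_measurable a chiC (fun k => @NC k)).
have fi s : mu.-integrable (@core_interval R) (fun t => (- psign (a l) * edge_form l s t)%:E).
  by have := integrableZl mc (- psign (a l)) (edge_form_integrable l s).
rewrite -sumEFin (eq_bigr _ (fun s _ => boundary_termE s Ul)) -integral_sum//.
(* The weights vanish beyond 1/2, which shrinks the interval of integration to the one on which
   fresh parts are defined. *)
have zo := @integral_zero_outside _ _ R mu (@core_interval R) (short_interval (R := R))
  (fun t => \sum_s (- psign (a l) * edge_form l s t)%:E)%E short_core.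
rewrite zo; last first.
  move=> t /core_lt1 t1 tn; rewrite big1// => s _; rewrite /edge_form local_coef_far ?mul0r ?mulr0//.
    exact: edge_in.
  rewrite prod_normE/= normr0 le_max; apply/orP; left; rewrite leNgt; apply/negP => h; exact: tn.
have mS : measurable_fun (short_interval : set (measurableTypeR R))
    (fun t => \sum_s (- psign (a l) * edge_form l s t)%:E)%E.
  apply: (measurable_funS mc short_core); apply: emeasurable_sum => s.
  by case/integrableP : (fi s).
apply: (le_trans (lee_abs _)); apply: (le_trans (le_abse_integral _ ms mS)).
have eX0 t : short_interval t -> (0 <= (wX l t)%:E)%E by rewrite lee_fin.
have eN0 t : short_interval t -> (0 <= (wN l t)%:E)%E by rewrite lee_fin.
have reX0 t : short_interval t -> (0 <= (r / 2)%:E * (wX l t)%:E)%E.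
  by move=> _; rewrite mule_ge0// lee_fin.
have reN0 t : short_interval t -> (0 <= (r ^+ 2 / 2)%:E * (wN l t)%:E)%E.
  by move=> _; rewrite mule_ge0// lee_fin.
have mrX := measurable_funeM (r / 2)%:E mX; have mrN := measurable_funeM (r ^+ 2 / 2)%:E mN.
rewrite -(ge0_integralZl mu ms mX eX0); last by rewrite lee_fin.
rewrite -(ge0_integralZl mu ms mN eN0); last by rewrite lee_fin.
rewrite -(ge0_integralD mu ms reX0 mrX reN0 mrN).
apply: ge0_le_integral => //.
- exact: measurableT_comp.
- exact: emeasurable_funD.
move=> t ts; rewrite sumEFin -mulr_sumr abse_EFin -!EFinM -EFinD lee_fin.
rewrite normrM normrN psign_norm mul1r; apply: edge_form_le.
exact: short_lt1 (ltW ts).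
Qed.

Lemma boundary_sum_le :
  ((\sum_x boundary_term x)%:E <=
   (r / 2)%:E * \sum_(l | `[< two_sided U (a l) >]) \int[mu]_(t in short_interval (R := R)) (wX l t)%:E +
   (r ^+ 2 / 2)%:E * \sum_(l | `[< two_sided U (a l) >])
      \int[mu]_(t in short_interval (R := R)) (wN l t)%:E)%E.
Proof.
have X0 l : (0 <= \int[mu]_(t in short_interval (R := R)) (wX l t)%:E)%E.
  by apply: integral_ge0 => t _; rewrite lee_fin edge_density_ge0.
have N0 l : (0 <= \int[mu]_(t in short_interval (R := R)) (wN l t)%:E)%E.
  by apply: integral_ge0 => t _; rewrite lee_fin edge_density_ge0.
rewrite !ge0_sume_distrr// -big_split/=.
have -> : \sum_x boundary_term x = \sum_(l | `[< two_sided U (a l) >]) \sum_s boundary_term (s, l).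
  rewrite (eq_bigr (fun x => boundary_term (x.1, x.2))); last by move=> [].
  rewrite -(pair_bigA _ (fun s l => boundary_term (s, l)))/= exchange_big/= [RHS]big_mkcond/=.
  apply: eq_bigr => l _; case: ifPn => // Ul.
  by rewrite big1// => s _; rewrite /boundary_term (negbTE Ul).
rewrite -sumEFin; apply: lee_sum => l /asboolP; exact: edge_bound.
Qed.

Lemma curve_length_ge :
  (\sum_(l | `[< two_sided U (a l) >]) \int[mu]_(t in short_interval (R := R)) (wX l t)%:E <=
   curve_length g (boundary U))%E.
Proof.
have phC := phi_C1 phiC2.
have h := @boundary_weighted_le R M U oU m a chi chiC chi0 chi1 phi (fun k => @phC k).
apply: (le_trans h).
have h2 := @fresh_speed_le R M g U m a phi (fun k => @phC k) (fun _ _ _ => 1).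
apply: h2 => i x v xi v0.
have [_ _ gE] := phiC2 i.
by rewrite mul1r gE// (imm_D3 phiC2).
Qed.

Lemma D3Z c v (X : P -> 'rV[R]_3) z : diff3 X z -> D3 (c *: v) X z = c *: D3 v X z.
Proof.
move=> dX; apply/rowP => k.
rewrite [LHS]mxE [RHS]mxE [in RHS]mxE !deriveE//.
by rewrite linearZ.
Qed.

Lemma gauss_length_ge :
  (\sum_(l | `[< two_sided U (a l) >]) \int[mu]_(t in short_interval (R := R)) (wN l t)%:E <=
   gauss_length g phi (boundary U))%E.
Proof.
have NC := gauss_C1 phiC2.
have h := @boundary_weighted_le R M U oU m a chi chiC chi0 chi1 N (fun k => @NC k).
apply: (le_trans h).
apply: (@fresh_speed_le R M g U m a N (fun k => @NC k)
  (fun i x v => normv ('D_v (N \o param i : P -> 'rV[R]_3) x))) => i x v xi v0.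
have dN := C13_diff3 (gauss_C13 phiC2 (i := i)) xi.
set s := Num.sqrt (g i x v v); have s0 : 0 < s by rewrite sqrtr_gt0; exact: metric_pos.
have -> : 'D_(s^-1 *: v) (N \o param i) x = D3 (s^-1 *: v) (N \o param i) x.
  apply: derive3E; apply/derivable_mxP => k1 k2.
  by rewrite (ord1 k1); apply: diff_derivable; exact: dN.
have -> : D3 (s^-1 *: v) (N \o param i) x = s^-1 *: D3 v (N \o param i) x.
  exact: D3Z dN.
by rewrite normvZ gtr0_norm ?invr_gt0// mulrAC mulVf ?mul1r// gt_eqF.
Qed.

(** An arbitrary family in the supremum is completed to a partition, which can only increase its
    area. The partition also competes in the supremum defining the total curvature, and the
    integrals of d omega over its pieces add up to boundary terms. *)
Lemma area_le : (area g U <= (r ^+ 2)%:E * total_curvature g phi U +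
  ((r / 2)%:E * curve_length g (boundary U) + (r ^+ 2 / 2)%:E * gauss_length g phi (boundary U)))%E.
Proof.
apply: ge_ereal_sup => _ [n [i [B [BU mB tB ->]]]].
pose T := ('I_n + 'I_m)%type.
pose A : T -> set M := piece U B a; pose J : T -> chart_index M := piece_chart i a.
have AU k : A k `<=` U `&` dom (J k) by apply: piece_sub.
have AJ k : A k `<=` dom (J k) by move=> p /AU[].
have mA k : measurable (chart (J k) @` A k : set PM) by apply: piece_measurable.
have tA : trivIset setT A by apply: piece_trivIset.
have cA : \bigcup_k A k = U by apply: piece_cover.
pose S k := (\int[lam]_(y in chart (J k) @` A k) (1 * Num.sqrt (\det (first_form g (J k) y)))%:E)%E.
pose K k := (\int[lam]_(y in chart (J k) @` A k)
  (`|gauss_curvature g phi (param (J k) y)| * Num.sqrt (\det (first_form g (J k) y)))%:E)%E.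
have S0 k : (0 <= S k)%E by apply: integral_ge0 => y _; rewrite lee_fin mul1r sqrtr_ge0.
have K0 k : (0 <= K k)%E by apply: integral_ge0 => y _; rewrite lee_fin mulr_ge0 ?sqrtr_ge0.
apply: (@le_trans _ _ (\sum_k S k)%E).
  by rewrite big_sumType/= leeDl// sume_ge0.
apply: (@le_trans _ _ (\sum_k ((r ^+ 2)%:E * K k +
    \int[lam]_(y in chart (J k) @` A k) (exterior_derivative phi (J k) y)%:E))%E).
  by apply: lee_sum => k _; exact: (piece_area_le (@AJ k) (mA k) phi_r).
rewrite big_split/= (pieces_integral AJ mA tA cA) -ge0_sume_distrr//.
apply: leeD.
  rewrite lee_wpmul2l ?lee_fin ?sqr_ge0//.
  exact: (surface_integral_ge g (fun p => `|gauss_curvature g phi p|) AU mA tA).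
apply: (le_trans boundary_sum_le); apply: leeD.
  by apply: lee_wpmul2l; [rewrite lee_fin divr_ge0// ltW|exact: curve_length_ge].
by apply: lee_wpmul2l; [rewrite lee_fin divr_ge0// sqr_ge0|exact: gauss_length_ge].
Qed.

End assembly.

Theorem proposition4 (R : realType) :
  exists C : R,
  forall (M : oriented_surface R) (g : riemannian_metric M) (r : R)
         (phi : M -> 'rV[R]_3) (U : set M),
    closed_surface M ->
    0 < r ->
    isometric_immersion_C2 g phi ->
    (forall p, normv (phi p) <= r) ->
    open U ->
    smooth_boundary U ->
    (area g U <=
       (r ^+ 2)%:E * (total_curvature g phi U
                      + C%:E * gauss_length g phi (boundary U)
                      + (1 / (2 * r))%:E * curve_length g (boundary U)))%E.
Proof.
exists (1 / 2) => M g r phi U cM r0 phiC2 phi_r oU sU.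
have [m [a [chi [[aU chiC chi0 chi1 chi_out] [chi_far acov]]]]] := partition_of_unity_exists cM oU sU.
apply: (le_trans (area_le phiC2 oU aU chiC chi0 chi1 chi_out chi_far acov r0 phi_r)).
(* Nonnegativity, which the empty family witnesses, is what permits distributing products over sums
   of possibly infinite terms. *)
have T0 : (0 <= total_curvature g phi U)%E.
  have := @surface_integral_ge R M g U (fun p => `|gauss_curvature g phi p|) 'I_0
    (fun k => match k with Ordinal _ h => False_rect _ (notF h) end) (fun=> set0).
  by rewrite big_ord0; apply => [[]|[]|[]].
have c0 f : (0 <= curve_integral g (boundary U) f)%E.
  have := @curve_integral_ge R M g (boundary U) f 'I_0
    (fun k => match k with Ordinal _ h => False_rect _ (notF h) end).
  by rewrite big_ord0; apply => [[]|[]].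
have LL : (0 <= (1 / (2 * r))%:E * curve_length g (boundary U))%E.
  by rewrite mule_ge0 ?c0// lee_fin divr_ge0// mulr_ge0// ltW.
have GG : (0 <= (1 / 2)%:E * gauss_length g phi (boundary U))%E.
  by rewrite mule_ge0 ?c0// lee_fin.
have TG := adde_ge0 T0 GG.
rewrite !ge0_muleDr//.
rewrite !muleA -!EFinM -addeA leeD2l// addeC.
have -> : r ^+ 2 * (1 / 2) = r ^+ 2 / 2 by rewrite mul1r.
have -> : r ^+ 2 * (1 / (2 * r)) = r / 2 by field; rewrite gt_eqF.
by [].
Qed.
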